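(* Let $(X,d)$ be a Polish space, $N\ge 2$ an integer, and let $f\colon[0,+\infty[\to\mathbb{R}\cup\{+\infty\}$ be a function with $f(0)=+\infty$ such that $f|_{]0,\infty[}$ is real-valued, continuous and decreasing, and $\lim_{t\to0+}f(t)=+\infty$. Define $c(x_1,\ldots,x_N)=\sum_{1\le i<j\le N}f(d(x_i,x_j))$ on $X^N$. Let $(\rho_n)_{n\in\mathbb{N}}$ be a sequence of Borel probability measures on $X$ converging weakly to a Borel probability measure $\rho_\infty$ on $X$ such that (A) $\lim_{r\to0}\sup_{x\in X}\rho_\infty(B(x,r))<\frac{1}{N(N-1)^2}$, and (B) there exist a point $o\in X$ and a radius $r_0>0$ such that $\int_{X\setminus B(o,r_0)}f(2d(x,o))\,\mathrm{d}\rho_\infty(x)>-\infty$. Let $\beta>0$ be such that $\sup_{x\in X}\rho_\infty(B(x,\beta))<\frac{1}{N(N-1)^2}$, and assume that, for some $0<\alpha<f^{-1}\left(\frac{N^2(N-1)}{2}f(\beta)\right)$, the restriction $f|_{[\alpha,\infty[}$ is Lipschitz. If, with $o$ the point in (B), $$\int_{X\setminus B(o,r)}f(2d(x,o))\,\mathrm{d}\rho_n(x)\to0\quad\text{as } r\to\infty,\ \text{uniformly in } n,$$ then $$\lim_{n\to\infty}C(\rho_n)=C(\rho_\infty).$$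
   Context: For a Borel probability measure $\rho$ on $X$, $\Gamma(\rho)$ is the set of Borel probability measures on $X^N$ all of whose $N$ marginals equal $\rho$, and $C(\rho)=\inf_{\gamma\in\Gamma(\rho)}\int_{X^N}c\,\mathrm{d}\gamma$ is the optimal transportation cost. $f^{-1}$ denotes the left-inverse $f^{-1}(t)=\inf\{s>0 : f(s)=t\}$ (with $\inf\emptyset=+\infty$). $B(x,r)$ is the ball of center $x$ and radius $r$. ''Decreasing'' means non-increasing. Weak convergence is convergence against bounded continuous functions. *)

(* Defs.v *)
From HB Require Import structures.
From mathcomp Require Import all_boot all_order all_algebra.
From mathcomp Require Import all_classical all_reals all_analysis.

Set Implicit Arguments.
Unset Strict Implicit.
Unset Printing Implicit Defensive.

Import Order.TTheory GRing.Theory Num.Theory.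
Import numFieldNormedType.Exports.

Local Open Scope classical_set_scope.
Local Open Scope ring_scope.

HB.mixin Record isSeparable T & Topological T := {
  separable : exists2 D : set T, countable D & dense D
}.

(* The point is needed by [measurableType]; it costs nothing, since a space
   carrying a probability measure is nonempty. *)
#[short(type="polishMetricType")]
HB.structure Definition PolishMetric (R : realType) :=
  { T of Pointed T & Metric R T & Complete T & isSeparable T }.

(* Makes the product topology a [ptopologicalType]. *)
HB.instance Definition _ (I : Type) (T : I -> ptopologicalType) :=
  Pointed.on (prod_topology T).

Definition borelType (T : ptopologicalType) : measurableType (@open T).-sigma :=
  g_sigma_algebraType (@open T).

Section defs.
Context {R : realType}.

Definition weak_cvg (X : ptopologicalType)
    (rho : nat -> probability (borelType X) R)
    (rhoo : probability (borelType X) R) : Prop :=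
  forall g : X -> R, continuous g -> bounded_fun g ->
    (\int[rho n]_x (g x)%:E)%E @[n --> \oo] --> (\int[rhoo]_x (g x)%:E)%E.

(* The infimum is taken in \bar R, so that it is +oo when t is not attained. *)
Definition left_inv_fun (f : R -> \bar R) (t : \bar R) : \bar R :=
  ereal_inf [set s%:E | s in [set s : R | 0 < s /\ f s = t]].

Section transport.
Context {X : polishMetricType R} (N : nat).

Definition pair_cost (f : R -> \bar R) (x : 'I_N -> X) : \bar R :=
  (\sum_(i < N) \sum_(j < N | (i < j)%N) f (mdist (x i) (x j)))%E.

Definition couplings (rho : probability (borelType X) R) :
    set (probability (borelType {ptws 'I_N -> X}) R) :=
  [set gamma | forall (i : 'I_N) (A : set (borelType X)), measurable A ->
    gamma [set x | A (x i)] = rho A].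

Definition transport_cost (f : R -> \bar R)
    (rho : probability (borelType X) R) : \bar R :=
  ereal_inf [set (\int[gamma]_x pair_cost f x)%E | gamma in couplings rho].

End transport.
End defs.

(* Main.v *)
Require Import Defs.
From HB Require Import structures.
From mathcomp Require Import all_boot all_order all_algebra.
From mathcomp Require Import all_classical all_reals all_analysis.
From mathcomp Require Import measurable_realfun.
From mathcomp Require Import ring lra.

(** Two things prevent the cost of a plan from depending continuously on its
    marginal: [f] is infinite at [0], and it may tend to [-oo] at infinity.

    At infinity: one of [x], [y] is at distance at least [mdist x y / 2] of [o],
    and [f] decreases, so [f (mdist x y)] becomes nonnegative once the gauges of
    [x] and [y] are added, the gauge of [x] being the negative part of
    [f (2 * mdist x o)] ([renormalized_ge0]). Under a plan with marginals [rho]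
    this adds to the cost a constant that depends on [rho] only
    ([integral_pair_cost]). The tails of the gauge are uniformly small along the
    sequence ([gauge_tails]), hence these constants converge
    ([tight_integral_cvg]), and the renormalized cost can be studied instead.

    Near the diagonal: truncate [f] at a distance [delta], and call a
    configuration crowded at [i] if another of its points is closer than [delta]
    to the [i]-th one. Take [x] crowded at [i], draw [y] from the same plan and
    exchange the [i]-th points of [x] and [y], which changes no marginal. Balls
    of radius [b] have mass at most [kappa] with [2 * (N - 1) * kappa < 1], so
    with a probability bounded below all the pairs created are at distance at
    least [b] ([good_mass]): a pair that cost at least [f delta] is replaced by
    pairs of bounded cost ([pair_energy_swap]). Thus a nearly optimal plan for the
    truncated cost charges little the crowded configurations ([few_crowded]), and
    exchanging these against uncrowded ones removes them at a small cost
    ([uncrowd]). On the plan so obtained the truncated and the true cost agree.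
    All the estimates are uniform over the measures with given [kappa] and given
    tails of the gauge ([uncrowding_scale]).

    The truncated cost is uniformly continuous, this being where the Lipschitz
    condition enters, and it is dominated by gauges. Measures that are weakly
    close have a coupling, with a density for their product, under which points
    seldom move far ([transfer_density_weak_cvg]); redrawing the points of a
    configuration one after the other with this density turns a plan for the
    first measure into a plan for the second and increases the truncated cost
    little ([transfer_all]).

    Together these facts bound the cost of either of two close measures by that of
    the other, up to the constants and a small error ([transport_cost_le]). *)

Set Implicit Arguments.
Unset Strict Implicit.
Unset Printing Implicit Defensive.

Import Order.TTheory GRing.Theory Num.Theory.
Import numFieldNormedType.Exports.

Local Open Scope classical_set_scope.
Local Open Scope ring_scope.

(** * Distances and measurability in Polish spaces and their finite powers *)

Section topology.
Context {R : realType} {X : polishMetricType R}.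

Lemma dense_sequence :
  exists q : nat -> X, forall x e, 0 < e -> exists n, mdist x (q n) < e.
Proof.
have [D cD dD] := @separable R X.
have [p Dp] : D !=set0.
  have [x [_ Dx]] : setT `&` D !=set0.
    by apply: dD; [exists point|exact: openT].
  by exists x.
have /pfcard_geP[D0|[g]] := cD.
  by move: Dp; rewrite D0.
exists g => x e e0.
have [y [xy Dy]] : (ball x e)° `&` D !=set0.
  by apply: dD; [exists x; exact: nbhsx_ballx|exact: open_interior].
have [n _ gny] := @surj _ _ _ _ g _ Dy.
exists n; rewrite gny.
by move/interior_subset: xy; rewrite ballEmdist.
Qed.

Lemma mdistC (x y : X) : mdist x y = mdist y x.
Proof. exact: metric_sym. Qed.

Lemma mdist_triangle (x y z : X) : mdist x z <= mdist x y + mdist y z.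
Proof. exact: metric_triangle. Qed.

Lemma mdist_dist (x y z : X) : `|mdist x z - mdist y z| <= mdist x y.
Proof.
have := mdist_triangle x y z; have := mdist_triangle y x z.
rewrite (mdistC y x) ler_norml => ? ?; apply/andP; split; lra.
Qed.

(** The pointwise topology on configurations is that of the maximal distance:
    what makes boxes enough to test measurability. *)
Lemma ptws_open_box N (U : set {ptws 'I_N -> X}) x : open U -> U x ->
  exists2 e : R, 0 < e & forall y, (forall i, mdist (x i) (y i) < e) -> U y.
Proof.
move=> oU Ux.
pose F := filter_from [set e : R | 0 < e]
  (fun e => [set y : {ptws 'I_N -> X} | forall i, mdist (x i) (y i) < e]).
have FF : Filter F.
  apply: filter_from_filter; first by exists 1 => /=.
  move=> i j /= i0 j0; exists (Num.min i j); first by rewrite /= lt_min i0.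
  by move=> y /= h; split=> k; move: (h k); rewrite lt_min => /andP[].
have : F --> x.
  apply/cvg_sup => i A /= [V] [[W] oW <-] Wx WA.
  apply: filterS WA _.
  have /nbhs_ballP[e /= e0 eW] : nbhs (x i) W by apply: open_nbhs_nbhs.
  by exists e => //= y /(_ i) xy; apply: eW; rewrite ballEmdist.
move=> /(_ U) [|e /= e0 eU]; first by apply: open_nbhs_nbhs.
by exists e => // y xy; exact: eU.
Qed.

Lemma continuous_mdistl (p : X) : continuous (fun x : X => mdist x p).
Proof.
move=> x; apply/cvgrPdist_lt => e e0; near=> t.
rewrite (le_lt_trans (mdist_dist _ _ _))//.
near: t; apply/nbhs_ballP; exists e => //= y; by rewrite ballEmdist.
Unshelve. all: by end_near. Qed.

Lemma open_mdist_lt (p : X) (r : R) : open [set x | mdist x p < r].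
Proof.
rewrite -[X in open X]/((mdist ^~ p) @^-1` [set t : R | t < r]).
by apply: open_comp; [move=> x _; exact: continuous_mdistl|exact: open_lt].
Qed.

Lemma measurable_mball (x : X) (r : R) : measurable (ball x r : set (borelType X)).
Proof.
rewrite (_ : ball x r = [set y : X | mdist y x < r]).
  by apply: sub_sigma_algebra; exact: open_mdist_lt.
by rewrite ballEmdist; apply/seteqP; split => y /=; rewrite mdistC.
Qed.

End topology.

Section measurability.
Context {R : realType} {X : polishMetricType R}.
Context d (T : measurableType d).

Lemma continuous_measurable_borel (g : X -> R) :
  continuous g -> measurable_fun [set: borelType X] g.
Proof.
move=> /continuousP cg.
apply: (measurability _ (RGenOInfty.measurableE R)).
move=> _ [_ [a ->] <-]; rewrite setTI.
by apply: sub_sigma_algebra; apply: cg; exact: interval_open.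
Qed.

Lemma measurable_mdistl (p : X) :
  measurable_fun [set: borelType X] (fun x : X => mdist x p).
Proof. apply: continuous_measurable_borel; exact: continuous_mdistl. Qed.

(** The Borel sets of the power are the product ones: by separability, an open
    set is a countable union of boxes centred on a dense sequence. *)
Lemma measurable_coordP N (h : T -> borelType {ptws 'I_N -> X}) :
  (forall i, measurable_fun [set: T] (fun t => h t i : borelType X)) ->
  measurable_fun [set: T] h.
Proof.
move=> mh.
have [q qd] := @dense_sequence R X.
apply: (@measurability _ _ T (borelType {ptws 'I_N -> X}) setT h (@open {ptws 'I_N -> X}) (erefl _)) => //.
move=> _ [U oU <-]; rewrite setTI.
pose box (c : {ffun 'I_N -> nat} * nat) : set {ptws 'I_N -> X} :=
  [set y | forall i, mdist (y i) (q (c.1 i)) < (c.2.+1)%:R^-1].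
have -> : h @^-1` U =
    \bigcup_c (if `[< box c `<=` U >] then h @^-1` box c else set0).
  apply/seteqP; split => [t Ut|t [c _]]; last by case: asboolP => // cU /cU.
  have [e e0 eU] := ptws_open_box oU Ut.
  have [k ke] : exists k : nat, (k.+1)%:R^-1 < e / 2.
    have e20 : 0 < e / 2 by rewrite divr_gt0.
    have [k _ hk] := near_infty_natSinv_lt (PosNum e20).
    by exists k; exact: (hk k (leqnn k)).
  have /choice[n hn] : forall i, exists n, mdist (h t i) (q n) < (k.+1)%:R^-1.
    by move=> i; apply: qd; rewrite invr_gt0.
  (* half of [e] for the box around the centre, half for the centre itself *)
  exists ([ffun i => n i], k) => //=.
  rewrite asboolT => [i /=|y /= hy]; first by rewrite ffunE.
  apply: eU => i.
  move: (hy i) (hn i) ke; rewrite /= ffunE => hyi hni ke.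
  move: hyi hni ke.
  have := mdist_triangle (h t i) (q (n i)) (y i).
  rewrite (mdistC (q (n i))); move: k.+1%:R^-1 => w; lra.
apply: countable_bigcupT_measurable; first exact: countableP.
move=> c; case: ifP => // _.
have -> : h @^-1` box c = ~` \bigcup_i
    ~` (h ^~ i @^-1` [set x | mdist x (q (c.1 i)) < (c.2.+1)%:R^-1]).
  rewrite setC_bigcup; apply/seteqP; split=> t /= ht i.
    by move=> _; rewrite setCK; exact: ht.
  by have := ht i I; rewrite setCK.
apply: measurableC; apply: countable_bigcupT_measurable => // i.
apply: measurableC.
rewrite -[X in measurable X]setTI; apply: mh => //.
apply: sub_sigma_algebra.
exact: open_mdist_lt.
Qed.

(** The distance is the infimum of [mdist u q + mdist v q] over a dense sequence,
    whence its measurability for the product of the Borel sigma-algebras. *)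
Lemma measurable_mdist (u v : T -> borelType X) :
  measurable_fun [set: T] u -> measurable_fun [set: T] v ->
  measurable_fun [set: T] (fun t => mdist (u t : X) (v t)).
Proof.
move=> mu mv; have [q qd] := @dense_sequence R X.
have -> : (fun t => mdist (u t : X) (v t)) =
  (fun t => infs (fun n => mdist (u t : X) (q n) + mdist (v t : X) (q n)) 0).
  apply/funext => t; rewrite /infs /sdrop; apply/eqP; rewrite eq_le; apply/andP; split.
    apply: lb_le_inf; first by eexists; exists 0%N.
    move=> _ [n _ <-]; rewrite (mdistC (v t)); exact: mdist_triangle.
  apply/ler_addgt0Pr => e e0.
  have e20 : 0 < e / 2 by rewrite divr_gt0.
  have [n vn] := qd (v t) (e / 2) e20.
  apply: (@le_trans _ _ (mdist (u t : X) (q n) + mdist (v t : X) (q n))).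
    apply: ge_inf; last by exists n.
    by exists 0 => _ [m _ <-]; rewrite addr_ge0// mdist_ge0.
  have := mdist_triangle (u t : X) (v t) (q n); lra.
apply: (@measurable_fun_infs _ _ _ setT
  (fun n t => mdist (u t : X) (q n) + mdist (v t : X) (q n))) => //.
  by move=> t _; exists 0 => _ [m _ <-]; rewrite addr_ge0// mdist_ge0.
by move=> n; apply: measurable_funD;
  apply: (measurableT_comp (measurable_mdistl _)).
Qed.

End measurability.

(** * Measures obtained by pushing a density forward *)

Section image_measure_with_density.
Local Open Scope ereal_scope.
Context {R : realType} d1 d2 (W : measurableType d1) (T : measurableType d2).
Variables (P : {measure set W -> \bar R}) (h : W -> R) (S : W -> T).
Hypotheses (h0 : forall w, (0 <= h w)%R) (mh : measurable_fun [set: W] h).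
Hypothesis mS : measurable_fun [set: W] S.

(** The vacuous [let] makes the definition depend on the hypotheses under which
    it is a measure, so that this structure can be declared on it. *)
Definition density_image (A : set T) :=
  let _ := (h0, mh, mS) in \int[P]_w ((h w)%:E * \d_(S w) A).

Let mhE : measurable_fun [set: W] (fun w => (h w)%:E).
Proof. exact/measurable_EFinP. Qed.

Let mdS A : measurable A -> measurable_fun [set: W] (fun w => \d_(S w) A : \bar R).
Proof.
move=> mA; apply: (@measurableT_comp _ _ _ _ _ _ (fun t => \d_t A : \bar R)) mS.
exact: measurable_fun_dirac.
Qed.

Let density_image0 : density_image set0 = 0.
Proof. by rewrite /density_image/= integral0_eq// => w _; rewrite measure0 mule0. Qed.

Let density_image_ge0 A : 0 <= density_image A.
Proof. by apply: integral_ge0 => w _; rewrite mule_ge0// lee_fin. Qed.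

Let density_image_semi_sigma_additive : semi_sigma_additive density_image.
Proof.
move=> F mF tF mUF.
have mk k : measurable_fun [set: W] (fun w => (h w)%:E * \d_(S w) (F k)).
  by apply: emeasurable_funM => //; exact: mdS.
have hk k w : 0 <= (h w)%:E * \d_(S w) (F k) by rewrite mule_ge0// lee_fin.
have -> : density_image (\bigcup_n F n) = \sum_(k <oo) density_image (F k).
  rewrite -integral_nneseries//; apply: eq_integral => w _.
  by rewrite measure_semi_bigcup// nneseriesZl.
exact: is_cvg_nneseries.
Qed.

HB.instance Definition _ := isMeasure.Build _ _ R density_image
  density_image0 density_image_ge0 density_image_semi_sigma_additive.

Let integral_density_image_indic A : measurable A ->
  \int[density_image]_t (\1_A t)%:E = \int[P]_w ((h w)%:E * (\1_A (S w))%:E).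
Proof. by move=> mA; rewrite integral_indic// setIT. Qed.

Import HBNNSimple.

Let integral_density_image_nnsfun (f : {nnsfun T >-> R}) :
  \int[density_image]_t (f t)%:E = \int[P]_w ((h w)%:E * (f (S w))%:E).
Proof.
have fE t : (f t)%:E = \sum_(y \in range f) (y%:E * (\1_(f @^-1` [set y]) t)%:E).
  rewrite (fimfunE f) -fsumEFin//.
transitivity (\int[density_image]_t
    \sum_(y \in range f) (y%:E * (\1_(f @^-1` [set y]) t)%:E)).
  by apply: eq_integral => t _; exact: fE.
transitivity (\int[P]_w ((h w)%:E *
    \sum_(y \in range f) (y%:E * (\1_(f @^-1` [set y]) (S w))%:E))); last first.
  by apply: eq_integral => w _; rewrite -fE.
have mf1 y : measurable_fun [set: T] (fun t => y%:E * (\1_(f @^-1` [set y]) t)%:E).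
  apply: measurable_funeM; exact/measurable_EFinP.
have f1_ge0 y t : 0 <= y%:E * (\1_(f @^-1` [set y]) t)%:E.
  exact: nnfun_muleindic_ge0.
rewrite ge0_integral_fsum//.
transitivity (\int[P]_w \sum_(y \in range f)
    ((h w)%:E * (y%:E * (\1_(f @^-1` [set y]) (S w))%:E))); last first.
  by apply: eq_integral => w _; rewrite ge0_mule_fsumr.
rewrite ge0_integral_fsum//; last 2 first.
- move=> y; apply: emeasurable_funM => //.
  exact: (measurableT_comp (mf1 y)).
- by move=> y w _; rewrite mule_ge0// lee_fin.
apply: eq_fsbigr => y /[!inE] -[t _ <-].
rewrite ge0_integralZl//; first last.
- by rewrite lee_fin.
- apply/measurable_EFinP => //.
rewrite integral_density_image_indic//.
rewrite -ge0_integralZl//; first last.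
- by rewrite lee_fin.
- by move=> w _; rewrite mule_ge0// lee_fin.
- by apply: emeasurable_funM => //; apply/measurable_EFinP; apply: measurableT_comp => //.
by apply: eq_integral => w _; rewrite muleCA.
Qed.

Lemma ge0_integral_density_image (phi : T -> \bar R) :
  measurable_fun [set: T] phi -> (forall t, 0 <= phi t) ->
  \int[density_image]_t phi t = \int[P]_w ((h w)%:E * phi (S w)).
Proof.
move=> mphi phi0.
pose g := nnsfun_approx measurableT mphi.
pose gE := fun n => EFin \o g n.
have mgE n : measurable_fun [set: T] (gE n) by exact/measurable_EFinP.
have gE_ge0 n x : 0 <= gE n x by rewrite lee_fin.
have nd_gE x : {homo gE ^~ x : n m / (n <= m)%O >-> n <= m}.
  by move=> *; exact/lefP/nd_nnsfun_approx.
have gphi t : gE ^~ t @ \oo --> phi t by exact: cvg_nnsfun_approx.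
transitivity (limn (fun n => \int[density_image]_x gE n x)).
  rewrite -monotone_convergence//; apply: eq_integral => t _.
  exact/esym/cvg_lim.
transitivity (limn (fun n => \int[P]_w ((h w)%:E * gE n (S w)))).
  by apply: congr_lim; apply/funext => n; exact: integral_density_image_nnsfun.
rewrite -[LHS]monotone_convergence//; last 3 first.
- by move=> n; apply: emeasurable_funM => //; exact: (measurableT_comp (mgE n)).
- by move=> n w _; rewrite mule_ge0// lee_fin.
- by move=> w _ m n mn; apply: lee_wpmul2l; [rewrite lee_fin|exact: nd_gE].
apply: eq_integral => w _; apply/cvg_lim => //.
exact: cvgeZl.
Qed.

End image_measure_with_density.

Lemma addIe (R : realType) (z x y : \bar R) :
  (z \is a fin_num -> x + z = y + z -> x = y)%E.
Proof. by move=> zfin xy; rewrite -(addeK x zfin) xy addeK. Qed.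

Section mass_one.
Local Open Scope ereal_scope.
Context {R : realType} d (T : measurableType d).
Variables (m : {measure set T -> \bar R}) (m1 : m [set: T] = 1).

(** A copy of [m] that carries [m1], on which the structure of probability can
    be declared. *)
Definition mass_one : set T -> \bar R := let _ := m1 in m.

HB.instance Definition _ := Measure.copy mass_one m.
HB.instance Definition _ := Measure_isProbability.Build _ _ _ mass_one m1.

Lemma ge0_integral_probability :
  exists P : probability T R, forall phi : T -> \bar R,
    \int[P]_t phi t = \int[m]_t phi t.
Proof.
exists [the probability T R of mass_one] => phi; exact: eq_measure_integral.
Qed.

End mass_one.

Section swap.
Local Open Scope ereal_scope.
Context {R : realType}.

(** Moving [t] to [S (t, u)], with [u] drawn from [nu] with density [p]. *)
Lemma transported_probability d1 d2 d3 (T : measurableType d1)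
    (U : measurableType d2) (V : measurableType d3)
    (gamma : probability T R) (nu : probability U R) (p : T * U -> R)
    (S : T * U -> V) :
  measurable_fun [set: T * U] p -> (forall w, (0 <= p w)%R) ->
  measurable_fun [set: T * U] S ->
  \int[gamma \x nu]_w (p w)%:E = 1 ->
  exists gamma' : probability V R, forall phi : V -> \bar R,
    measurable_fun [set: V] phi -> (forall x, 0 <= phi x) ->
    \int[gamma']_x phi x = \int[gamma \x nu]_w ((p w)%:E * phi (S w)).
Proof.
move=> mp p0 mS p1.
pose m := [the {measure set V -> \bar R} of density_image (gamma \x nu) p0 mp mS].
have mT : m setT = 1.
  rewrite /m/= /density_image -[RHS]p1; apply: eq_integral => w _.
  by rewrite diracT mule1.
have [P hP] := ge0_integral_probability mT.
by exists P => phi mphi phi0; rewrite hP ge0_integral_density_image.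
Qed.

(** Pairs drawn from [gamma \x gamma] with density [q] are removed from [gamma]
    and replaced by their images under [S1] and [S2]; the bound on the marginals
    of [q] says that there is enough mass to remove. The balance is written
    without subtraction, so that it also holds when the integrals are infinite. *)
Lemma swapped_probability d (T : measurableType d) (gamma : probability T R)
    (q : T * T -> R) (S1 S2 : T * T -> T) :
  measurable_fun [set: T * T] q -> (forall w, (0 <= q w)%R) ->
  measurable_fun [set: T * T] S1 -> measurable_fun [set: T * T] S2 ->
  (forall z, \int[gamma]_y (q (z, y))%:E + \int[gamma]_x (q (x, z))%:E <= 1) ->
  exists gamma' : probability T R, forall phi : T -> \bar R,
    measurable_fun [set: T] phi -> (forall x, 0 <= phi x) ->
    \int[gamma']_x phi x
      + \int[gamma \x gamma]_w ((q w)%:E * (phi w.1 + phi w.2)) =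
    \int[gamma]_x phi x
      + \int[gamma \x gamma]_w ((q w)%:E * (phi (S1 w) + phi (S2 w))).
Proof.
move=> mq q0 mS1 mS2 q12.
have mqE : measurable_fun [set: T * T] (fun w => (q w)%:E) by exact/measurable_EFinP.
have q0E w : 0 <= (q w)%:E by rewrite lee_fin.
pose q1 z := \int[gamma]_y (q (z, y))%:E.
pose q2 z := \int[gamma]_x (q (x, z))%:E.
have q1_ge0 z : 0 <= q1 z by exact: integral_ge0.
have q2_ge0 z : 0 <= q2 z by exact: integral_ge0.
have q1_fin z : q1 z \is a fin_num.
  rewrite ge0_fin_numE// (@le_lt_trans _ _ 1)// ?ltry//.
  by apply: le_trans (q12 z); rewrite leeDl//; exact: q2_ge0.
have q2_fin z : q2 z \is a fin_num.
  rewrite ge0_fin_numE// (@le_lt_trans _ _ 1)// ?ltry//.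
  by apply: le_trans (q12 z); rewrite leeDr//; exact: q1_ge0.
have mq1 : measurable_fun [set: T] q1 := @measurable_fun_fubini_tonelli_F _ _ _ _ _ gamma _ mqE q0E.
have mq2 : measurable_fun [set: T] q2 := @measurable_fun_fubini_tonelli_G _ _ _ _ _ gamma _ mqE q0E.
(* the density of the mass left in place *)
pose r z := (1 - fine (q1 z) - fine (q2 z))%R.
have r0 z : (0 <= r z)%R.
  have := q12 z; rewrite -/(q1 z) -/(q2 z) -(fineK (q1_fin z)) -(fineK (q2_fin z)).
  by rewrite -EFinD lee_fin /r; lra.
have mr : measurable_fun [set: T] r.
  apply: measurable_funB; last by apply: measurableT_comp.
  by apply: measurable_funB => //; apply: measurableT_comp.
pose m0 := [the {measure set T -> \bar R} of density_image gamma r0 mr (@measurable_id _ _ setT)].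
pose m1 := [the {measure set T -> \bar R} of density_image (gamma \x gamma) q0 mq mS1].
pose m2 := [the {measure set T -> \bar R} of density_image (gamma \x gamma) q0 mq mS2].
pose m := measure_add m0 (measure_add m1 m2).
have mE (phi : T -> \bar R) : measurable_fun setT phi -> (forall x, 0 <= phi x) ->
    \int[m]_x phi x + \int[gamma \x gamma]_w ((q w)%:E * (phi w.1 + phi w.2)) =
    \int[gamma]_x phi x
      + \int[gamma \x gamma]_w ((q w)%:E * (phi (S1 w) + phi (S2 w))).
  move=> mphi phi0.
  have mqphi (S : T * T -> T) : measurable_fun setT S ->
      measurable_fun setT (fun w => (q w)%:E * phi (S w)).
    by move=> mS; apply: emeasurable_funM => //; exact: (measurableT_comp mphi).
  have qphi0 (S : T * T -> T) w : 0 <= (q w)%:E * phi (S w) by rewrite mule_ge0.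
  have qD (U V : T * T -> T) : measurable_fun setT U -> measurable_fun setT V ->
      \int[gamma \x gamma]_w ((q w)%:E * (phi (U w) + phi (V w))) =
      \int[gamma \x gamma]_w ((q w)%:E * phi (U w)) +
      \int[gamma \x gamma]_w ((q w)%:E * phi (V w)).
    move=> mU mV; rewrite -ge0_integralD//; [|exact: mqphi|exact: mqphi].
    by apply: eq_integral => w _; rewrite ge0_muleDr.
  rewrite !qD//.
  have -> : \int[gamma \x gamma]_w ((q w)%:E * phi w.1) = \int[gamma]_x (q1 x * phi x).
    rewrite fubini_tonelli1//; last exact: mqphi measurable_fst.
    apply: eq_integral => x _; rewrite /fubini_F/= ge0_integralZr//.
    exact: (measurableT_comp mqE).
  have -> : \int[gamma \x gamma]_w ((q w)%:E * phi w.2) = \int[gamma]_x (q2 x * phi x).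
    rewrite fubini_tonelli2//; last exact: mqphi measurable_snd.
    apply: eq_integral => x _; rewrite /fubini_G/= ge0_integralZr//.
    exact: (measurableT_comp mqE).
  rewrite ge0_integral_measure_add// ge0_integral_measure_add//.
  rewrite !ge0_integral_density_image//=.
  rewrite addeAC; congr (_ + _).
  rewrite -ge0_integralD//; first last.
  - exact: emeasurable_funM.
  - by move=> x _; rewrite mule_ge0.
  - exact: emeasurable_funM.
  - by move=> x _; rewrite mule_ge0.
  rewrite -ge0_integralD//; first last.
  - by apply: emeasurable_funD; exact: emeasurable_funM.
  - by move=> x _; rewrite adde_ge0// mule_ge0.
  - by apply: emeasurable_funM => //; exact/measurable_EFinP.
  - by move=> x _; rewrite mule_ge0// lee_fin.
  apply: eq_integral => x _.
  rewrite -ge0_muleDl// -ge0_muleDl; [|by rewrite lee_fin|exact: adde_ge0].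
  rewrite -(fineK (q1_fin x)) -(fineK (q2_fin x)) -!EFinD.
  by rewrite (_ : r x + _ = 1)%R ?mul1e// /r; lra.
have m1T : m [set: T] = 1.
  have := mE (cst 1) (measurable_cst _) (fun _ => lee01).
  rewrite !integral_cst//= !mul1e probability_setT.
  have : \int[gamma \x gamma]_w ((q w)%:E * (1 + 1)) \is a fin_num.
    rewrite ge0_integralZr// ?adde_ge0// fin_numM//.
    rewrite ge0_fin_numE; last exact: integral_ge0.
    rewrite fubini_tonelli1// (@le_lt_trans _ _ (\int[gamma]_x cst 1 x))//.
      apply: ge0_le_integral => // x _ /=.
      by apply: le_trans (q12 x); rewrite leeDl//; exact: q2_ge0.
    by rewrite integral_cst//= mul1e; rewrite (_ : gamma setT = 1) ?ltry// probability_setT.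
  by move=> /addIe; exact.
have [P hP] := ge0_integral_probability m1T.
by exists P => phi mphi phi0; rewrite hP mE.
Qed.

End swap.

(** * Marginals of a measure on configurations *)

Section marginals.
Context {R : realType} {X : polishMetricType R} {N : nat}.
Local Notation BX := (borelType X).
Local Notation BXN := (borelType {ptws 'I_N -> X}).

(** Different marginals are allowed for different coordinates, because plans are
    carried from one measure to another one coordinate at a time. *)
Definition has_marginals (gamma : probability BXN R)
    (sigma : 'I_N -> probability BX R) :=
  forall i (A : set BX), measurable A -> gamma [set x | A (x i)] = sigma i A.

Lemma measurable_coord (i : 'I_N) : measurable_fun [set: BXN] (fun x => x i : BX).
Proof.
apply: (@measurability _ _ BXN BX setT _ (@open X) (erefl _)).
move=> _ [U oU <-]; rewrite setTI; apply: sub_sigma_algebra.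
apply: (@open_comp {ptws 'I_N -> X} X (fun x => x i)) => // x _.
exact: (@proj_continuous 'I_N (fun=> X) i x).
Qed.

Lemma ge0_integral_marginal gamma sigma i (psi : BX -> \bar R) :
  has_marginals gamma sigma -> measurable_fun [set: BX] psi ->
  (forall x, 0 <= psi x)%E ->
  (\int[gamma]_x psi (x i) = \int[sigma i]_x psi x)%E.
Proof.
move=> gs mpsi psi0.
rewrite -[LHS](ge0_integral_pushforward (measurable_coord i) gamma measurableT mpsi)//.
apply: eq_measure_integral => [|mf A mA _]; first exact: measurable_coord.
exact: gs.
Qed.

Lemma has_marginalsP (gamma : probability BXN R) (sigma : 'I_N -> probability BX R) :
  (forall i (psi : BX -> \bar R), measurable_fun [set: BX] psi ->
    (forall x, 0 <= psi x)%E ->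
    (\int[gamma]_x psi (x i) = \int[sigma i]_x psi x)%E) ->
  has_marginals gamma sigma.
Proof.
move=> h i A mA.
have mAE : measurable_fun [set: BX] (fun x => (\1_A x)%:E : \bar R).
  exact/measurable_EFinP.
have mi : measurable [set x : BXN | A (x i)].
  by rewrite -[X in measurable X]setTI; exact: measurable_coord.
have <- : (\int[sigma i]_x (\1_A x)%:E = sigma i A)%E.
  by rewrite integral_indic// setIT.
rewrite -h//.
have -> : gamma [set x | A (x i)] =
    (\int[gamma]_x (\1_[set x : BXN | A (x i)] x)%:E)%E.
  by rewrite integral_indic// setIT.
by [].
Qed.

Definition replace_coord (i : 'I_N) (w : BXN * BX) : BXN :=
  fun j => if j == i then w.2 else w.1 j.

Lemma measurable_replace_coord i : measurable_fun [set: BXN * BX] (replace_coord i).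
Proof.
apply: measurable_coordP => j; rewrite /replace_coord.
case: eqP => _; first exact: measurable_snd.
exact: (measurableT_comp (measurable_coord j) measurable_fst).
Qed.

End marginals.

(** * Carrying a plan from one measure to another *)

Section transfer.
Context {R : realType} {X : polishMetricType R}.
Local Notation BX := (borelType X).

Definition far (eps : R) (w : BX * BX) : \bar R :=
  ((eps <= mdist (w.1 : X) (w.2 : X))%R%:R)%:E.

Lemma measurable_far eps : measurable_fun [set: BX * BX] (far eps).
Proof.
apply/measurable_EFinP.
have md : measurable_fun [set: BX * BX] (fun w => mdist (w.1 : X) (w.2 : X)).
  by apply: measurable_mdist; [exact: measurable_fst|exact: measurable_snd].
have -> : (fun w : BX * BX => ((eps <= mdist (w.1 : X) (w.2 : X))%R%:R : R)) =
    \1_((fun w : BX * BX => mdist (w.1 : X) (w.2 : X)) @^-1` `[eps, +oo[).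
  by apply/funext => w; rewrite indicE preimage_itvcy mem_setE.
apply: measurable_indic; rewrite -[X in measurable X]setTI; exact: md.
Qed.

Lemma far_ge0 eps w : (0 <= far eps w)%E.
Proof. by rewrite lee_fin. Qed.

(** A coupling of [mu] and [nu] that moves at most a mass [eps] by [eps] or more.
    Asking for a density with respect to the product avoids disintegration: it
    is a kernel from [mu] to [nu] and from [nu] to [mu] at the same time. *)
Definition transfer_density (mu nu : probability BX R) (eps : R) (p : BX * BX -> R) :=
  [/\ measurable_fun [set: BX * BX] p, (forall w, 0 <= p w),
      (forall x, \int[nu]_y (p (x, y))%:E = 1)%E,
      (forall y, \int[mu]_x (p (x, y))%:E = 1)%E &
      (\int[mu \x nu]_w ((p w)%:E * far eps w) <= eps%:E)%E].

Definition excess (g : BX -> R) (A : R) (x : BX) := Num.max 0 (g x - A).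

Lemma excess_ge0 g A x : 0 <= excess g A x.
Proof. by rewrite le_max lexx. Qed.

Lemma le_excess g A x : g x <= A + excess g A x.
Proof. by rewrite -lerBlDl le_max lexx orbT. Qed.

Lemma measurable_excess g A : measurable_fun [set: BX] g ->
  measurable_fun [set: BX] (fun x => (excess g A x)%:E).
Proof.
move=> mg; apply/measurable_EFinP; apply: measurable_maxr => //.
exact: measurable_funB.
Qed.

Section step.
Context {N : nat}.
Local Notation BXN := (borelType {ptws 'I_N -> X}).
Variables (g : BX -> R) (phi : BXN -> R) (omega K C eps A tau : R).
Hypotheses (mg : measurable_fun [set: BX] g) (g0 : forall x, 0 <= g x).
Hypotheses (mphi : measurable_fun [set: BXN] phi) (phi0 : forall x, 0 <= phi x).
Hypotheses (eps0 : 0 < eps) (K0 : 0 <= K) (C0 : 0 <= C) (A0 : 0 <= A) (omega0 : 0 <= omega).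
Hypothesis phi_near : forall x x' : BXN,
  (forall a, mdist (x a : X) (x' a) < eps) -> phi x' <= phi x + omega.
Hypothesis phi_far : forall x : BXN, phi x <= K + C * \sum_(a < N) g (x a).

Local Open Scope ereal_scope.

(** Given [x], the [i]-th point is redrawn according to [p (x i, _)]. If it moves
    by less than [eps] the cost increases by at most [omega]; otherwise it is
    bounded through [phi_far], where [g] is split at height [A]: what lies below
    [A] is multiplied by the small probability [eps] of a long move, and what
    lies above has integral at most [tau] for every marginal. *)
Lemma transfer_step gamma sigma (i : 'I_N) (nu : probability BX R) p :
  has_marginals gamma sigma -> transfer_density (sigma i) nu eps p ->
  (forall j, \int[sigma j]_x (excess g A x)%:E <= tau%:E) ->
  \int[nu]_x (excess g A x)%:E <= tau%:E ->
  exists gamma', has_marginals gamma' (fun j => if j == i then nu else sigma j) /\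
    \int[gamma']_x (phi x)%:E <= \int[gamma]_x (phi x)%:E +
      (omega + (K + C * N.+1%:R * A) * eps + C * N.+1%:R * tau)%:E.
Proof.
move=> gs [mp p0 px py pfar] stau ntau.
pose pc (w : BXN * BX) := p (w.1 i, w.2).
have mpc : measurable_fun setT pc.
  apply: (measurableT_comp mp); apply: measurable_fun_pair => //.
  exact: (measurableT_comp (measurable_coord i)).
have pc0 w : (0 <= pc w)%R by exact: p0.
have mpcE : measurable_fun setT (fun w => (pc w)%:E) by exact/measurable_EFinP.
have pc1 : \int[gamma \x nu]_w (pc w)%:E = 1.
  rewrite fubini_tonelli1// /fubini_F.
  under eq_integral do rewrite px.
  by rewrite integral_cst//= mul1e probability_setT.
(* [pi] is the joint law of the configuration and of the redrawn point *)
have [pi hpi] := transported_probability mpc pc0 (@measurable_id _ _ setT) pc1.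
have [gamma' hgamma'] := transported_probability mpc pc0 (measurable_replace_coord i) pc1.
have gpi (psi : BXN -> \bar R) : measurable_fun setT psi -> (forall x, 0 <= psi x) ->
    \int[gamma']_x psi x = \int[pi]_w psi (replace_coord i w).
  move=> mpsi psi0; rewrite hgamma'// hpi//.
  exact: (measurableT_comp mpsi (measurable_replace_coord i)).
have pi1 (psi : BXN -> \bar R) : measurable_fun setT psi -> (forall x, 0 <= psi x) ->
    \int[pi]_w psi w.1 = \int[gamma]_x psi x.
  move=> mpsi psi0; rewrite hpi//; last exact: (measurableT_comp mpsi).
  rewrite fubini_tonelli1//; first last.
  - by move=> w; rewrite mule_ge0// lee_fin.
  - by apply: emeasurable_funM => //; exact: (measurableT_comp mpsi).
  apply: eq_integral => x _; rewrite /fubini_F/=.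
  rewrite ge0_integralZr ?px ?mul1e// => [|y _]; last by rewrite lee_fin.
  exact: (measurable_fun_pair2 _ mpcE).
have pi2 (H : BX * BX -> \bar R) : measurable_fun setT H -> (forall x, 0 <= H x) ->
    \int[pi]_w H (w.1 i, w.2) = \int[sigma i \x nu]_w ((p w)%:E * H w).
  move=> mH H0; rewrite hpi//; last first.
    apply: (measurableT_comp mH); apply: measurable_fun_pair => //.
    exact: (measurableT_comp (measurable_coord i)).
  have mpH : measurable_fun setT (fun w => (p w)%:E * H w).
    by apply: emeasurable_funM => //; exact/measurable_EFinP.
  have pH0 w : 0 <= (p w)%:E * H w by rewrite mule_ge0// lee_fin.
  rewrite fubini_tonelli1//; first last.
  - by move=> w; rewrite mule_ge0// lee_fin.
  - have mi2 : measurable_fun setT (fun w : BXN * BX => (w.1 i : BX, w.2)).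
      apply: measurable_fun_pair => //.
      exact: (measurableT_comp (measurable_coord i)).
    exact: (measurableT_comp mpH mi2).
  rewrite fubini_tonelli1//.
  rewrite -[RHS](ge0_integral_marginal i gs)//; first exact: measurable_fun_fubini_tonelli_F.
  by move=> x; exact: integral_ge0.
have pi3 (psi : BX -> \bar R) : measurable_fun setT psi -> (forall x, 0 <= psi x) ->
    \int[pi]_w psi w.2 = \int[nu]_x psi x.
  move=> mpsi psi0; rewrite (pi2 (fun w => psi w.2))//; last exact: (measurableT_comp mpsi).
  rewrite fubini_tonelli2//; first last.
  - by move=> w; rewrite mule_ge0// lee_fin.
  - apply: emeasurable_funM => //; first exact/measurable_EFinP.
    exact: (measurableT_comp mpsi).
  apply: eq_integral => y _; rewrite /fubini_G/=.
  rewrite ge0_integralZr ?py ?mul1e// => [|x _]; last by rewrite lee_fin.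
  have mpE : measurable_fun setT (fun w => (p w)%:E) by exact/measurable_EFinP.
  exact: (measurable_fun_pair1 _ mpE).
exists gamma'; split.
  apply: has_marginalsP => j psi mpsi psi0.
  rewrite (gpi (fun x => psi (x j)))//; last exact: (measurableT_comp mpsi (measurable_coord j)).
  rewrite /replace_coord /=; case: eqP => [_|_]; first exact: pi3.
  rewrite (pi1 (fun x => psi (x j)))//; last exact: (measurableT_comp mpsi (measurable_coord j)).
  exact: ge0_integral_marginal.
have mphiE : measurable_fun setT (fun x => (phi x)%:E) by exact/measurable_EFinP.
rewrite gpi//.
have mexc := measurable_excess A mg.
have mfar : measurable_fun setT (fun w : BXN * BX => far eps (w.1 i, w.2)).
  apply: (measurableT_comp (measurable_far eps)); apply: measurable_fun_pair => //.
  exact: (measurableT_comp (measurable_coord i)).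
pose K' := (K + C * N.+1%:R * A)%R.
have CN0 : (0 <= C * N.+1%:R)%R by rewrite mulr_ge0.
have K'0 : (0 <= K')%R by rewrite addr_ge0// mulr_ge0.
pose ex2 (w : BXN * BX) := (excess g A w.2)%:E + \sum_(a < N) (excess g A (w.1 a))%:E.
have mexa a : measurable_fun setT (fun w : BXN * BX => (excess g A (w.1 a))%:E).
  apply: (measurableT_comp mexc); exact: (measurableT_comp (measurable_coord a)).
have mex2 : measurable_fun setT ex2.
  apply: emeasurable_funD; first exact: (measurableT_comp mexc).
  by apply: emeasurable_sum.
have ex20 w : 0 <= ex2 w.
  by rewrite adde_ge0 ?sume_ge0// => *; rewrite lee_fin excess_ge0.
apply: (@le_trans _ _ (\int[pi]_w ((phi w.1)%:E + (omega%:E +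
    (K'%:E * far eps (w.1 i, w.2) + C%:E * ex2 w))))).
  apply: ge0_le_integral => //.
  - by move=> w _; rewrite lee_fin.
  - exact: (measurableT_comp mphiE (measurable_replace_coord i)).
  - apply: emeasurable_funD; first exact: (measurableT_comp mphiE).
    apply: emeasurable_funD => //.
    by apply: emeasurable_funD; apply: measurable_funeM.
  move=> [x y] _ /=.
  rewrite /ex2 /far/= sumEFin -!EFinD lee_fin.
  have S0 : (0 <= excess g A y + \sum_(a < N) excess g A (x a))%R.
    by rewrite addr_ge0 ?sumr_ge0// => *; exact: excess_ge0.
  have [fxy|nxy] := leP eps (mdist (x i : X) y); last first.
    rewrite mulr0 add0r addrA.
    apply: (@le_trans _ _ (phi x + omega)%R); last by rewrite lerDl mulr_ge0.
    apply: phi_near => a; rewrite /replace_coord/=.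
    by case: eqP => [->//|_]; rewrite mdistxx.
  rewrite mulr1 (le_trans (phi_far _))//.
  apply: (@le_trans _ _ (K + C * (\sum_(a < N) (A + excess g A (x a)) + (A + excess g A y)))%R).
    rewrite lerD2l ler_wpM2l// (@le_trans _ _ (\sum_(a < N) g (x a) + g y)%R)//.
      rewrite (bigD1 i)//= [in leRHS](bigD1 i)//= /replace_coord/= eqxx.
      rewrite (eq_bigr (fun a => g (x a))); last by move=> a /negbTE ->.
      by have := g0 (x i); lra.
    by apply: lerD; [apply: ler_sum => a _|]; exact: le_excess.
  rewrite big_split/= sumr_const card_ord -mulr_natr /K' -natr1.
  rewrite -subr_ge0 [leRHS](_ : _ = phi x + omega)%R ?addr_ge0//.
  by set s := (\sum_(_ < _) _)%R; ring.
rewrite ge0_integralD//; first last.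
- apply: emeasurable_funD => //.
  by apply: emeasurable_funD; apply: measurable_funeM.
- by move=> w _; rewrite !adde_ge0// ?mule_ge0// ?lee_fin// far_ge0.
- exact: (measurableT_comp mphiE).
- by move=> w _; rewrite lee_fin.
rewrite (pi1 (fun x => (phi x)%:E))//.
rewrite leeD2l//.
rewrite ge0_integralD//; first last.
- by apply: emeasurable_funD; apply: measurable_funeM.
- by move=> w _; rewrite !adde_ge0// ?mule_ge0// ?lee_fin// far_ge0.
rewrite integral_cst//= probability_setT mule1.
rewrite ge0_integralD//; first last.
- exact: measurable_funeM.
- by move=> w _; rewrite mule_ge0// lee_fin.
- exact: measurable_funeM.
- by move=> w _; rewrite mule_ge0// ?lee_fin// far_ge0.
rewrite ge0_integralZl//; last by move=> w _; exact: far_ge0.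
rewrite ge0_integralZl//.
rewrite -addrA [in leRHS]EFinD leeD2l// [in leRHS]EFinD.
apply: leeD.
  rewrite EFinM lee_wpmul2l ?lee_fin//.
  by rewrite (pi2 _ (measurable_far eps) (far_ge0 eps)).
rewrite -mulrA [in leRHS]EFinM lee_wpmul2l ?lee_fin//.
rewrite ge0_integralD//; first last.
- exact: emeasurable_sum.
- by move=> w _; apply: sume_ge0 => a _; rewrite lee_fin excess_ge0.
- exact: (measurableT_comp mexc).
- by move=> w _; rewrite lee_fin excess_ge0.
rewrite (pi3 (fun y => (excess g A y)%:E))//; last by move=> y; rewrite lee_fin excess_ge0.
rewrite -nat1r mulrDl mul1r EFinD; apply: leeD => //.
rewrite ge0_integral_sum//; last by move=> a w _; rewrite lee_fin excess_ge0.
rewrite (@le_trans _ _ (\sum_(a < N) tau%:E))//.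
  apply: lee_sum => a _.
  rewrite (pi1 (fun x => (excess g A (x a))%:E))//; first last.
  - by move=> x; rewrite lee_fin excess_ge0.
  - exact: (measurableT_comp mexc (measurable_coord a)).
  rewrite (ge0_integral_marginal a (psi := fun x => (excess g A x)%:E) gs)//.
  by move=> x; rewrite lee_fin excess_ge0.
by rewrite sumEFin sumr_const card_ord mulr_natl.
Qed.

End step.
End transfer.

Section transfer_all.
Context {R : realType} {X : polishMetricType R} {N : nat}.
Local Notation BX := (borelType X).
Local Notation BXN := (borelType {ptws 'I_N -> X}).
Variables (g : BX -> R) (phi : BXN -> R) (omega K C eps A tau : R).
Hypotheses (mg : measurable_fun [set: BX] g) (g0 : forall x, 0 <= g x).
Hypotheses (mphi : measurable_fun [set: BXN] phi) (phi0 : forall x, 0 <= phi x).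
Hypotheses (eps0 : 0 < eps) (K0 : 0 <= K) (C0 : 0 <= C) (A0 : 0 <= A) (omega0 : 0 <= omega).
Hypothesis phi_near : forall x x' : BXN,
  (forall a, mdist (x a : X) (x' a) < eps) -> phi x' <= phi x + omega.
Hypothesis phi_far : forall x : BXN, phi x <= K + C * \sum_(a < N) g (x a).

Local Open Scope ereal_scope.

Lemma transfer_all (mu nu : probability BX R) p gamma :
  has_marginals gamma (fun=> mu) -> transfer_density mu nu eps p ->
  \int[mu]_x (excess g A x)%:E <= tau%:E ->
  \int[nu]_x (excess g A x)%:E <= tau%:E ->
  exists gamma' : probability BXN R, has_marginals gamma' (fun=> nu) /\
    \int[gamma']_x (phi x)%:E <= \int[gamma]_x (phi x)%:E +
      (N%:R * (omega + (K + C * N.+1%:R * A) * eps + C * N.+1%:R * tau))%:E.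
Proof.
move=> gmu hp mutau nutau.
set err := (omega + _ + _)%R.
(* after [k] steps the first [k] coordinates have been carried *)
pose sigma k (j : 'I_N) := if (j < k)%N then nu else mu.
have step k : (k <= N)%N -> exists gamma' : probability BXN R,
    has_marginals gamma' (sigma k) /\
    \int[gamma']_x (phi x)%:E <= \int[gamma]_x (phi x)%:E + (k%:R * err)%:E.
  elim: k => [|k ih] kN; first by exists gamma; rewrite mul0r adde0.
  have [gk [gks gkc]] := ih (ltnW kN).
  have hpk : transfer_density (sigma k (Ordinal kN)) nu eps p.
    by rewrite /sigma/= ltnn.
  have stau j : \int[sigma k j]_x (excess g A x)%:E <= tau%:E.
    by rewrite /sigma; case: ifP.
  have [g' [g's g'c]] := transfer_step mg g0 mphi phi0 eps0 K0 C0 A0 omega0 phi_near phi_far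
    gks hpk stau nutau.
  exists g'; split.
    move=> j B mB; rewrite g's//= /sigma [in RHS]ltnS [in RHS]leq_eqVlt -(inj_eq val_inj)/=.
    by case: (nat_of_ord j == k).
  apply: (le_trans g'c); rewrite -/err -nat1r mulrDl mul1r [in leRHS]EFinD addeA.
  by rewrite addeAC leeD2r.
have [g' [g's g'c]] := step N (leqnn N).
exists g'; split => // j B mB.
by rewrite g's// /sigma ltn_ord.
Qed.

End transfer_all.

(** * Couplings between weakly close measures *)

Section transfer_density_exists.
Context {R : realType} {X : polishMetricType R}.
Local Notation BX := (borelType X).
Local Open Scope ereal_scope.

Lemma transfer_densityC (mu nu : probability BX R) eps p :
  transfer_density mu nu eps p ->
  transfer_density nu mu eps (fun w => p (w.2, w.1)).
Proof.
move=> [mp p0 px py pfar]; split => //.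
- apply: (measurableT_comp mp); exact: (measurable_fun_pair measurable_snd measurable_fst).
- have mpf : measurable_fun setT (fun w => (p w)%:E * far eps w).
    by apply: emeasurable_funM; [exact/measurable_EFinP|exact: measurable_far].
  have pf0 w : 0 <= (p w)%:E * far eps w by rewrite mule_ge0 ?far_ge0// lee_fin.
  have mpf' : measurable_fun setT (fun w : BX * BX => (p (w.2, w.1))%:E * far eps (w.2, w.1)).
    apply: (measurableT_comp mpf); exact: (measurable_fun_pair measurable_snd measurable_fst).
  move: pfar; rewrite fubini_tonelli2// => pfar.
  rewrite (eq_integral (fun w : BX * BX => (p (w.2, w.1))%:E * far eps (w.2, w.1))).
    by rewrite fubini_tonelli1// => w.
  by move=> [x y] _; rewrite /far/= mdistC.
Qed.

Lemma ge0_integral_fin_num_le1 (mu : probability BX R) (h : BX -> R) :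
  measurable_fun [set: BX] h -> (forall x, 0 <= h x <= 1)%R ->
  \int[mu]_x (h x)%:E \is a fin_num /\ \int[mu]_x (h x)%:E <= 1.
Proof.
move=> mh h01.
have h1 : \int[mu]_x (h x)%:E <= 1.
  rewrite (@le_trans _ _ (\int[mu]_x (cst 1 x)))//.
    apply: ge0_le_integral => //.
    - by move=> x _; rewrite lee_fin; case/andP: (h01 x).
    - exact/measurable_EFinP.
    - by move=> x _; rewrite lee_fin; case/andP: (h01 x).
  by rewrite integral_cst//= mul1e probability_setT.
split => //; rewrite ge0_fin_numE ?(le_lt_trans h1) ?ltry//.
by apply: integral_ge0 => x _; rewrite lee_fin; case/andP: (h01 x).
Qed.

Section partition.
Variables (mu nu : probability BX R) (eps theta : R) (K : nat).
Variable phi : nat -> BX -> R.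
Hypotheses (theta0 : (0 < theta)%R) (theta1 : (theta < 1)%R).
Hypothesis mphi : forall k, measurable_fun [set: BX] (phi k).
Hypothesis phi0 : forall k x, (0 <= phi k x)%R.
Hypothesis phi1 : forall x, (\sum_(k < K) phi k x <= 1)%R.
Hypothesis phi_near : forall k x y, (phi k x != 0 -> phi k y != 0 ->
  mdist (x : X) (y : X) < eps)%R.

Let m k := fine (\int[mu]_x (phi k x)%:E).
Let n k := fine (\int[nu]_x (phi k x)%:E).

Hypothesis common : (1 - eps <= (1 - theta) * \sum_(k < K) Num.min (m k) (n k))%R.

(* [a k * m k * n k] is the mass common to [mu] and [nu] in the cell [k], up to
   the factor [1 - theta], which keeps the rest [Q] positive so that one may
   divide by it; an empty cell gets [a k = 0], since the inverse of [0] is [0] *)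
Let a k := ((1 - theta) / Num.max (m k) (n k))%R.
Let Q := (1 - \sum_(k < K) a k * m k * n k)%R.
Let u x := (1 - \sum_(k < K) a k * n k * phi k x)%R.
Let v x := (1 - \sum_(k < K) a k * m k * phi k x)%R.

Let phi_le1 k x : (k < K)%N -> (phi k x <= 1)%R.
Proof.
move=> kK; apply: le_trans (phi1 x).
rewrite (bigD1 (Ordinal kK))//= lerDl; exact: sumr_ge0.
Qed.

Let phi01 (k : 'I_K) x : (0 <= phi k x <= 1)%R.
Proof. by rewrite phi0/= phi_le1. Qed.

Let mE (k : 'I_K) : \int[mu]_x (phi k x)%:E = (m k)%:E.
Proof. by rewrite fineK//; have [] := ge0_integral_fin_num_le1 mu (mphi k) (phi01 k). Qed.

Let nE (k : 'I_K) : \int[nu]_x (phi k x)%:E = (n k)%:E.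
Proof. by rewrite fineK//; have [] := ge0_integral_fin_num_le1 nu (mphi k) (phi01 k). Qed.

Let m0 k : (0 <= m k)%R.
Proof. by apply: fine_ge0; apply: integral_ge0 => x _; rewrite lee_fin. Qed.

Let n0 k : (0 <= n k)%R.
Proof. by apply: fine_ge0; apply: integral_ge0 => x _; rewrite lee_fin. Qed.

Let mn0 k : (0 <= Num.max (m k) (n k))%R. Proof. by rewrite le_max m0. Qed.

Let a0 k : (0 <= a k)%R.
Proof. by rewrite divr_ge0// subr_ge0 ltW. Qed.

Let am k : (a k * m k <= 1 - theta)%R.
Proof.
rewrite /a; have [->|M0] := eqVneq (Num.max (m k) (n k)) 0%R.
  by rewrite invr0 mulr0 mul0r subr_ge0 ltW.
rewrite -mulrA ler_piMr ?subr_ge0 ?(ltW theta1)//.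
have Mpos : (0 < Num.max (m k) (n k))%R by rewrite lt_neqAle eq_sym M0 mn0.
by rewrite mulrC ler_pdivrMr// mul1r le_max lexx.
Qed.

Let an k : (a k * n k <= 1 - theta)%R.
Proof.
rewrite /a; have [->|M0] := eqVneq (Num.max (m k) (n k)) 0%R.
  by rewrite invr0 mulr0 mul0r subr_ge0 ltW.
rewrite -mulrA ler_piMr ?subr_ge0 ?(ltW theta1)//.
have Mpos : (0 < Num.max (m k) (n k))%R by rewrite lt_neqAle eq_sym M0 mn0.
by rewrite mulrC ler_pdivrMr// mul1r le_max lexx orbT.
Qed.

Let amn k : (a k * m k * n k = (1 - theta) * Num.min (m k) (n k))%R.
Proof.
rewrite /a; have [mn|nm] := leP (m k) (n k).
  have [n00|nn0] := eqVneq (n k) 0%R; last by field.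
  have m00 : m k = 0%R by apply/eqP; rewrite eq_le m0 -n00 mn.
  by rewrite n00 m00 !mulr0.
have [m00|nm0] := eqVneq (m k) 0%R; last by field.
by have := n0 k; rewrite m00 in nm; rewrite leNgt nm.
Qed.

Let le_sum1 (c : nat -> R) x : (forall k, 0 <= c k <= 1 - theta)%R ->
  (\sum_(k < K) c k * phi k x <= 1 - theta)%R.
Proof.
move=> c1; rewrite (@le_trans _ _ (\sum_(k < K) (1 - theta) * phi k x)%R)//.
  by apply: ler_sum => k _; rewrite ler_wpM2r//; case/andP: (c1 k).
by rewrite -mulr_sumr ler_piMr// subr_ge0 ltW.
Qed.

Let u0 x : (0 <= u x)%R.
Proof.
have := @le_sum1 (fun k => a k * n k)%R x (fun k => _).
rewrite /u subr_ge0 => h; rewrite (le_trans (h _))// => [k|]; first by rewrite mulr_ge0//= an.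
by rewrite lerBlDr lerDl ltW.
Qed.

Let v0 x : (0 <= v x)%R.
Proof.
have := @le_sum1 (fun k => a k * m k)%R x (fun k => _).
rewrite /v subr_ge0 => h; rewrite (le_trans (h _))// => [k|]; first by rewrite mulr_ge0//= am.
by rewrite lerBlDr lerDl ltW.
Qed.

Let mlin (c : nat -> R) : measurable_fun [set: BX] (fun x => \sum_(k < K) c k * phi k x)%R.
Proof. by apply: measurable_sum => k; apply: measurable_funM. Qed.

Let mu_ : measurable_fun [set: BX] u.
Proof. by apply: measurable_funB => //; exact: (mlin (fun k => a k * n k)%R). Qed.

Let mv_ : measurable_fun [set: BX] v.
Proof. by apply: measurable_funB => //; exact: (mlin (fun k => a k * m k)%R). Qed.

Let int_lin (rho : probability BX R) (r c : nat -> R) :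
  (forall k : 'I_K, \int[rho]_x (phi k x)%:E = (r k)%:E) -> (forall k, 0 <= c k)%R ->
  \int[rho]_x (\sum_(k < K) c k * phi k x)%:E = (\sum_(k < K) c k * r k)%:E.
Proof.
move=> rE c0; rewrite -sumEFin.
under eq_integral do rewrite -sumEFin.
rewrite ge0_integral_sum//; first last.
- by move=> k x _; rewrite lee_fin mulr_ge0.
- by move=> k; apply/measurable_EFinP; apply: measurable_funM.
apply: eq_bigr => k _.
under eq_integral do rewrite EFinM.
rewrite ge0_integralZl ?rE//.
- exact/measurable_EFinP.
- by move=> x _; rewrite lee_fin.
- by rewrite lee_fin.
Qed.

Let int_res (rho : probability BX R) (r c : nat -> R) :
  (forall k : 'I_K, \int[rho]_x (phi k x)%:E = (r k)%:E) -> (forall k, 0 <= c k <= 1 - theta)%R ->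
  \int[rho]_x (1 - \sum_(k < K) c k * phi k x)%:E = (1 - \sum_(k < K) c k * r k)%:E.
Proof.
move=> rE c01; have c0 k : (0 <= c k)%R by case/andP: (c01 k).
apply: (@addIe _ (\sum_(k < K) c k * r k)%:E) => //.
rewrite -EFinD subrK -(int_lin rE c0) -ge0_integralD//; first last.
- exact/measurable_EFinP.
- by move=> x _; rewrite lee_fin sumr_ge0// => k _; rewrite mulr_ge0.
- by apply/measurable_EFinP; apply: measurable_funB.
- move=> x _; rewrite lee_fin subr_ge0 (le_trans (le_sum1 x c01))//.
  by rewrite lerBlDr lerDl ltW.
under eq_integral do rewrite -EFinD subrK.
by rewrite integral_cst//= mul1e probability_setT.
Qed.

Let Q0 : (0 < Q)%R.
Proof.
rewrite /Q subr_gt0 (@le_lt_trans _ _ (1 - theta)%R)// ?ltrBlDr ?ltrDl//.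
under eq_bigr do rewrite amn.
rewrite -mulr_sumr ler_piMr ?subr_ge0 ?(ltW theta1)//.
rewrite (@le_trans _ _ (\sum_(k < K) 1 * m k)%R)//.
  by apply: ler_sum => k _; rewrite mul1r ge_min lexx.
rewrite -lee_fin.
have /= <- := @int_lin mu m (fun=> 1%R) mE (fun=> ler01).
have [||_] := @ge0_integral_fin_num_le1 mu (fun x => \sum_(k < K) 1 * phi k x)%R.
- exact: (mlin (fun=> 1%R)).
- by move=> x; under eq_bigr do rewrite mul1r; rewrite phi1 sumr_ge0.
- exact.
Qed.

Let intu : \int[mu]_x (u x)%:E = Q%:E.
Proof.
rewrite (int_res (c := fun k => a k * n k)%R mE) => [|k]; last by rewrite mulr_ge0//= an.
by rewrite /Q; congr (1 - _)%:E; apply: eq_bigr => k _; rewrite mulrAC.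
Qed.

Let intv : \int[nu]_x (v x)%:E = Q%:E.
Proof.
by rewrite (int_res (c := fun k => a k * m k)%R nE) => [|k]//; rewrite mulr_ge0//= am.
Qed.

Let Qeps : (Q <= eps)%R.
Proof.
rewrite /Q; under eq_bigr do rewrite amn.
by rewrite -mulr_sumr; move: common; lra.
Qed.

(** The common mass of a cell is coupled within the cell, whose points are
    closer than [eps]; what remains, of mass [Q] on both sides, is coupled
    independently, and it is at most [eps] by [common]. *)
Let p (w : BX * BX) : R :=
  (\sum_(k < K) a k * phi k w.1 * phi k w.2 + u w.1 * v w.2 / Q)%R.

Lemma transfer_density_partition : transfer_density mu nu eps p.
Proof.
have mf1 (h : BX -> R) : measurable_fun setT h -> measurable_fun setT (fun w : BX * BX => h w.1).
  by move=> mh; exact: (measurableT_comp mh).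
have mf2 (h : BX -> R) : measurable_fun setT h -> measurable_fun setT (fun w : BX * BX => h w.2).
  by move=> mh; exact: (measurableT_comp mh).
split.
- apply: measurable_funD.
    apply: measurable_sum => k; apply: measurable_funM; last exact: mf2.
    by apply: measurable_funM => //; exact: mf1.
  by apply: measurable_funM => //; apply: measurable_funM; [exact: mf1|exact: mf2].
- move=> w; apply: addr_ge0; first by apply: sumr_ge0 => k _; rewrite mulr_ge0// mulr_ge0.
  by rewrite divr_ge0 ?mulr_ge0// ltW.
- move=> x.
  have E y : p (x, y) = (\sum_(k < K) (a k * phi k x) * phi k y + (u x / Q) * v y)%R.
    by rewrite /p/= mulrAC.
  under eq_integral do rewrite E EFinD.
  rewrite ge0_integralD//; first last.
  + by apply/measurable_EFinP; apply: measurable_funM.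
  + by move=> y _; rewrite lee_fin mulr_ge0// divr_ge0// ltW.
  + by apply/measurable_EFinP; exact: (mlin (fun k => a k * phi k x)%R).
  + by move=> y _; rewrite lee_fin sumr_ge0// => k _; rewrite mulr_ge0// mulr_ge0.
  rewrite (int_lin (c := fun k => a k * phi k x)%R nE) => [|k]; last by rewrite mulr_ge0.
  under eq_integral do rewrite EFinM.
  rewrite ge0_integralZl//; first last.
  + by rewrite lee_fin divr_ge0// ltW.
  + by move=> y _; rewrite lee_fin.
  + exact/measurable_EFinP.
  rewrite intv -EFinM -EFinD divfK ?gt_eqF// /u.
  under eq_bigr do rewrite mulrAC.
  by rewrite addrC subrK.
- move=> y.
  have E x : p (x, y) = (\sum_(k < K) (a k * phi k y) * phi k x + (v y / Q) * u x)%R.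
    rewrite /p/=; congr (_ + _)%R; last by ring.
    by apply: eq_bigr => k _; rewrite mulrAC.
  under eq_integral do rewrite E EFinD.
  rewrite ge0_integralD//; first last.
  + by apply/measurable_EFinP; apply: measurable_funM.
  + by move=> x _; rewrite lee_fin mulr_ge0// divr_ge0// ltW.
  + by apply/measurable_EFinP; exact: (mlin (fun k => a k * phi k y)%R).
  + by move=> x _; rewrite lee_fin sumr_ge0// => k _; rewrite mulr_ge0// mulr_ge0.
  rewrite (int_lin (c := fun k => a k * phi k y)%R mE) => [|k]; last by rewrite mulr_ge0.
  under eq_integral do rewrite EFinM.
  rewrite ge0_integralZl//; first last.
  + by rewrite lee_fin divr_ge0// ltW.
  + by move=> x _; rewrite lee_fin.
  + exact/measurable_EFinP.
  rewrite intu -EFinM -EFinD divfK ?gt_eqF// /v.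
  under eq_bigr do rewrite mulrAC.
  by rewrite addrC subrK.
- have muv : measurable_fun setT (fun w : BX * BX => (u w.1 * v w.2 / Q)%:E).
    apply/measurable_EFinP; apply: measurable_funM => //.
    by apply: measurable_funM; [exact: mf1|exact: mf2].
  have uv0 w : 0 <= (u w.1 * v w.2 / Q)%:E.
    by rewrite lee_fin divr_ge0 ?mulr_ge0// ltW.
  apply: (@le_trans _ _ (\int[mu \x nu]_w (u w.1 * v w.2 / Q)%:E)).
    apply: ge0_le_integral => //.
    + move=> w _; rewrite mule_ge0 ?far_ge0// lee_fin addr_ge0//.
        by rewrite sumr_ge0// => k _; rewrite mulr_ge0// mulr_ge0.
      by rewrite -lee_fin.
    + apply: emeasurable_funM; last exact: measurable_far.
      apply/measurable_EFinP; apply: measurable_funD; last exact/measurable_EFinP.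
      apply: measurable_sum => k; apply: measurable_funM; last exact: mf2.
      by apply: measurable_funM => //; exact: mf1.
    + move=> [x y] _; rewrite /far/=.
      have [fxy|nxy] := leP eps (mdist (x : X) y); last by rewrite mule0 (uv0 (x, y)).
      rewrite mule1 lee_fin /p/= big1 ?add0r// => k _.
      apply/eqP; rewrite !mulf_eq0 -!orbA; apply/negPn/negP; rewrite !negb_or.
      move=> /and4P[_ _ px py]; have := phi_near px py.
      by rewrite ltNge fxy.
  rewrite fubini_tonelli1// /fubini_F/=.
  have E x y : (u x * v y / Q)%:E = (u x / Q)%:E * (v y)%:E.
    by rewrite -EFinM mulrAC.
  under eq_integral => x _.
    under eq_integral do rewrite E.
    rewrite ge0_integralZl//; first last.
    + by rewrite lee_fin divr_ge0// ltW.
    + by move=> y _; rewrite lee_fin.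
    + exact/measurable_EFinP.
    rewrite intv -EFinM divfK ?gt_eqF//.
    over.
  by rewrite intu lee_fin.
Qed.

End partition.
End transfer_density_exists.

Section weak_convergence_transfer.
Context {R : realType} {X : polishMetricType R}.
Local Notation BX := (borelType X).

Lemma le_bounded_fun (h : X -> R) M : (forall x, `|h x| <= M) -> bounded_fun h.
Proof.
move=> hM; exists M; split=> [|r Mr x _]; first exact: num_real.
exact: le_trans (hM x) (ltW Mr).
Qed.

Lemma weak_cvg_bounded (rho : nat -> probability BX R) (rhoo : probability BX R)
    (h : X -> R) (M : R) :
  weak_cvg rho rhoo -> continuous h -> (forall x, 0 <= h x <= M) ->
  (\int[rho n]_x (h x)%:E @[n --> \oo] --> \int[rhoo]_x (h x)%:E)%E.
Proof.
move=> rr ch h0M; apply: rr => //; apply: (@le_bounded_fun _ M) => x.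
by have /andP[h0 hM] := h0M x; rewrite ger0_norm.
Qed.

Lemma weak_cvg_fine (rho : nat -> probability BX R) (rhoo : probability BX R) (h : X -> R) :
  weak_cvg rho rhoo -> continuous h -> (forall x, 0 <= h x <= 1) ->
  fine (\int[rho n]_x (h x)%:E)%E @[n --> \oo] --> fine (\int[rhoo]_x (h x)%:E)%E.
Proof.
move=> rr ch h01; apply: fine_cvg; rewrite fineK; last first.
  by have [] := ge0_integral_fin_num_le1 rhoo (continuous_measurable_borel ch) h01.
exact: weak_cvg_bounded rr ch h01.
Qed.

(** Bumps around a dense sequence give a continuous partition of unity whose cells
    have points closer than [eps]. Finitely many cells carry almost all the mass
    of [rhoo], and in each of them the mass of [rho n] converges. *)
Lemma transfer_density_weak_cvg (rho : nat -> probability BX R) (rhoo : probability BX R) eps :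
  weak_cvg rho rhoo -> 0 < eps ->
  \forall n \near \oo, exists p, transfer_density (rho n) rhoo eps p.
Proof.
move=> rr eps0.
have [q qd] := @dense_sequence R X.
pose e := eps / 4.
have e0 : 0 < e by rewrite divr_gt0.
(* a bump equal to [1] up to distance [e] from [q k] and to [0] from distance [2 e] on *)
pose psi k (x : X) := Num.max 0 (Num.min 1 (2 - mdist x (q k) / e)).
have psi01 k x : 0 <= psi k x <= 1.
  by rewrite /psi le_max lexx/= ge_max ler01 ge_min lexx.
have cpsi k : continuous (psi k).
  move=> x; apply: (@continuous_max R X (fun=> 0)); first exact: cst_continuous.
  apply: (@continuous_min R X (fun=> 1)); first exact: cst_continuous.
  apply: cvgB; first exact: cvg_cst.
  by apply: cvgMr_tmp; exact: continuous_mdistl.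
have psi1 k x : mdist x (q k) <= e -> psi k x = 1.
  move=> xq; rewrite /psi min_l ?max_r//.
  by rewrite lerBrDr -lerBrDl (_ : 2 - 1 = 1) ?ler_pdivrMr ?mul1r//; lra.
have psi0 k x : psi k x != 0 -> mdist x (q k) < 2 * e.
  apply: contraNT; rewrite -leNgt => h; rewrite /psi max_l// ge_min.
  by rewrite subr_le0 ler_pdivlMr// h orbT.
(* the cell [k] gets what the bump [k] leaves of what the previous cells left *)
pose res K (x : X) := \prod_(l < K) (1 - psi l x).
pose phi k x := psi k x * res k x.
have resS K x : res K.+1 x = res K x - phi K x.
  by rewrite /phi {1}/res big_ord_recr/= -/(res K x); ring.
have res01 K x : 0 <= res K x <= 1.
  elim: K => [|K /andP[r0 r1]]; first by rewrite /res big_ord0 ler01 lexx.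
  have /andP[p0 p1] := psi01 K x.
  by rewrite /res big_ord_recr/= -/(res K x) mulr_ge0 ?mulr_ile1 ?subr_ge0// gerBl.
have cres K : continuous (res K).
  elim: K => [|K ih] x.
    rewrite (_ : res 0%N = fun=> 1); first exact: cst_continuous.
    by apply/funext => y; rewrite /res big_ord0.
  rewrite (_ : res K.+1 = fun x => res K x * (1 - psi K x)).
    apply: continuousM; first exact: ih.
    by apply: cvgB; [exact: cvg_cst|exact: cpsi].
  by apply/funext => y; rewrite /res big_ord_recr.
have cphi k : continuous (phi k) by move=> x; apply: continuousM; [exact: cpsi|exact: cres].
have phi01 k x : 0 <= phi k x <= 1.
  have /andP[? ?] := psi01 k x; have /andP[? ?] := res01 k x.
  by rewrite mulr_ge0//= mulr_ile1.
have sumphi K x : \sum_(k < K) phi k x = 1 - res K x.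
  elim: K => [|K ih]; first by rewrite big_ord0 /res big_ord0 subrr.
  by rewrite big_ord_recr/= ih resS; ring.
have mphi k := continuous_measurable_borel (cphi k).
have mres k := continuous_measurable_borel (cres k).
have res0 x : exists K0, forall K, (K0 <= K)%N -> res K x = 0.
  have [n xn] := qd x e e0.
  exists n.+1 => K nK; apply/eqP/prodf_eq0.
  by exists (Ordinal nK); rewrite //= psi1 ?subrr// ltW.
have [K hK] : exists K, (\int[rhoo]_x (res K x)%:E <= (eps / 3)%:E)%E.
  have mresE k : measurable_fun [set: BX] (fun x => (res k x)%:E) by exact/measurable_EFinP.
  have : (\int[rhoo]_x (res k x)%:E @[k --> \oo] --> \int[rhoo]_x (cst 0 x))%E.
    apply: (@dominated_cvg _ _ _ rhoo setT measurableT _ _ (cst 1%E)) => //.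
    - move=> x _; have [K0 hK0] := res0 x; apply: cvg_near_cst.
      by exists K0 => // K /= /hK0 ->.
    - exact: finite_measure_integrable_cst.
    - by move=> k x _; rewrite lee_fin; have /andP[? ?] := res01 k x; rewrite ger0_norm.
  rewrite integral_cst//= mul0e => h.
  have e30 : (0 < (eps / 3)%:E)%E by rewrite lte_fin divr_gt0.
  have /fine_cvgP[h1 /cvgrPdist_le/(_ _ e30) h2] := h.
  have [K _ hK] : \forall k \near \oo, (\int[rhoo]_x (res k x)%:E <= (eps / 3)%:E)%E.
    near=> k; rewrite -[leLHS]fineK; last by near: k.
    rewrite lee_fin (le_trans (ler_norm _))// -normrN -sub0r; near: k; exact: h2.
  by exists K; apply: hK => /=.
pose mk n k := fine (\int[rho n]_x (phi k x)%:E)%E.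
pose nk k := fine (\int[rhoo]_x (phi k x)%:E)%E.
have nkE k : (\int[rhoo]_x (phi k x)%:E = (nk k)%:E)%E.
  by rewrite fineK//; have [] := ge0_integral_fin_num_le1 rhoo (mphi k) (phi01 k).
have nk1 : 1 - eps / 3 <= \sum_(k < K) nk k.
  have resfin := ge0_integral_fin_num_le1 rhoo (mres K) (res01 K).
  have : (\sum_(k < K) (nk k)%:E + \int[rhoo]_x (res K x)%:E = 1)%E.
    under eq_bigr do rewrite -nkE.
    rewrite -ge0_integral_sum//; first last.
    - by move=> k x _; rewrite lee_fin; have /andP[] := phi01 k x.
    - by move=> k; exact/measurable_EFinP.
    rewrite -ge0_integralD//; first last.
    - exact/measurable_EFinP.
    - by move=> x _; rewrite lee_fin; have /andP[] := res01 K x.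
    - by apply: emeasurable_sum => k; exact/measurable_EFinP.
    - move=> x _; apply: sume_ge0 => k _; rewrite lee_fin.
      by have /andP[] := phi01 k x.
    under eq_integral do rewrite sumEFin -EFinD sumphi subrK.
    by rewrite integral_cst//= mul1e probability_setT.
  move: hK; rewrite -(fineK resfin.1) sumEFin -EFinD lee_fin => h [h1].
  by move: h h1; set r := fine _; set s := \sum_(_ < _) _; lra.
pose theta := Num.min (eps / 3) 2^-1.
have theta0 : 0 < theta by rewrite lt_min divr_gt0//= invr_gt0.
have theta1 : theta < 1 by rewrite gt_min invf_lt1// ltr1n orbT.
have thetae : theta <= eps / 3 by rewrite ge_min lexx.
have c0 : 0 < eps / 3 / K.+1%:R by rewrite !divr_gt0.
have hk : \forall n \near \oo, forall k : 'I_K, nk k - eps / 3 / K.+1%:R <= mk n k.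
  apply: filter_forall => k.
  have /cvgrPdist_le/(_ _ c0) := weak_cvg_fine rr (cphi k) (phi01 k).
  apply: filterS => n; rewrite -/(mk n k) -/(nk k) ler_norml => /andP[_].
  by rewrite lerBlDr addrC -lerBlDr.
near=> n.
have hkn : forall k : 'I_K, nk k - eps / 3 / K.+1%:R <= mk n k by near: n.
eexists; apply: (@transfer_density_partition _ _ (rho n) rhoo eps theta K phi) => //.
- by move=> k x; have /andP[] := phi01 k x.
- by move=> x; rewrite sumphi; have /andP[] := res01 K x; lra.
- move=> k x y; rewrite !mulf_eq0 !negb_or => /andP[/psi0 xq _] /andP[/psi0 yq _].
  have := mdist_triangle x (q k) y; rewrite (mdistC (q k)).
  by move: xq yq; rewrite /e; lra.
- have : \sum_(k < K) (nk k - eps / 3 / K.+1%:R) <= \sum_(k < K) Num.min (mk n k) (nk k).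
    apply: ler_sum => k _; rewrite le_min hkn lerBlDr lerDl ltW//.
  rewrite sumrB sumr_const card_ord => hmin.
  have hK3 : (eps / 3 / K.+1%:R) *+ K <= eps / 3.
    rewrite -mulr_natr -mulrA ler_piMr//; first by rewrite ltW// divr_gt0.
    by rewrite mulrC ler_pdivrMr// mul1r ler_nat.
  have hS : 1 - 2 * (eps / 3) <= \sum_(k < K) Num.min (mk n k) (nk k).
    rewrite lerBlDr in hmin.
    have := le_trans nk1 (le_trans hmin (lerD (lexx _) hK3)).
    by move: (\sum_(k < K) _) => S; lra.
  rewrite (@le_trans _ _ ((1 - theta) * (1 - 2 * (eps / 3))))//.
    by move: theta0 theta1 thetae eps0; nra.
  by rewrite ler_wpM2l// subr_ge0 ltW.
Unshelve. all: by end_near. Qed.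

End weak_convergence_transfer.

(** * Exchanging a point between two configurations *)

Section bool_indicator.
Context {R : realType} d (T : measurableType d).

Lemma measurable_bool_natr (P : T -> bool) :
  measurable [set t | P t] -> measurable_fun [set: T] (fun t => (P t)%:R : R).
Proof.
move=> mP; rewrite (_ : (fun t => (P t)%:R : R) = \1_[set t | P t]).
  exact: measurable_indic.
by apply/funext => t; rewrite indicE mem_setE.
Qed.

Lemma measurable_bool_EFin (P : T -> bool) :
  measurable [set t | P t] -> measurable_fun [set: T] (fun t => ((P t)%:R : R)%:E).
Proof. by move=> mP; apply/measurable_EFinP; exact: measurable_bool_natr. Qed.

Lemma ge0_integral_bool (mu : {measure set T -> \bar R}) (P : T -> bool) :
  measurable [set t | P t] -> (\int[mu]_t ((P t)%:R : R)%:E = mu [set t | P t])%E.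
Proof.
move=> mP; have <- : (\int[mu]_t (\1_[set t | P t] t)%:E = mu [set t | P t])%E.
  by rewrite integral_indic// setIT.
by apply: eq_integral => t _; rewrite indicE mem_setE.
Qed.

Lemma measurable_fin_forall (I : finType) (P : pred I) (Q : I -> T -> bool) :
  (forall i, P i -> measurable [set t | Q i t]) ->
  measurable [set t | [forall i, P i ==> Q i t]].
Proof.
move=> mQ.
rewrite (_ : [set t | _] = \bigcap_(i in [set i | P i]) [set t | Q i t]).
  exact: fin_bigcap_measurable.
apply/seteqP; split => t /= h.
  by move=> i Pi; have /forallP/(_ i)/implyP := h; apply.
by apply/forallP => i; apply/implyP; exact: h.
Qed.

End bool_indicator.

Section swap_plan.
Context {R : realType} {X : polishMetricType R} {N : nat}.
Local Notation BX := (borelType X).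
Local Notation BXN := (borelType {ptws 'I_N -> X}).

Definition swap1 (i : 'I_N) (w : BXN * BXN) : BXN :=
  fun j => if j == i then w.2 i else w.1 j.
Definition swap2 (i : 'I_N) (w : BXN * BXN) : BXN :=
  fun j => if j == i then w.1 i else w.2 j.

(** The condition under which exchanging the [i]-th points of the two
    configurations creates no pair closer than [b]. *)
Definition separated (b : R) (i : 'I_N) (w : BXN * BXN) : bool :=
  [forall j, (j != i) ==>
    (b <= mdist (w.1 i : X) (w.2 j)) && (b <= mdist (w.1 j : X) (w.2 i))].

Let mfst (j : 'I_N) : measurable_fun [set: BXN * BXN] (fun w => w.1 j : BX).
Proof. exact: (measurableT_comp (measurable_coord j)). Qed.

Let msnd (j : 'I_N) : measurable_fun [set: BXN * BXN] (fun w => w.2 j : BX).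
Proof. exact: (measurableT_comp (measurable_coord j)). Qed.

Lemma measurable_swap1 i : measurable_fun [set: BXN * BXN] (swap1 i).
Proof. by apply: measurable_coordP => j; rewrite /swap1; case: eqP. Qed.

Lemma measurable_swap2 i : measurable_fun [set: BXN * BXN] (swap2 i).
Proof. by apply: measurable_coordP => j; rewrite /swap2; case: eqP. Qed.

Lemma measurable_mdist_ge d (T : measurableType d) (u v : T -> BX) b :
  measurable_fun [set: T] u -> measurable_fun [set: T] v ->
  measurable [set t | b <= mdist (u t : X) (v t)].
Proof.
move=> mu mv.
rewrite (_ : [set t | _] = [set: T] `&` (fun t => mdist (u t : X) (v t)) @^-1` `[b, +oo[).
  exact: measurable_mdist.
by rewrite setTI preimage_itvcy.
Qed.

Lemma measurable_separated b i : measurable [set w | separated b i w].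
Proof.
apply: measurable_fin_forall => j _.
rewrite (_ : [set t | _] = [set w : BXN * BXN | b <= mdist (w.1 i : X) (w.2 j)] `&`
   [set w | b <= mdist (w.1 j : X) (w.2 i)]).
  by apply: measurableI; exact: measurable_mdist_ge.
by apply/seteqP; split => w /= /andP.
Qed.

Local Open Scope ereal_scope.

Section construction.
Variables (rho : probability BX R) (gamma : probability BXN R) (i : 'I_N).
Variables (E F : BXN -> bool) (b s z0 : R).
Hypotheses (mE : measurable [set x | E x]) (mF : measurable [set x | F x]).
Hypothesis gr : has_marginals gamma (fun=> rho).
Hypotheses (s0 : (0 < s)%R) (z0_gt0 : (0 < z0)%R).

Let good (w : BXN * BXN) := F w.2 && separated b i w.

Let mgood : measurable [set w | good w].
Proof.
rewrite (_ : [set w | _] = ([set: BXN * BXN] `&` (snd @^-1` [set x | F x])) `&` [set w | separated b i w]).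
  apply: measurableI; last exact: measurable_separated.
  exact: (@measurable_snd _ _ BXN BXN).
by rewrite setTI; apply/seteqP; split => w /= /andP.
Qed.

(* the probability that a configuration drawn from [gamma] can be exchanged with [x] *)
Let Z x := \int[gamma]_y ((good (x, y))%:R : R)%:E.

Hypothesis hZ : forall x, z0%:E <= Z x.

Let m := fine (gamma [set x | E x]).

Hypothesis hs : forall z, (s * (E z)%:R + s * m / z0 * (F z)%:R <= 1)%R.

Let mgoodE : measurable_fun [set: BXN * BXN] (fun w => ((good w)%:R : R)%:E).
Proof. exact: measurable_bool_EFin. Qed.

Let Zfin x : Z x \is a fin_num.
Proof.
have mgx : measurable_fun setT (fun y => ((good (x, y))%:R : R)%:E).
  exact: (measurable_fun_pair2 _ mgoodE).
rewrite ge0_fin_numE; last by apply: integral_ge0 => y _; rewrite lee_fin.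
rewrite (@le_lt_trans _ _ (\int[gamma]_y cst 1 y))//.
  by apply: ge0_le_integral => // y _; rewrite lee_fin lern1 leq_b1.
by rewrite integral_cst//= mul1e; rewrite (_ : gamma setT = 1) ?ltry// probability_setT.
Qed.

Let Zr x := fine (Z x).

Let Zr_ge x : (z0 <= Zr x)%R.
Proof. by rewrite -lee_fin fineK. Qed.

Let Zr_gt0 x : (0 < Zr x)%R.
Proof. exact: lt_le_trans (Zr_ge x). Qed.

Let mZr : measurable_fun [set: BXN] Zr.
Proof.
have mZ : measurable_fun [set: BXN] Z.
  by apply: (@measurable_fun_fubini_tonelli_F _ _ _ _ _ gamma _ mgoodE) => w; rewrite lee_fin.
by apply: measurableT_comp.
Qed.

(* A proportion [s] of each configuration [x] of [E] is exchanged with a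
   configuration drawn from [gamma] conditioned on [F] and on separation from
   [x]. A configuration of [F] is used at most with weight [s * m / z0]. *)
Let q (w : BXN * BXN) : R := (s * (E w.1)%:R * (Zr w.1)^-1 * (good w)%:R)%R.

Let q0 w : (0 <= q w)%R.
Proof. by rewrite !mulr_ge0// ?invr_ge0 ltW. Qed.

Let mq : measurable_fun [set: BXN * BXN] q.
Proof.
apply: measurable_funM; last exact: measurable_bool_natr.
apply: measurable_funM.
  apply: measurable_funM => //.
  exact: (measurableT_comp (measurable_bool_natr (R:=R) mE)).
have mi : measurable_fun [set: BXN] (fun x => (Zr x)^-1)%R.
  rewrite (_ : (fun x => _) = (@powR R)^~ (- 1)%R \o Zr).
    exact: (measurableT_comp (measurable_powR _)).
  by apply/funext => x /=; rewrite powR_inv1// ltW.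
exact: (measurableT_comp mi).
Qed.

Let mqE : measurable_fun [set: BXN * BXN] (fun w => (q w)%:E).
Proof. exact/measurable_EFinP. Qed.

Let mass : \int[gamma]_x ((E x)%:R : R)%:E = m%:E.
Proof. by rewrite ge0_integral_bool// fineK// fin_num_measure. Qed.

Let q1 x : \int[gamma]_y (q (x, y))%:E = (s * (E x)%:R)%:E.
Proof.
have qE y : (q (x, y))%:E = (s * (E x)%:R * (Zr x)^-1)%:E * ((good (x, y))%:R : R)%:E.
  by rewrite -EFinM.
under eq_integral do rewrite qE.
rewrite ge0_integralZl//; first last.
- by rewrite lee_fin !mulr_ge0// ?invr_ge0 ltW.
- exact: (measurable_fun_pair2 _ mgoodE).
by rewrite -/(Z x) -(fineK (Zfin x)) -EFinM mulfVK// gt_eqF// Zr_gt0.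
Qed.

Let q2 y : \int[gamma]_x (q (x, y))%:E <= (s * m / z0 * (F y)%:R)%:E.
Proof.
apply: (@le_trans _ _ (\int[gamma]_x ((s / z0 * (F y)%:R)%:E * ((E x)%:R)%:E))).
  apply: ge0_le_integral => //.
  - by move=> x _; rewrite lee_fin.
  - exact: (measurable_fun_pair1 _ mqE).
  - by apply: measurable_funeM; exact: measurable_bool_EFin.
  move=> x _; rewrite -EFinM lee_fin /q /good/=.
  case: (E x); last by rewrite !(mulr0, mul0r).
  case: (F y) => /=; last by rewrite !(mulr0, mul0r).
  rewrite !mulr1 -!mulrA ler_pM2l// (@le_trans _ _ (Zr x)^-1%R)//.
    by rewrite ler_piMr ?lern1 ?leq_b1// invr_ge0 ltW.
  by rewrite lef_pV2 ?posrE.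
rewrite ge0_integralZl//; first last.
- by rewrite lee_fin mulr_ge0// divr_ge0// ltW.
- exact: measurable_bool_EFin.
by rewrite mass -EFinM lee_fin (_ : s / z0 * _ * _ = s * m / z0 * (F y)%:R)%R//; ring.
Qed.

(** [pi] is the law of the exchanged pairs: its first marginal is known, its
    second one is dominated by [gamma], and inequalities need only be checked on
    the pairs that are exchanged. The marginals of the plan are preserved because
    an exchange only permutes the [j]-th points of the two configurations. *)
Lemma swap_plan_exists :
  exists (gamma' : probability BXN R) (pi : {measure set (BXN * BXN) -> \bar R}),
  [/\ has_marginals gamma' (fun=> rho),
      forall phi : BXN -> \bar R, measurable_fun setT phi -> (forall x, 0 <= phi x) ->
        \int[gamma']_x phi x + \int[pi]_w (phi w.1 + phi w.2) =
        \int[gamma]_x phi x + \int[pi]_w (phi (swap1 i w) + phi (swap2 i w)),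
      forall phi : BXN -> \bar R, measurable_fun setT phi -> (forall x, 0 <= phi x) ->
        \int[pi]_w phi w.1 = \int[gamma]_x ((s * (E x)%:R)%:E * phi x),
      forall phi : BXN -> \bar R, measurable_fun setT phi -> (forall x, 0 <= phi x) ->
        \int[pi]_w phi w.2 <= \int[gamma]_x phi x &
      forall H H' : BXN * BXN -> \bar R, measurable_fun setT H -> measurable_fun setT H' ->
        (forall w, 0 <= H w) -> (forall w, 0 <= H' w) ->
        (forall w, E w.1 -> F w.2 -> separated b i w -> H w <= H' w) ->
        \int[pi]_w H w <= \int[pi]_w H' w].
Proof.
pose pi := [the {measure set (BXN * BXN) -> \bar R} of
  density_image (gamma \x gamma) q0 mq (@measurable_id _ _ setT)].
have piE (H : BXN * BXN -> \bar R) : measurable_fun setT H -> (forall w, 0 <= H w) ->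
    \int[pi]_w H w = \int[gamma \x gamma]_w ((q w)%:E * H w).
  by move=> mH H0; rewrite ge0_integral_density_image.
have q12 z : \int[gamma]_y (q (z, y))%:E + \int[gamma]_x (q (x, z))%:E <= 1.
  by rewrite q1 (le_trans (leeD2l _ (q2 z)))// -EFinD lee_fin.
have [gamma' hg] := swapped_probability mq q0 (measurable_swap1 i) (measurable_swap2 i) q12.
have mid (phi : BXN -> \bar R) (S : BXN * BXN -> BXN) : measurable_fun setT phi ->
    measurable_fun setT S -> measurable_fun setT (fun w => phi (S w)).
  by move=> mphi mS; exact: (measurableT_comp mphi).
have hpi (phi : BXN -> \bar R) : measurable_fun setT phi -> (forall x, 0 <= phi x) ->
    \int[gamma']_x phi x + \int[pi]_w (phi w.1 + phi w.2) =
    \int[gamma]_x phi x + \int[pi]_w (phi (swap1 i w) + phi (swap2 i w)).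
  move=> mphi phi0; rewrite piE; last 2 first.
  - by apply: emeasurable_funD; apply: mid.
  - by move=> w; rewrite adde_ge0.
  rewrite hg// piE//.
  - by apply: emeasurable_funD; apply: mid => //; [exact: measurable_swap1|exact: measurable_swap2].
  - by move=> w; rewrite adde_ge0.
have pi1 (phi : BXN -> \bar R) : measurable_fun setT phi -> (forall x, 0 <= phi x) ->
    \int[pi]_w phi w.1 = \int[gamma]_x ((s * (E x)%:R)%:E * phi x).
  move=> mphi phi0; rewrite piE//; last exact: mid.
  rewrite fubini_tonelli1//; first last.
  - by move=> w; rewrite mule_ge0// lee_fin.
  - by apply: emeasurable_funM => //; exact: mid.
  apply: eq_integral => x _; rewrite /fubini_F/=.
  rewrite ge0_integralZr// ?q1// => [|y _]; last by rewrite lee_fin.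
  exact: (measurable_fun_pair2 _ mqE).
have pi2 (phi : BXN -> \bar R) : measurable_fun setT phi -> (forall x, 0 <= phi x) ->
    \int[pi]_w phi w.2 <= \int[gamma]_x phi x.
  move=> mphi phi0; rewrite piE//; last exact: mid.
  have mqphi : measurable_fun setT (fun w => (q w)%:E * phi w.2).
    by apply: emeasurable_funM => //; exact: mid.
  have qphi0 w : 0 <= (q w)%:E * phi w.2 by rewrite mule_ge0// lee_fin.
  rewrite fubini_tonelli2//.
  apply: ge0_le_integral => //.
  - by move=> y _; apply: integral_ge0 => x _; exact: qphi0.
  - exact: measurable_fun_fubini_tonelli_G.
  move=> y _; rewrite /fubini_G/=.
  rewrite ge0_integralZr//; first last.
  - by move=> x _; rewrite lee_fin.
  - exact: (measurable_fun_pair1 _ mqE).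
  rewrite -[leRHS]mul1e lee_wpmul2r//.
  by apply: le_trans (q12 y); rewrite leeDr// q1 lee_fin mulr_ge0// ltW.
exists gamma', pi; split => //.
- move=> j A mA.
  have mA1 : measurable_fun setT (fun x : BXN => (\1_A (x j))%:E : \bar R).
    by apply/measurable_EFinP; exact: (measurableT_comp _ (measurable_coord j)).
  have A10 (x : BXN) : 0 <= (\1_A (x j))%:E :> \bar R by rewrite lee_fin.
  have A1 (P : probability BXN R) : \int[P]_x (\1_A (x j))%:E = P [set x | A (x j)].
    have mAj : measurable [set x : BXN | A (x j)].
      by rewrite -[X in measurable X]setTI; exact: measurable_coord.
    transitivity (\int[P]_x (\1_[set x : BXN | A (x j)] x)%:E); first by [].
    by rewrite integral_indic// setIT.
  rewrite -(gr j mA) -!A1.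
  have := hpi _ mA1 A10.
  have -> : \int[pi]_w ((\1_A (swap1 i w j))%:E + (\1_A (swap2 i w j))%:E) =
            \int[pi]_w ((\1_A (w.1 j))%:E + (\1_A (w.2 j))%:E).
    apply: eq_integral => w _; rewrite /swap1 /swap2.
    by case: eqP => [->|//]; rewrite addeC.
  apply: addIe; rewrite ge0_integralD//; last 2 first.
  - exact: (mid _ _ mA1).
  - exact: (mid _ _ mA1).
  have A1le (P : probability BXN R) : P [set x | A (x j)] <= 1.
    apply: probability_le1.
    by rewrite -[X in measurable X]setTI; exact: measurable_coord.
  rewrite fin_numD (pi1 _ mA1 A10); apply/andP; split.
    rewrite ge0_fin_numE; last by apply: integral_ge0 => x _; rewrite mule_ge0// lee_fin mulr_ge0// ltW.
    apply: (@le_lt_trans _ _ (\int[gamma]_x (s%:E * (\1_A (x j))%:E))).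
      apply: ge0_le_integral => //.
      - by move=> x _; rewrite mule_ge0// lee_fin mulr_ge0// ltW.
      - apply: emeasurable_funM => //; apply/measurable_EFinP.
        by apply: measurable_funM => //; exact: measurable_bool_natr.
      - exact: measurable_funeM.
      - by move=> x _; rewrite lee_wpmul2r// lee_fin ler_piMr ?lern1 ?leq_b1// ltW.
    rewrite ge0_integralZl//; last by rewrite lee_fin ltW.
    by rewrite A1 lte_mul_pinfty ?lee_fin ?(ltW s0)// (le_lt_trans (A1le _))// ltry.
  rewrite ge0_fin_numE; last exact: integral_ge0.
  by rewrite (le_lt_trans (pi2 _ mA1 A10))// A1 (le_lt_trans (A1le _))// ltry.
- move=> H H' mH mH' H0 H'0 HH'; rewrite !piE//.
  apply: ge0_le_integral => //.
  - by move=> w _; rewrite mule_ge0// lee_fin.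
  - exact: emeasurable_funM.
  - exact: emeasurable_funM.
  move=> w _; rewrite /q /good.
  case Ew : (E w.1); last by rewrite !(mulr0, mul0r, mul0e).
  case Fw : (F w.2); last by rewrite /= !(mulr0, mul0e).
  case sw : (separated b i w); last by rewrite /= !(mulr0, mul0e).
  by rewrite lee_wpmul2l ?HH'// lee_fin !mulr_ge0// ?invr_ge0 ltW.
Qed.

End construction.
End swap_plan.

(** * Exchanges reduce the crowding and the energy *)

Section pair_sum.
Context {R : realType} {N : nat}.
Implicit Types c : 'I_N -> 'I_N -> R.

Definition pair_sum c := \sum_(i < N) \sum_(j < N | (i < j)%N) c i j.

Lemma pair_sum_ge0 c : (forall i j : 'I_N, (i < j)%N -> 0 <= c i j) -> 0 <= pair_sum c.
Proof. by move=> c0; apply: sumr_ge0 => i _; apply: sumr_ge0 => j; exact: c0. Qed.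

Lemma le_pair_sum c c' : (forall i j : 'I_N, (i < j)%N -> c i j <= c' i j) ->
  pair_sum c <= pair_sum c'.
Proof. by move=> cc'; apply: ler_sum => i _; apply: ler_sum => j; exact: cc'. Qed.

Lemma pair_sum_ge c (i j : 'I_N) : (forall i j : 'I_N, (i < j)%N -> 0 <= c i j) -> (i < j)%N ->
  c i j <= pair_sum c.
Proof.
move=> c0 ij; rewrite /pair_sum (bigD1 i)//= (bigD1 j)//= -addrA lerDl.
rewrite addr_ge0// sumr_ge0// => [k /andP[/c0]//|k _].
by apply: sumr_ge0 => l; exact: c0.
Qed.

Lemma pair_sumD c c' : pair_sum (fun i j => c i j + c' i j) = pair_sum c + pair_sum c'.
Proof. by rewrite /pair_sum -big_split/=; apply: eq_bigr => i _; rewrite big_split. Qed.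

Lemma pair_sumB c c' : pair_sum (fun i j => c i j - c' i j) = pair_sum c - pair_sum c'.
Proof. by rewrite /pair_sum -sumrB; apply: eq_bigr => i _; rewrite sumrB. Qed.

Lemma pair_sum_le_sum (K : R) (h : 'I_N -> R) : 0 <= K -> (forall i, 0 <= h i) ->
  pair_sum (fun i j => K + (h i + h j)) <= K * N%:R ^+ 2 + 2 * N%:R * \sum_(i < N) h i.
Proof.
move=> K0 h0.
apply: (@le_trans _ _ (\sum_(i < N) \sum_(j < N) (K + (h i + h j)))).
  apply: ler_sum => i _; rewrite [leRHS](bigID (fun j : 'I_N => (i < j)%N))/= lerDl.
  by apply: sumr_ge0 => j _; rewrite !addr_ge0.
under eq_bigr do rewrite !big_split/= !sumr_const card_ord.
rewrite !big_split/= !sumr_const card_ord sumrMnl.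
by rewrite le_eqVlt; apply/orP; left; apply/eqP; ring.
Qed.

End pair_sum.

Section swap_cost.
Context {R : realType} {X : polishMetricType R} {N : nat}.
Local Notation BX := (borelType X).
Local Notation BXN := (borelType {ptws 'I_N -> X}).

Definition crowded (delta : R) (i : 'I_N) (x : BXN) : bool :=
  [exists j, (j != i) && (mdist (x i : X) (x j) < delta)].

Lemma measurable_crowded delta i : measurable [set x | crowded delta i x].
Proof.
rewrite (_ : [set x | _] = ~` [set x : BXN | [forall j, (j != i) ==>
    (delta <= mdist (x i : X) (x j))]]).
  apply: measurableC; apply: measurable_fin_forall => j _.
  by apply: measurable_mdist_ge; exact: measurable_coord.
apply/seteqP; split => x /=.
  move=> /existsP[j /andP[ji xij]] /forallP/(_ j)/implyP/(_ ji).
  by rewrite leNgt xij.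
move=> /negP; rewrite negb_forall => /existsP[j]; rewrite negb_imply -ltNge => h.
by apply/existsP; exists j.
Qed.

Variables (F : X -> X -> R) (g : X -> R) (delta b K M : R).
Hypotheses (F0 : forall x y, 0 <= F x y) (g0 : forall x, 0 <= g x).
Hypothesis K0 : 0 <= K.
Hypothesis F_far : forall x y, b <= mdist x y -> F x y <= K + g x + g y.
Hypothesis F_close : forall x y, mdist x y < delta -> M <= F x y.

Definition pair_energy (x : BXN) : R := pair_sum (fun i j => F (x i) (x j)).

Lemma pair_energy_ge0 x : 0 <= pair_energy x.
Proof. exact: pair_sum_ge0. Qed.

(** Exchanging the [i]-th points only changes the pairs that contain [i]: the
    pairs created are at distance [b] at least, hence cost at most [K] and the
    value of [g], and the crowded pair that was destroyed cost at least [M]. *)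
Lemma pair_energy_swap i (w : BXN * BXN) : separated b i w ->
  pair_energy (swap1 i w) + pair_energy (swap2 i w) + M * (crowded delta i w.1)%:R <=
  pair_energy w.1 + pair_energy w.2 +
  (2 * K * N%:R ^+ 2 + 2 * N%:R * \sum_(a < N) (g (w.1 a) + g (w.2 a))).
Proof.
case: w => x y /= /forallP sep.
have sepl j : j != i -> b <= mdist (x i : X) (y j) by move=> ji; have /implyP/(_ ji)/andP[] := sep j.
have sepr j : j != i -> b <= mdist (x j : X) (y i) by move=> ji; have /implyP/(_ ji)/andP[] := sep j.
pose h a := g (x a) + g (y a).
have h0 a : 0 <= h a by rewrite addr_ge0.
(* the gain of the exchange on the pair [(a, c)], increased by the bound on the
   cost of two far pairs, which makes it nonnegative *)
pose D (a c : 'I_N) := F (x a) (x c) + F (y a) (y c) + (2 * K + (h a + h c)) -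
  (F (swap1 i (x, y) a) (swap1 i (x, y) c) + F (swap2 i (x, y) a) (swap2 i (x, y) c)).
have Di (a c : 'I_N) : (a < c)%N -> (a == i) || (c == i) -> F (x a) (x c) <= D a c.
  move=> ac; have ca : c != a by apply: contraTneq ac => ->; rewrite ltnn.
  have Fy := F0 (y a) (y c).
  have [ai _|ai /= /eqP ci] := eqVneq a i.
    rewrite ai in ca Fy *.
    rewrite /D /swap1 /swap2/= eqxx (negbTE ca) /h.
    have : F (y i) (x c) <= K + g (y i) + g (x c).
      by apply: F_far; rewrite mdistC; exact: sepr.
    move: Fy (F_far (sepl _ ca)).
    move: (F _ _) (F _ _) (F _ _) (F _ _) (g _) (g _) (g _) (g _) => *; lra.
  rewrite ci in Fy *.
  rewrite /D /swap1 /swap2/= eqxx (negbTE ai) /h.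
  have : F (y a) (x i) <= K + g (y a) + g (x i).
    by apply: F_far; rewrite mdistC; exact: sepl.
  move: Fy (F_far (sepr _ ai)).
  move: (F _ _) (F _ _) (F _ _) (F _ _) (g _) (g _) (g _) (g _) => *; lra.
have D0 (a c : 'I_N) : (a < c)%N -> 0 <= D a c.
  move=> ac; have [aci|] := boolP ((a == i) || (c == i)).
    exact: le_trans (Di _ _ ac aci).
  rewrite negb_or => /andP[ai ci].
  rewrite /D /swap1 /swap2/= (negbTE ai) (negbTE ci).
  by rewrite addrC addKr !addr_ge0// mulr_ge0.
have MD : M * (crowded delta i x)%:R <= pair_sum D.
  have [|_] := boolP (crowded delta i x); last by rewrite mulr0 pair_sum_ge0.
  rewrite mulr1 => /existsP[j /andP[ji xij]].
  have [ij|ij] := ltnP i j.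
    rewrite (le_trans (F_close xij))// (le_trans (Di _ _ ij _)) ?eqxx//.
    exact: pair_sum_ge.
  have {}ij : (j < i)%N by rewrite ltn_neqAle ij andbT; apply: contraNneq ji => /val_inj ->.
  rewrite mdistC in xij.
  rewrite (le_trans (F_close xij))// (le_trans (Di _ _ ij _)) ?eqxx ?orbT//.
  exact: pair_sum_ge.
have DE : pair_sum D = pair_energy x + pair_energy y +
    pair_sum (fun a c => 2 * K + (h a + h c)) -
    (pair_energy (swap1 i (x, y)) + pair_energy (swap2 i (x, y))).
  by rewrite /D pair_sumB !pair_sumD.
have := pair_sum_le_sum (mulr_ge0 (ler0n _ 2) K0) h0.
move: MD; rewrite DE lerBrDl => MD hsum; apply: le_trans MD _.
by rewrite lerD2l.
Qed.

End swap_cost.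

Section swap_step.
Context {R : realType} {X : polishMetricType R} {N : nat}.
Local Notation BX := (borelType X).
Local Notation BXN := (borelType {ptws 'I_N -> X}).
Local Open Scope ereal_scope.

(** For each [j] other than [i] there are two balls to be avoided, [y j] near
    [x i] and [y i] near [x j], and each has mass at most [kappa]. *)
Lemma good_mass (rho : probability BX R) (gamma : probability BXN R) (i : 'I_N)
    (F : BXN -> bool) (b kappa m : R) :
  has_marginals gamma (fun=> rho) -> measurable [set x | F x] ->
  (forall x : X, rho (ball x b) <= kappa%:E) ->
  gamma [set x | ~~ F x] <= m%:E ->
  forall x, (1 - m - 2 * N.-1%:R * kappa)%:E <=
    \int[gamma]_y ((F y && separated b i (x, y))%:R : R)%:E.
Proof.
move=> gr mF rb hm x.
have mnF : measurable [set y | ~~ F y].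
  rewrite (_ : [set y | _] = ~` [set y | F y]); first exact: measurableC.
  by apply/seteqP; split => y /= /negP.
pose cl (u : X) (j : 'I_N) (y : BXN) : bool := (mdist u (y j) < b)%R.
have mcl0 u : measurable [set y : BX | (mdist u (y : X) < b)%R].
  rewrite (_ : [set y | _] = ~` [set y : BX | (b <= mdist u (y : X))%R]).
    by apply: measurableC; apply: measurable_mdist_ge.
  by apply/seteqP; split => y /=; [rewrite ltNge => /negP|move=> /negP; rewrite -ltNge].
have mcl u j : measurable [set y | cl u j y].
  rewrite -[X in measurable X]setTI; exact: (measurable_coord j measurableT (mcl0 u)).
have icl u j : \int[gamma]_y ((cl u j y)%:R : R)%:E <= kappa%:E.
  rewrite ge0_integral_bool// (le_trans _ (rb u))// ballEmdist.
  by have <- := gr j _ (mcl0 u).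
have mgood : measurable_fun setT (fun y => ((F y && separated b i (x, y))%:R : R)%:E).
  apply: measurable_bool_EFin.
  rewrite (_ : [set y | _] = [set y | F y] `&` [set y | separated b i (x, y)]).
    apply: measurableI => //.
    rewrite -[X in measurable X]setTI.
    exact: (pair1_measurable x measurableT (measurable_separated b i)).
  by apply/seteqP; split => y /= /andP.
pose cc j y : R := if j != i then ((cl (x i) j y)%:R + (cl (x j) i y)%:R)%R else 0%R.
pose close y : R := (\sum_(j < N) cc j y)%R.
have mcc j : measurable_fun setT (cc j).
  by rewrite /cc; case: (j != i) => //; apply: measurable_funD; exact: (measurable_bool_natr (mcl _ _)).
have cc0 j y : (0 <= cc j y)%R by rewrite /cc; case: ifP => // _; rewrite addr_ge0.
have mclose : measurable_fun setT (fun y => (close y)%:E).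
  by apply/measurable_EFinP; apply: measurable_sum.
have close0 y : (0 <= close y)%R by apply: sumr_ge0.
have iclose : \int[gamma]_y (close y)%:E <= (2 * N.-1%:R * kappa)%:E.
  under eq_integral do rewrite -sumEFin.
  rewrite ge0_integral_sum//; [|by move=> j; exact/measurable_EFinP|by move=> j y _; rewrite lee_fin].
  apply: (@le_trans _ _ (\sum_(j < N) (if j != i then kappa + kappa else 0)%:E)).
    apply: lee_sum => j _; rewrite /cc; case: (j != i); last by rewrite integral0.
    under eq_integral do rewrite EFinD.
    rewrite ge0_integralD//; [|exact: measurable_bool_EFin|exact: measurable_bool_EFin].
    by rewrite EFinD leeD.
  rewrite sumEFin -big_mkcond sumr_const cardC1 card_ord lee_fin.
  by rewrite le_eqVlt; apply/orP; left; apply/eqP; ring.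
have one : 1 <= \int[gamma]_y ((F y && separated b i (x, y))%:R : R)%:E +
    (\int[gamma]_y ((~~ F y)%:R : R)%:E + \int[gamma]_y (close y)%:E).
  rewrite -ge0_integralD//; first last.
  - by move=> y _; rewrite lee_fin.
  - exact: measurable_bool_EFin.
  rewrite -ge0_integralD//; first last.
  - by apply: emeasurable_funD => //; exact: measurable_bool_EFin.
  - by move=> y _; rewrite adde_ge0// lee_fin.
  have -> : 1 = \int[gamma]_y cst 1 y.
    by rewrite integral_cst//= mul1e probability_setT.
  apply: ge0_le_integral => //.
  - apply: emeasurable_funD => //; apply: emeasurable_funD => //.
    exact: measurable_bool_EFin.
  move=> y _ /=; rewrite -!EFinD lee_fin.
  case: (F y) => /=; last by rewrite add0r lerDl.
  have [_|] := boolP (separated b i (x, y)).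
    by rewrite lerDl add0r.
  rewrite negb_forall => /existsP[j]; rewrite negb_imply => /andP[ji].
  rewrite !add0r /close (bigD1 j)//= negb_and -!ltNge => /orP h.
  apply: (@le_trans _ _ (cc j y)); last by rewrite lerDl; exact: sumr_ge0.
  by rewrite /cc ji; case: h => h; rewrite /cl h /= ?lerDl ?lerDr.
have Zfin : \int[gamma]_y ((F y && separated b i (x, y))%:R : R)%:E \is a fin_num.
  rewrite ge0_fin_numE; last by apply: integral_ge0 => y _; rewrite lee_fin.
  rewrite (@le_lt_trans _ _ (\int[gamma]_y cst 1 y))//.
    by apply: ge0_le_integral => // y _; rewrite lee_fin lern1 leq_b1.
  by rewrite integral_cst//= mul1e; rewrite (_ : gamma setT = 1) ?ltry// probability_setT.
rewrite (ge0_integral_bool gamma mnF) in one.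
have := le_trans one (leeD2l _ (leeD hm iclose)).
by rewrite -(fineK Zfin) -!EFinD !lee_fin; lra.
Qed.

Variables (F : X -> X -> R) (g : X -> R) (delta b K M A tau : R).
Hypotheses (F0 : forall x y, (0 <= F x y)%R) (g0 : forall x, (0 <= g x)%R).
Hypotheses (mg : measurable_fun [set: BX] g).
Hypothesis mF : forall i j, measurable_fun [set: BXN] (fun x => F (x i) (x j)).
Hypotheses (K0 : (0 <= K)%R) (M0 : (0 <= M)%R) (A0 : (0 <= A)%R).
Hypothesis delta_b : (delta <= b)%R.
Hypothesis F_far : forall x y, (b <= mdist x y -> F x y <= K + g x + g y)%R.
Hypothesis F_close : forall x y, (mdist x y < delta -> M <= F x y)%R.

Lemma measurable_pair_energy : measurable_fun [set: BXN] (pair_energy F).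
Proof.
have -> : pair_energy F = fun x : BXN =>
    (\sum_(i < N) \sum_(j < N) if (i < j)%N then F (x i) (x j) else 0)%R.
  by apply/funext => x; apply: eq_bigr => i _; rewrite big_mkcond.
by apply: measurable_sum => i; apply: measurable_sum => j; case: (i < j)%N.
Qed.

Lemma crowded_swap1 (i k : 'I_N) (w : BXN * BXN) : separated b i w -> crowded delta k (swap1 i w) ->
  k != i /\ crowded delta k w.1.
Proof.
case: w => x y /forallP/= sep /existsP[j /andP[jk]]; rewrite /swap1/=.
have [ki|ki] := eqVneq k i.
  have ji : j != i by rewrite -ki.
  have /implyP/(_ ji)/andP[_ h] := sep j.
  by rewrite (negbTE ji) mdistC ltNge (le_trans delta_b h).
have [ji|ji] := eqVneq j i.
  have /implyP/(_ ki)/andP[_ h] := sep k.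
  by rewrite ltNge (le_trans delta_b h).
by move=> h; split => //; apply/existsP; exists j; rewrite jk.
Qed.

Lemma crowded_swap2 (i k : 'I_N) (w : BXN * BXN) : separated b i w -> crowded delta k (swap2 i w) ->
  crowded delta k w.2.
Proof.
case: w => x y /forallP/= sep /existsP[j /andP[jk]]; rewrite /swap2/=.
have [ki|ki] := eqVneq k i.
  have ji : j != i by rewrite -ki.
  have /implyP/(_ ji)/andP[h _] := sep j.
  by rewrite (negbTE ji) ltNge (le_trans delta_b h).
have [ji|ji] := eqVneq j i.
  have /implyP/(_ ki)/andP[h _] := sep k.
  by rewrite mdistC ltNge (le_trans delta_b h).
by move=> h; apply/existsP; exists j; rewrite jk.
Qed.

(** The configurations crowded at [i] are exchanged, with weight [s], against
    configurations of [P]. The energy decreases by [M] for each of them, up to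
    terms that are controlled by the tail of [g]. If moreover [P] excludes
    crowding, no crowding is created, and with full weight that at [i] vanishes. *)
Lemma swap_step (rho : probability BX R) (gamma : probability BXN R) (i : 'I_N)
    (P : BXN -> bool) (s z0 : R) :
  has_marginals gamma (fun=> rho) ->
  \int[rho]_x (excess g A x)%:E <= tau%:E ->
  \int[gamma]_x (pair_energy F x)%:E \is a fin_num ->
  measurable [set x | P x] -> (0 < s <= 1)%R -> (0 < z0)%R ->
  (forall x, z0%:E <= \int[gamma]_y ((P y && separated b i (x, y))%:R : R)%:E) ->
  let m := fine (gamma [set x | crowded delta i x]) in
  (forall z, s * (crowded delta i z)%:R + s * m / z0 * (P z)%:R <= 1)%R ->
  exists gamma' : probability BXN R,
  [/\ has_marginals gamma' (fun=> rho),
      \int[gamma']_x (pair_energy F x)%:E + (M * (s * m))%:E <=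
      \int[gamma]_x (pair_energy F x)%:E +
      ((2 * K + 4 * A) * N%:R ^+ 2 * (s * m) + 4 * N%:R ^+ 2 * tau)%:E,
      (forall x k, P x -> ~~ crowded delta k x) ->
      forall k, gamma' [set x | crowded delta k x] <= gamma [set x | crowded delta k x] &
      (forall x k, P x -> ~~ crowded delta k x) -> s = 1%R ->
      gamma' [set x | crowded delta i x] = 0].
Proof.
move=> gr rtau efin mP /andP[s0 s1] z0_gt0 hZ m hs.
have [gamma' [pi [g'r hid hpi1 hpi2 hpile]]] :=
  swap_plan_exists (measurable_crowded delta i) mP gr s0 z0_gt0 hZ hs.
have mm : \int[gamma]_x ((crowded delta i x)%:R : R)%:E = m%:E.
  by rewrite ge0_integral_bool ?fineK ?fin_num_measure//; exact: measurable_crowded.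
have m0 : (0 <= m)%R by exact: fine_ge0.
have s0' := ltW s0.
have mEi (k : 'I_N) : measurable_fun [set: BXN] (fun x : BXN => ((crowded delta k x)%:R : R)%:E).
  by apply: measurable_bool_EFin; exact: measurable_crowded.
have msE : measurable_fun [set: BXN] (fun x => (s * (crowded delta i x)%:R : R)%:E).
  apply/measurable_EFinP; apply: measurable_funM => //; apply: measurable_bool_natr.
  exact: measurable_crowded.
have mfst (phi : BXN -> \bar R) : measurable_fun setT phi -> measurable_fun setT (fun w : BXN * BXN => phi w.1).
  by move=> mphi; exact: (measurableT_comp mphi).
have msnd (phi : BXN -> \bar R) : measurable_fun setT phi -> measurable_fun setT (fun w : BXN * BXN => phi w.2).
  by move=> mphi; exact: (measurableT_comp mphi).
have msw1 (phi : BXN -> \bar R) : measurable_fun setT phi -> measurable_fun setT (fun w => phi (swap1 i w)).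
  by move=> mphi; exact: (measurableT_comp mphi (measurable_swap1 i)).
have msw2 (phi : BXN -> \bar R) : measurable_fun setT phi -> measurable_fun setT (fun w => phi (swap2 i w)).
  by move=> mphi; exact: (measurableT_comp mphi (measurable_swap2 i)).
have piC c : (0 <= c)%R -> \int[pi]_w c%:E = (c * (s * m))%:E.
  move=> c0; rewrite (hpi1 (fun=> c%:E))// ge0_integralZr//; last first.
    by move=> x _; rewrite lee_fin mulr_ge0.
  under eq_integral do rewrite EFinM.
  rewrite ge0_integralZl// ?lee_fin//.
  by rewrite mm -!EFinM mulrC.
have pi1_le (phi : BXN -> \bar R) : measurable_fun setT phi -> (forall x, 0 <= phi x) ->
    \int[pi]_w phi w.1 <= \int[gamma]_x phi x.
  move=> mphi phi0; rewrite hpi1//; apply: ge0_le_integral => //.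
  - by move=> x _; rewrite mule_ge0// lee_fin mulr_ge0.
  - exact: emeasurable_funM.
  move=> x _; rewrite -[leRHS]mul1e lee_wpmul2r// lee_fin.
  by rewrite mulr_ile1 ?lern1 ?leq_b1.
(* the mass exchanged with weight [phi] is finite, so it can be cancelled *)
have pifin (phi : BXN -> \bar R) : measurable_fun setT phi -> (forall x, 0 <= phi x) ->
    \int[gamma]_x phi x \is a fin_num -> \int[pi]_w (phi w.1 + phi w.2) \is a fin_num.
  move=> mphi phi0 fphi; rewrite ge0_integralD//; [|exact: mfst|exact: msnd].
  have glt : \int[gamma]_x phi x < +oo by rewrite -ge0_fin_numE//; exact: integral_ge0.
  rewrite fin_numD; apply/andP; split.
    by rewrite ge0_fin_numE ?(le_lt_trans (pi1_le _ mphi phi0))//; exact: integral_ge0.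
  by rewrite ge0_fin_numE ?(le_lt_trans (hpi2 _ mphi phi0))//; exact: integral_ge0.
have cfin k : \int[gamma]_x ((crowded delta k x)%:R : R)%:E \is a fin_num.
  by rewrite ge0_integral_bool ?fin_num_measure//; exact: measurable_crowded.
have cr0 (k : 'I_N) (x : BXN) : 0 <= ((crowded delta k x)%:R : R)%:E by rewrite lee_fin.
exists gamma'; split => //.
- pose phi (x : BXN) : \bar R := (pair_energy F x)%:E.
  have mphi : measurable_fun setT phi by apply/measurable_EFinP; exact: measurable_pair_energy.
  have phi0 x : 0 <= phi x by rewrite lee_fin pair_energy_ge0.
  pose u (x : BXN) := \sum_(a < N) (excess g A (x a))%:E.
  have mexa a : measurable_fun setT (fun x : BXN => (excess g A (x a))%:E).
    exact: (measurableT_comp (measurable_excess A mg) (measurable_coord a)).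
  have mu_ : measurable_fun setT u by exact: emeasurable_sum.
  have u0 x : 0 <= u x by apply: sume_ge0 => a _; rewrite lee_fin excess_ge0.
  have intu : \int[gamma]_x u x <= (N%:R * tau)%:E.
    rewrite ge0_integral_sum//; last by move=> a x _; rewrite lee_fin excess_ge0.
    apply: (@le_trans _ _ (\sum_(a < N) tau%:E)).
      apply: lee_sum => a _; apply: le_trans rtau.
      rewrite (ge0_integral_marginal a (psi := fun x => (excess g A x)%:E) gr)//.
        exact: measurable_excess.
      by move=> x; rewrite lee_fin excess_ge0.
    by rewrite sumEFin sumr_const card_ord mulr_natl.
  pose C := ((2 * K + 4 * A) * N%:R ^+ 2)%R.
  have C0 : (0 <= C)%R by rewrite mulr_ge0// addr_ge0 ?mulr_ge0.
  have N20 : (0 <= 2 * N%:R :> R)%R by rewrite mulr_ge0.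
  have key : \int[pi]_w ((phi (swap1 i w) + phi (swap2 i w)) + M%:E) <=
     \int[pi]_w ((phi w.1 + phi w.2) + (C%:E + (2 * N%:R)%:E * (u w.1 + u w.2))).
    apply: hpile.
    - by apply: emeasurable_funD => //; apply: emeasurable_funD; [exact: msw1|exact: msw2].
    - apply: emeasurable_funD; first by apply: emeasurable_funD; [exact: mfst|exact: msnd].
      apply: emeasurable_funD => //; apply: measurable_funeM.
      by apply: emeasurable_funD; [exact: mfst|exact: msnd].
    - by move=> w; rewrite !adde_ge0// lee_fin.
    - by move=> w; rewrite !adde_ge0// ?mule_ge0 ?adde_ge0// lee_fin.
    move=> w Ew _ sepw.
    rewrite /phi /u !sumEFin -!EFinD lee_fin.
    have := pair_energy_swap F0 g0 K0 F_far F_close sepw; rewrite Ew mulr1.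
    move=> /le_trans; apply; rewrite lerD2l.
    have : (\sum_(a < N) (g (w.1 a) + g (w.2 a)) <=
       \sum_(a < N) ((A + excess g A (w.1 a)) + (A + excess g A (w.2 a))))%R.
      by apply: ler_sum => a _; apply: lerD; exact: le_excess.
    rewrite !big_split/= sumr_const card_ord => hg.
    rewrite (@le_trans _ _ (2 * K * N%:R ^+ 2 + 2 * N%:R * (A *+ N + \sum_(a < N) excess g A (w.1 a) +
       (A *+ N + \sum_(a < N) excess g A (w.2 a))))%R)//.
      by rewrite lerD2l ler_wpM2l// big_split.
    rewrite /C le_eqVlt; apply/orP; left; apply/eqP.
    by move: (\sum_(_ < N) _)%R (\sum_(_ < N) _)%R => s1' s2'; ring.
  have keyL : \int[pi]_w ((phi (swap1 i w) + phi (swap2 i w)) + M%:E) =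
      \int[pi]_w (phi (swap1 i w) + phi (swap2 i w)) + (M * (s * m))%:E.
    rewrite ge0_integralD ?piC//.
    - by move=> w _; rewrite adde_ge0.
    - by apply: emeasurable_funD; [exact: msw1|exact: msw2].
  have keyR : \int[pi]_w ((phi w.1 + phi w.2) + (C%:E + (2 * N%:R)%:E * (u w.1 + u w.2))) =
      \int[pi]_w (phi w.1 + phi w.2) +
      \int[pi]_w (C%:E + (2 * N%:R)%:E * (u w.1 + u w.2)).
    rewrite ge0_integralD//.
    - by move=> w _; rewrite adde_ge0.
    - by apply: emeasurable_funD; [exact: mfst|exact: msnd].
    - by move=> w _; rewrite !adde_ge0// ?mule_ge0 ?adde_ge0// lee_fin.
    - apply: emeasurable_funD => //; apply: measurable_funeM.
      by apply: emeasurable_funD; [exact: mfst|exact: msnd].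
  rewrite {}keyL {}keyR in key.
  have err : \int[pi]_w (C%:E + (2 * N%:R)%:E * (u w.1 + u w.2)) <=
      (C * (s * m) + 4 * N%:R ^+ 2 * tau)%:E.
    rewrite ge0_integralD//; first last.
    - by apply: measurable_funeM; apply: emeasurable_funD; [exact: mfst|exact: msnd].
    - by move=> w _; rewrite mule_ge0 ?adde_ge0// lee_fin.
    rewrite piC// EFinD leeD2l// ge0_integralZl//; first last.
    - by move=> w _; rewrite adde_ge0.
    - by apply: emeasurable_funD; [exact: mfst|exact: msnd].
    rewrite ge0_integralD//; [|exact: mfst|exact: msnd].
    rewrite (_ : 4 * N%:R ^+ 2 * tau = 2 * N%:R * (N%:R * tau + N%:R * tau))%R; last by ring.
    rewrite [in leRHS]EFinM lee_wpmul2l ?lee_fin// EFinD leeD//.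
      exact: le_trans (pi1_le _ mu_ u0) intu.
    exact: le_trans (hpi2 _ mu_ u0) intu.
  have pf := pifin _ mphi phi0 efin.
  rewrite -(leeD2rE _ _ pf) addeAC (hid _ mphi phi0) -addeA [leRHS]addeAC -[leRHS]addeA leeD2l//.
  by apply: (le_trans key); rewrite leeD2l.
- move=> Pspread k.
  rewrite -!ge0_integral_bool//; [|exact: measurable_crowded|exact: measurable_crowded].
  have pf := pifin _ (mEi k) (cr0 k) (cfin k).
  rewrite -(leeD2rE _ _ pf) (hid _ (mEi k) (cr0 k)) leeD2l//.
  apply: hpile.
  - by apply: emeasurable_funD; [exact: (msw1 _ (mEi k))|exact: (msw2 _ (mEi k))].
  - by apply: emeasurable_funD; [exact: (mfst _ (mEi k))|exact: (msnd _ (mEi k))].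
  - by move=> w; rewrite adde_ge0.
  - by move=> w; rewrite adde_ge0.
  move=> w Ew Pw sepw; apply: leeD; rewrite lee_fin ler_nat.
    by case h : (crowded delta k (swap1 i w)) => //; have [_ ->] := crowded_swap1 sepw h.
  case h : (crowded delta k (swap2 i w)) => //.
  by have := Pspread _ k Pw; rewrite (crowded_swap2 sepw h).
- move=> Pspread s1'.
  rewrite -ge0_integral_bool//; last exact: measurable_crowded.
  apply/eqP; rewrite eq_le integral_ge0// andbT.
  rewrite -(leeD2rE _ _ (cfin i)) add0e.
  apply: (@le_trans _ _ (\int[gamma']_x ((crowded delta i x)%:R)%:E +
    \int[pi]_w (((crowded delta i w.1)%:R)%:E + ((crowded delta i w.2)%:R)%:E))).
    rewrite leeD2l// ge0_integralD//; [|exact: (mfst _ (mEi i))|exact: (msnd _ (mEi i))].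
    rewrite (hpi1 _ (mEi i) (cr0 i)) -[leLHS]adde0 leeD ?integral_ge0//.
    rewrite le_eqVlt; apply/orP; left; apply/eqP; apply: eq_integral => x _.
    by rewrite s1' mul1r -EFinM -natrM mulnb andbb.
  rewrite (hid _ (mEi i) (cr0 i)) -[leRHS]adde0 leeD2l//.
  rewrite -[leRHS](integral0 pi setT).
  apply: hpile => //.
  - by apply: emeasurable_funD; [exact: (msw1 _ (mEi i))|exact: (msw2 _ (mEi i))].
  - by move=> w; rewrite adde_ge0.
  move=> w Ew Pw sepw.
  case h1 : (crowded delta i (swap1 i w)).
    by have [] := crowded_swap1 sepw h1; rewrite eqxx.
  case h2 : (crowded delta i (swap2 i w)); last by rewrite adde0.
  by have := Pspread _ i Pw; rewrite (crowded_swap2 sepw h2).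
Qed.

End swap_step.

(** * Plans without crowding *)

Section uncrowding.
Context {R : realType} {X : polishMetricType R} {N : nat}.
Local Notation BX := (borelType X).
Local Notation BXN := (borelType {ptws 'I_N -> X}).
Local Open Scope ereal_scope.

Variables (F : X -> X -> R) (g : X -> R) (delta b K M A tau kappa : R).
Variable rho : probability BX R.
Hypotheses (F0 : forall x y, (0 <= F x y)%R) (g0 : forall x, (0 <= g x)%R).
Hypotheses (mg : measurable_fun [set: BX] g).
Hypothesis mF : forall i j, measurable_fun [set: BXN] (fun x => F (x i) (x j)).
Hypotheses (K0 : (0 <= K)%R) (M0 : (0 <= M)%R) (A0 : (0 <= A)%R).
Hypothesis delta_b : (delta <= b)%R.
Hypothesis F_far : forall x y, (b <= mdist x y -> F x y <= K + g x + g y)%R.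
Hypothesis F_close : forall x y, (mdist x y < delta -> M <= F x y)%R.
Hypotheses (kappa0 : (0 <= kappa)%R) (rho_ball : forall x : X, rho (ball x b) <= kappa%:E).
Hypothesis rho_tail : \int[rho]_x (excess g A x)%:E <= tau%:E.

Let z0 := (1 - 2 * N.-1%:R * kappa)%R.
Hypothesis z0_gt0 : (0 < z0)%R.

Local Notation plan gamma := (has_marginals gamma (fun=> rho)).
Local Notation energy gamma := (\int[gamma]_x (pair_energy F x)%:E).

Hypothesis energy_fin : forall gamma : probability BXN R, plan gamma ->
  energy gamma \is a fin_num.

Let mcrowded i : measurable [set x : BXN | crowded delta i x].
Proof. exact: measurable_crowded. Qed.

Let fine_le1 (gamma : probability BXN R) i :
  (0 <= fine (gamma [set x | crowded delta i x]) <= 1)%R.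
Proof.
rewrite fine_ge0//= -lee_fin fineK ?fin_num_measure//.
exact: probability_le1.
Qed.

Let z0_le1 : (z0 <= 1)%R.
Proof. by rewrite /z0 gerBl !mulr_ge0. Qed.

Let Cst := ((2 * K + 4 * A) * N%:R ^+ 2)%R.
Let Tst := (4 * N%:R ^+ 2 * tau)%R.

Let Cst0 : (0 <= Cst)%R. Proof. by rewrite mulr_ge0// addr_ge0 ?mulr_ge0. Qed.

(** Exchanging a proportion [z0 / 2] of the crowded configurations would lower the
    energy by [M] times their mass, up to bounded terms, and near optimality
    limits this gain. Crowded configurations are not excluded as partners of the
    exchange; the proportion is small enough for them to serve in both roles. *)
Lemma few_crowded (gamma : probability BXN R) (eta : R) (i : 'I_N) :
  plan gamma ->
  (forall gamma' : probability BXN R, plan gamma' -> energy gamma <= energy gamma' + eta%:E) ->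
  (M * (z0 / 2 * fine (gamma [set x | crowded delta i x])) <= eta + Cst + Tst)%R.
Proof.
move=> gr gopt; set m := fine _.
have /andP[m0 m1] := fine_le1 gamma i; rewrite -/m in m0 m1.
have mtrue : measurable [set x : BXN | true].
  by rewrite (_ : [set x | _] = setT)//; apply/seteqP; split.
have hZ (x : BXN) : z0%:E <= \int[gamma]_y ((true && separated b i (x, y))%:R : R)%:E.
  have h0 : gamma [set x | ~~ true] <= 0%:E.
    by rewrite (_ : [set x | _] = set0) ?measure0//; apply/seteqP; split.
  have := good_mass i gr mtrue rho_ball h0 x.
  by rewrite subr0.
have s0 : (0 < z0 / 2 <= 1)%R by apply/andP; split; [rewrite divr_gt0|move: z0_le1; lra].
have hs (z : BXN) : (z0 / 2 * (crowded delta i z)%:R + z0 / 2 * m / z0 * true%:R <= 1)%R.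
  have -> : (z0 / 2 * m / z0 * true%:R = m / 2 :> R)%R.
    by rewrite mulr1; field; rewrite gt_eqF.
  have : (z0 / 2 * (crowded delta i z)%:R <= z0 / 2)%R.
    by rewrite ler_piMr ?lern1 ?leq_b1//; case/andP: s0 => /ltW.
  by move: z0_le1 m1; lra.
have [gamma' [g'r g'e _ _]] := swap_step F0 g0 mg mF K0 M0 A0 delta_b F_far F_close
  gr rho_tail (energy_fin gr) mtrue s0 z0_gt0 hZ hs.
have := le_trans g'e (leeD2r _ (gopt _ g'r)).
rewrite -/m -/Cst -/Tst -(fineK (energy_fin g'r)) -!EFinD lee_fin.
have : (Cst * (z0 / 2 * m) <= Cst)%R.
  by rewrite ler_piMr// mulr_ile1//; case/andP: s0 => // /ltW.
move: (fine _) (Cst * _)%R (M * _)%R => e c q; lra.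
Qed.

(** When crowding is rare, the crowded configurations are exchanged entirely
    against uncrowded ones, for one index after the other; an exchange for one
    index does not recreate the crowding removed for the previous ones. *)
Lemma uncrowd (gamma : probability BXN R) (mbar : R) :
  plan gamma -> (0 < mbar)%R -> (2 * mbar <= z0)%R ->
  (forall i, N%:R * fine (gamma [set x | crowded delta i x]) <= mbar)%R ->
  exists gamma' : probability BXN R, [/\ plan gamma',
    energy gamma' <= energy gamma + (N%:R * (Cst * mbar + Tst))%:E &
    forall i, gamma' [set x | crowded delta i x] = 0].
Proof.
move=> gr mbar0 mbarz hm.
pose P (x : BXN) := [forall k, true ==> ~~ crowded delta k x].
have mP : measurable [set x | P x].
  apply: measurable_fin_forall => k _.
  rewrite (_ : [set t | _] = ~` [set x : BXN | crowded delta k x]); first exact: measurableC.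
  by apply/seteqP; split => x /= /negP.
have Pn x k : P x -> ~~ crowded delta k x by move=> /forallP/(_ k).
pose z1 := (1 - mbar - 2 * N.-1%:R * kappa)%R.
have z1E : (z1 = z0 - mbar)%R by rewrite /z1 /z0; ring.
have z1_gt0 : (0 < z1)%R by rewrite z1E; move: mbarz mbar0; lra.
have nP (gk : probability BXN R) :
    (forall i, fine (gk [set x | crowded delta i x]) <= fine (gamma [set x | crowded delta i x]))%R ->
    gk [set x | ~~ P x] <= mbar%:E.
  move=> hk.
  have mnP : measurable [set x | ~~ P x].
    rewrite (_ : [set x | _] = ~` [set x | P x]); first exact: measurableC.
    by apply/seteqP; split => x /= /negP.
  rewrite -ge0_integral_bool//.
  apply: (@le_trans _ _ (\int[gk]_x (\sum_(i < N) ((crowded delta i x)%:R : R)%:E))).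
    apply: ge0_le_integral => //.
    - exact: measurable_bool_EFin.
    - by apply: emeasurable_sum => i; exact: measurable_bool_EFin.
    move=> x _; rewrite sumEFin lee_fin /P negb_forall.
    case: existsP => [[i]|_]; last by apply: sumr_ge0.
    rewrite /= negbK => ci; rewrite (bigD1 i)//= ci lerDl; exact: sumr_ge0.
  rewrite ge0_integral_sum//; last by move=> i; exact: measurable_bool_EFin.
  have iE i : \int[gk]_x ((crowded delta i x)%:R : R)%:E =
      (fine (gk [set x | crowded delta i x]))%:E.
    by rewrite ge0_integral_bool// fineK// fin_num_measure.
  under eq_bigr do rewrite iE.
  rewrite sumEFin lee_fin.
  have [N0|N0] := eqVneq N 0%N.
    rewrite big1 ?ltW// => i _; by have := ltn_ord i; rewrite [X in (_ < X)%N]N0.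
  have Npos : (0 < N%:R :> R)%R by rewrite ltr0n lt0n.
  apply: (@le_trans _ _ (\sum_(i < N) mbar / N%:R)%R).
    apply: ler_sum => i _; rewrite ler_pdivlMr// mulrC (le_trans _ (hm i))//.
    by rewrite ler_wpM2l.
  by rewrite sumr_const card_ord -[((_ / _) *+ N)%R]mulr_natr divfK ?gt_eqF.
suff step k : (k <= N)%N -> exists gk : probability BXN R, [/\ plan gk,
    energy gk <= energy gamma + (k%:R * (Cst * mbar + Tst))%:E,
    (forall i, gk [set x | crowded delta i x] <= gamma [set x | crowded delta i x]) &
    (forall i : 'I_N, (i < k)%N -> gk [set x | crowded delta i x] = 0)].
  have [g' [g'r g'e _ g'0]] := step N (leqnn N).
  by exists g'; split => // i; exact: g'0.
elim: k => [|k ih] kN.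
  by exists gamma; split => //; rewrite mul0r adde0.
have [gk [gkr gke gkle gk0]] := ih (ltnW kN).
pose i := Ordinal kN.
have gkf j : (fine (gk [set x | crowded delta j x]) <= fine (gamma [set x | crowded delta j x]))%R.
  by rewrite fine_le ?fin_num_measure.
have hZ x : z1%:E <= \int[gk]_y ((P y && separated b i (x, y))%:R : R)%:E.
  exact: (good_mass i gkr mP rho_ball (nP _ gkf)).
set m := fine (gk [set x | crowded delta i x]).
have /andP[m0 m1] := fine_le1 gk i; rewrite -/m in m0 m1.
have mm : (m <= mbar)%R.
  apply: le_trans (gkf i) _; apply: le_trans (hm i).
  rewrite ler_peMl//; first by case/andP: (fine_le1 gamma i).
  by rewrite ler1n (leq_trans _ kN).
have hs z : (1 * (crowded delta i z)%:R + 1 * m / z1 * (P z)%:R <= 1)%R.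
  rewrite !mul1r; case Pz : (P z); last by rewrite mulr0 addr0 lern1 leq_b1.
  rewrite (negbTE (Pn z i Pz)) add0r mulr1 ler_pdivrMr// mul1r.
  by rewrite z1E; move: mm mbarz; lra.
have s1 : (0 < 1 :> R)%R && (1 <= 1 :> R)%R by rewrite ltr01 lexx.
have [gamma' [g'r g'e g'le g'0]] := swap_step F0 g0 mg mF K0 M0 A0 delta_b F_far F_close
  gkr rho_tail (energy_fin gkr) mP s1 z1_gt0 hZ hs.
exists gamma'; split => //.
- apply: (@le_trans _ _ (energy gamma' + (M * (1 * m))%:E)).
    by rewrite leeDl// lee_fin mul1r mulr_ge0.
  apply: (le_trans g'e); rewrite -/m -/Cst -/Tst mul1r.
  apply: (le_trans (leeD2r _ gke)).
  rewrite -addeA -EFinD leeD2l// lee_fin -natr1 mulrDl mul1r lerD2l lerD2r.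
  by rewrite ler_wpM2l.
- by move=> j; apply: le_trans (gkle j); apply: g'le => x l; exact: Pn.
- move=> j; rewrite ltnS leq_eqVlt => /predU1P[jk|jk].
    have -> : j = i by exact: val_inj.
    by apply: g'0 => // x l; exact: Pn.
  apply/eqP; rewrite eq_le measure_ge0 andbT -(gk0 j jk).
  by apply: g'le => x l; exact: Pn.
Qed.

(** A nearly optimal plan has few crowded configurations, since those are
    expensive, and few configurations can be repaired cheaply. The new plan
    is built from a nearly optimal one; [gamma] only bounds the infimum. *)
Lemma uncrowded_plan (gamma : probability BXN R) (eta mbar : R) :
  plan gamma -> (0 < eta)%R -> (0 < mbar)%R -> (2 * mbar <= z0)%R ->
  (N%:R * (eta + Cst + Tst) <= M * (z0 / 2) * mbar)%R -> (0 < M)%R ->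
  exists gamma' : probability BXN R, [/\ plan gamma',
    energy gamma' <= energy gamma + (eta + N%:R * (Cst * mbar + Tst))%:E &
    forall i, gamma' [set x | crowded delta i x] = 0].
Proof.
move=> gr eta0 mbar0 mbarz hM M_gt0.
pose I := ereal_inf [set energy g' | g' in [set g' : probability BXN R | plan g']].
have I0 : 0 <= I.
  apply: le_ereal_inf_tmp => _ [g' _ <-]; apply: integral_ge0 => x _.
  by rewrite lee_fin pair_energy_ge0.
have Ile (g' : probability BXN R) : plan g' -> I <= energy g' by move=> g'r; apply: ereal_inf_lbound; exists g'.
have Ifin : I \is a fin_num.
  rewrite ge0_fin_numE// (le_lt_trans (Ile _ gr))//.
  rewrite -ge0_fin_numE ?energy_fin//; apply: integral_ge0 => x _.
  by rewrite lee_fin pair_energy_ge0.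
have [_ [g1 g1r <-] g1I] := lb_ereal_inf_adherent eta0 Ifin.
have g1opt (g' : probability BXN R) : plan g' -> energy g1 <= energy g' + eta%:E.
  by move=> g'r; apply: (le_trans (ltW g1I)); rewrite leeD2r// Ile.
have hm i : (N%:R * fine (g1 [set x | crowded delta i x]) <= mbar)%R.
  have Mz : (0 < M * (z0 / 2))%R by rewrite mulr_gt0 ?divr_gt0.
  rewrite -(ler_pM2l Mz) (le_trans _ hM)// mulrCA ler_wpM2l//.
  have := few_crowded i g1r g1opt.
  by rewrite mulrA.
have [g2 [g2r g2e g20]] := uncrowd g1r mbar0 mbarz hm.
exists g2; split => //; apply: (le_trans g2e).
by rewrite [in leRHS]EFinD addeA leeD2r// g1opt.
Qed.

End uncrowding.

(** * The truncated interaction *)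

Section uniform_continuity.
Context {R : realType}.

Lemma continuous_uniform_on_segment (h : R -> R) (a c w : R) :
  continuous h -> 0 < w ->
  exists2 e, 0 < e & forall s, a <= s <= c -> forall t, `|s - t| < e -> `|h s - h t| <= w.
Proof.
move=> ch w0.
have /compact_near_coveringP K : compact [set` `[a, c]] by exact: segment_compact.
pose P (e s : R) := forall t, `|s - t| < e -> `|h s - h t| <= w.
have : \forall e \near 0^'+, [set` `[a, c]] `<=` P e.
  apply: K => x _.
  have /cvgrPdist_lt/(_ (w / 2)) := ch x.
  rewrite divr_gt0// => /(_ isT)/nbhs_ballP[r /= r0 hr].
  have r20 : 0 < r / 2 by rewrite divr_gt0.
  exists (ball x (r / 2), [set e : R | e < r / 2]) => /=.
    split; first exact: nbhsx_ballx.
    exact: nbhs_right_lt.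
  move=> [s e] /= [xs er] t st.
  have xs' : `|x - s| < r / 2 by [].
  have hs : `|h x - h s| < w / 2.
    by apply: hr; rewrite /ball/= (lt_trans xs')// ltr_pdivrMr// ltr_pMr// ltr1n.
  have ht : `|h x - h t| < w / 2.
    apply: hr; rewrite /ball/=.
    have := ler_normD (x - s) (s - t); rewrite addrA subrK.
    by move: xs' st er; lra.
  have := ler_normD (h s - h x) (h x - h t); rewrite addrA subrK (distrC (h s) (h x)).
  by move: hs ht; lra.
move=> [r /= r0 hr].
have r20 : 0 < r / 2 by rewrite divr_gt0.
exists (r / 2) => // s sac; apply: (hr (r / 2)) => //=.
by rewrite sub0r normrN gtr0_norm// ltr_pdivrMr// ltr_pMr// ltr1n.
Qed.

Lemma uniform_continuous_lipschitz_tails (h : R -> R) (a c L w : R) :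
  continuous h -> (forall s t, s <= a -> t <= a -> h s = h t) ->
  (forall s t, c <= s -> c <= t -> `|h s - h t| <= L * `|s - t|) -> 0 < w ->
  exists2 e, 0 < e & forall s t, `|s - t| < e -> `|h s - h t| <= w.
Proof.
move=> ch hconst hlip w0.
have [e e0 he] := continuous_uniform_on_segment (a - 1) (c + 1) ch w0.
pose L' := Num.max 1 L.
have L'0 : 0 < L' by rewrite lt_max ltr01.
exists (Num.min e (Num.min 1 (w / L'))).
  by rewrite !lt_min e0 ltr01 divr_gt0.
move=> s t; rewrite !lt_min => /andP[ste /andP[st1 stw]].
have [sa|sa] := ltP s (a - 1).
  rewrite (hconst s t) ?subrr ?normr0 ?ltW//; first by lra.
  by move: st1; rewrite ltr_norml => /andP[? ?]; lra.
have [sc|sc] := leP s (c + 1); first by apply: he => //; rewrite sa sc.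
have ct : c <= t by move: st1; rewrite ltr_norml => /andP[? ?]; lra.
have cs : c <= s by lra.
rewrite (le_trans (hlip _ _ cs ct))//.
rewrite (@le_trans _ _ (L' * `|s - t|))//.
  by rewrite ler_wpM2r// le_max lexx orbT.
by rewrite mulrC -ler_pdivlMr// ltW.
Qed.

End uniform_continuity.

Section repulsive_function.
Context {R : realType} (f : R -> \bar R).
Hypothesis f_fin : forall t, 0 < t -> f t \is a fin_num.
Hypothesis f_cont : {within [set t : R | 0 < t], continuous f}.
Hypothesis f_decr : forall s t : R, 0 < s -> s <= t -> (f t <= f s)%E.
Hypothesis f_lim0 : f t @[t --> 0^'+] --> +oo%E.

Definition clamp (delta t : R) : R := fine (f (Num.max delta t)).

Lemma fine_f t : 0 < t -> (fine (f t))%:E = f t.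
Proof. by move=> t0; rewrite fineK// f_fin. Qed.

Lemma fine_decr s t : 0 < s -> s <= t -> fine (f t) <= fine (f s).
Proof.
by move=> s0 st; rewrite -lee_fin !fine_f//; [exact: f_decr|exact: lt_le_trans st].
Qed.

Lemma large_near0 (M : R) : exists2 d, 0 < d & forall t, 0 < t -> t <= d -> M <= fine (f t).
Proof.
have /cvgeyPge/(_ M)[r /= r0 hr] := f_lim0.
exists (r / 2); first by rewrite divr_gt0.
move=> t t0 td; rewrite -lee_fin fine_f//; apply: hr => //=.
by rewrite sub0r normrN gtr0_norm// (le_lt_trans td)// ltr_pdivrMr// ltr_pMr// ltr1n.
Qed.

Lemma continuous_clamp delta : 0 < delta -> continuous (clamp delta).
Proof.
move=> d0 t.
have t0 : 0 < Num.max delta t by rewrite lt_max d0.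
have cf : f s @[s --> Num.max delta t] --> f (Num.max delta t).
  have oP : open [set t : R | 0 < t] by exact: open_gt.
  by move: f_cont; rewrite (continuous_open_subspace f oP); apply; rewrite inE.
have cfine : fine (f s) @[s --> Num.max delta t] --> fine (f (Num.max delta t)).
  by apply: fine_cvg; rewrite fineK ?f_fin.
have cmax : {for t, continuous (fun s => Num.max delta s)}.
  by apply: (@continuous_max R R (fun=> delta)); [exact: cvg_cst|exact: cvg_id].
exact: (continuous_comp cmax cfine).
Qed.

Lemma clamp_decr delta s t : 0 < delta -> s <= t -> clamp delta t <= clamp delta s.
Proof.
move=> d0 st; apply: fine_decr; first by rewrite lt_max d0.
by rewrite ge_max le_max lexx/= le_max st orbT.
Qed.

Lemma uniform_continuous_clamp delta alpha w : 0 < delta -> 0 < w ->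
  [lipschitz fine (f t) | t in [set t : R | alpha <= t]] ->
  exists2 e, 0 < e & forall s t, `|s - t| < e -> `|clamp delta s - clamp delta t| <= w.
Proof.
move=> d0 w0 [L0 [_ hL]].
have {}hL := hL (L0 + 1); rewrite ltrDl ltr01 in hL.
apply: (@uniform_continuous_lipschitz_tails _ (clamp delta) delta (Num.max delta alpha) (L0 + 1)) => //.
- exact: continuous_clamp.
- by move=> s t sd td; rewrite /clamp !max_l.
- move=> s t; rewrite !ge_max => /andP[ds als] /andP[dt alt].
  by rewrite /clamp !max_r//; exact: (hL isT (s, t)).
Qed.

End repulsive_function.

(** * The renormalized cost *)

Section integral_split.
Local Open Scope ereal_scope.
Context {R : realType} d (T : measurableType d) (mu : {measure set T -> \bar R}).

(** The bound [- G <= c] makes the integral of the negative part of [c] finite,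
    which allows cancellation even when that of its positive part is infinite. *)
Lemma ge0_integral_addr (c : T -> \bar R) (G : T -> R) :
  measurable_fun setT c -> measurable_fun setT G -> (forall x, 0 <= G x)%R ->
  (forall x, 0 <= c x + (G x)%:E) -> \int[mu]_x (G x)%:E \is a fin_num ->
  \int[mu]_x (c x + (G x)%:E) = \int[mu]_x c x + \int[mu]_x (G x)%:E.
Proof.
move=> mc mG G0 cG0 Gfin.
have mGE : measurable_fun setT (fun x => (G x)%:E) by exact/measurable_EFinP.
have mcp := measurable_funepos mc; have mcn := measurable_funeneg mc.
have cnG x : c^\- x <= (G x)%:E.
  rewrite funenegE ge_max lee_fin G0 andbT.
  have := cG0 x; case: (c x) => [r| |]//=; last by rewrite leNye.
  by rewrite -EFinD !lee_fin; lra.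
have ncfin : \int[mu]_x c^\- x \is a fin_num.
  rewrite ge0_fin_numE; last by apply: integral_ge0 => x _; exact: funeneg_ge0.
  rewrite (@le_lt_trans _ _ (\int[mu]_x (G x)%:E))//.
    by apply: ge0_le_integral => // x _; exact: funeneg_ge0.
  by rewrite -ge0_fin_numE//; apply: integral_ge0 => x _; rewrite lee_fin.
have E : \int[mu]_x (c x + (G x)%:E) + \int[mu]_x c^\- x =
    \int[mu]_x c^\+ x + \int[mu]_x (G x)%:E.
  rewrite -ge0_integralD//; [|exact: emeasurable_funD].
  rewrite -ge0_integralD//; last by move=> x _; rewrite lee_fin.
  apply: eq_integral => x _; rewrite funeposE funenegE.
  have := cG0 x; case: (c x) => [r _| _|].
  - rewrite -EFinN -!EFin_max -!EFinD; congr EFin.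
    by have [r0|r0] := leP 0%R r; [rewrite max_r ?oppr_le0//|rewrite max_l ?oppr_ge0 ?(ltW r0)//]; lra.
  - by rewrite maxNye maxye adde0.
  - by rewrite addNye.
by rewrite -[LHS](addeK _ ncfin) E addeAC -integralE.
Qed.

End integral_split.

Section renormalized_cost.
Context {R : realType} {X : polishMetricType R} (f : R -> \bar R) (o : X) (d0 : R).
Local Notation BX := (borelType X).
Hypotheses (f0 : f 0 = +oo%E) (f_fin : forall t, 0 < t -> f t \is a fin_num).
Hypothesis f_cont : {within [set t : R | 0 < t], continuous f}.
Hypothesis f_decr : forall s t : R, 0 < s -> s <= t -> (f t <= f s)%E.
Hypothesis f_lim0 : f t @[t --> 0^'+] --> +oo%E.
Hypotheses (d0_gt0 : 0 < d0) (fd0 : forall t, 0 < t -> t <= d0 -> 0 <= fine (f t)).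

(** The negative part of [f (2 * mdist x o)], with [f] truncated below [d0], where
    it is nonnegative, in order to be continuous at [o]. *)
Definition gauge (x : X) : R := Num.max 0 (- clamp f d0 (2 * mdist x o)).

Definition renormalized (delta : R) (x y : X) : R :=
  clamp f delta (mdist x y) + gauge x + gauge y.

Lemma gauge_ge0 x : 0 <= gauge x.
Proof. by rewrite le_max lexx. Qed.

Lemma continuous_gauge : continuous gauge.
Proof.
move=> x; apply: (@continuous_max R X (fun=> 0)); first exact: cvg_cst.
have c2 : {for x, continuous (fun x : X => 2 * mdist x o)}.
  by apply: cvgMl_tmp; exact: continuous_mdistl.
have c3 : {for x, continuous (fun x : X => clamp f d0 (2 * mdist x o))}.
  exact: (continuous_comp c2 (@continuous_clamp _ _ f_fin f_cont _ d0_gt0 _)).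
exact: (cvgN c3).
Qed.

Lemma gauge_dist x y : `|gauge x - gauge y| <=
  `|clamp f d0 (2 * mdist x o) - clamp f d0 (2 * mdist y o)|.
Proof.
rewrite /gauge; set u := clamp _ _ _; set v := clamp _ _ _.
have := ler_norm (u - v); have := ler_norm (v - u); rewrite distrC => h1 h2.
rewrite ler_norml; apply/andP.
by case: (leP 0 (- u)) => ?; case: (leP 0 (- v)) => ?;
  split; move: (normr_ge0 (u - v)) h1 h2; lra.
Qed.

(** One of [x] and [y] is at distance at least [mdist x y / 2] of [o], and its
    gauge compensates [f (mdist x y)] because [f] is decreasing. *)
Lemma renormalized_ge0 delta x y : 0 < delta -> delta <= d0 -> 0 <= renormalized delta x y.
Proof.
move=> delta0 dd0; rewrite /renormalized /clamp; set t := Num.max _ _.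
have t0 : 0 < t by rewrite lt_max delta0.
have [td|dt] := leP t d0; first by rewrite !addr_ge0 ?gauge_ge0 ?fd0.
have tE : t = mdist x y.
  by rewrite /t max_r// leNgt; apply/negP => h; move: dt; rewrite /t max_l ?ltNge ?dd0// ltW.
wlog xy : x y t t0 dt tE / mdist y o <= mdist x o.
  move=> wl; have [xy|/ltW xy] := leP (mdist y o) (mdist x o); first exact: (wl x y t).
  by rewrite addrAC; apply: (wl y x t) => //; rewrite mdistC.
have tle : t <= 2 * mdist x o.
  by rewrite tE; have := mdist_triangle x o y; rewrite (mdistC o); move: xy; lra.
have gx : - fine (f t) <= gauge x.
  rewrite /gauge le_max /clamp max_r ?(ltW (lt_le_trans dt tle))//.
  by rewrite lerN2 (fine_decr f_fin f_decr t0 tle) orbT.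
by have := gauge_ge0 y; move: gx; lra.
Qed.

Lemma renormalized_far delta b x y : 0 < delta -> 0 < b -> b <= mdist x y ->
  renormalized delta x y <= Num.max 0 (fine (f b)) + gauge x + gauge y.
Proof.
move=> delta0 b0 bxy; rewrite /renormalized !lerD2r le_max /clamp.
by rewrite (fine_decr f_fin f_decr b0) ?orbT// le_max bxy orbT.
Qed.

Lemma renormalized_close delta x y : 0 < delta -> delta <= d0 ->
  mdist x y < delta -> fine (f delta) <= renormalized delta x y.
Proof.
move=> delta0 dd0 xyd; rewrite /renormalized /clamp max_l ?(ltW xyd)//.
by rewrite -addrA lerDl addr_ge0// gauge_ge0.
Qed.

Lemma renormalized_le delta x y : 0 < delta ->
  renormalized delta x y <= fine (f delta) + gauge x + gauge y.
Proof.
move=> delta0; rewrite !lerD2r.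
by apply: (fine_decr f_fin f_decr) => //; rewrite le_max lexx.
Qed.

Lemma renormalized_le_cost delta x y : 0 < delta ->
  ((renormalized delta x y)%:E <= f (mdist x y) + (gauge x + gauge y)%:E)%E.
Proof.
move=> delta0; rewrite /renormalized -addrA EFinD leeD2r// /clamp.
have : 0 <= mdist x y by exact: mdist_ge0.
rewrite le_eqVlt => /predU1P[<-|xy0]; first by rewrite f0 leey.
rewrite -(fine_f f_fin xy0) lee_fin; apply: (fine_decr f_fin f_decr) => //.
by rewrite le_max lexx orbT.
Qed.

Lemma renormalized_eq_cost delta x y : 0 < delta -> delta <= mdist x y ->
  ((renormalized delta x y)%:E = f (mdist x y) + (gauge x + gauge y)%:E)%E.
Proof.
move=> delta0 dxy; rewrite /renormalized -addrA EFinD /clamp max_r//.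
by rewrite fine_f//; exact: lt_le_trans dxy.
Qed.

Lemma measurable_gauge : measurable_fun [set: BX] gauge.
Proof. exact: continuous_measurable_borel continuous_gauge. Qed.

Lemma measurable_clamp delta : 0 < delta -> measurable_fun [set: R] (clamp f delta).
Proof.
by move=> delta0; apply: continuous_measurable_fun; exact: (continuous_clamp f_fin f_cont).
Qed.

Section measurable.
Context d (T : measurableType d) (u v : T -> BX).
Hypotheses (mu : measurable_fun [set: T] u) (mv : measurable_fun [set: T] v).

Lemma measurable_renormalized delta : 0 < delta ->
  measurable_fun [set: T] (fun t => renormalized delta (u t) (v t)).
Proof.
move=> delta0; apply: measurable_funD; last exact: (measurableT_comp measurable_gauge).
apply: measurable_funD; last exact: (measurableT_comp measurable_gauge).
exact: (measurableT_comp (measurable_clamp delta0) (measurable_mdist mu mv)).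
Qed.

(** The interactions clamped at [k.+1%:R^-1] converge to [f], also at [0], where
    they tend to [+oo]. *)
Lemma measurable_f_mdist :
  measurable_fun [set: T] (fun t => f (mdist (u t : X) (v t))).
Proof.
apply: (emeasurable_fun_cvg (fun k t => (clamp f (k.+1%:R^-1) (mdist (u t : X) (v t)))%:E)).
  move=> k; apply/measurable_EFinP.
  have k0 : 0 < k.+1%:R^-1 :> R by rewrite invr_gt0.
  exact: (measurableT_comp (measurable_clamp k0) (measurable_mdist mu mv)).
move=> t _.
have : 0 <= mdist (u t : X) (v t) by exact: mdist_ge0.
rewrite le_eqVlt => /predU1P[<-|t0].
  rewrite f0; apply/cvgeyPge => M.
  have [e e0 he] := large_near0 f_fin f_lim0 M.
  have := near_infty_natSinv_lt (PosNum e0); apply: filterS => k /= ke.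
  have k0 : 0 < k.+1%:R^-1 :> R by rewrite invr_gt0.
  rewrite lee_fin /clamp max_l; last exact: ltW.
  by apply: he => //; exact: ltW.
apply: cvg_near_cst.
have := near_infty_natSinv_lt (PosNum t0); apply: filterS => k /= ke.
by rewrite /clamp max_r; [exact: fine_f|exact: ltW].
Qed.

End measurable.

Section pairs.
Context {N : nat}.
Local Notation BXN := (borelType {ptws 'I_N -> X}).

Definition pair_gauge (x : BXN) : R := pair_sum (fun i j : 'I_N => gauge (x i) + gauge (x j)).

Lemma pair_gauge_ge0 x : 0 <= pair_gauge x.
Proof. by apply: pair_sum_ge0 => i j _; rewrite addr_ge0// gauge_ge0. Qed.

Lemma pair_cost_gaugeE (x : BXN) : (pair_cost f x + (pair_gauge x)%:E =
  \sum_(i < N) \sum_(j < N | (i < j)%N)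
    (f (mdist (x i : X) (x j)) + (gauge (x i) + gauge (x j))%:E))%E.
Proof.
rewrite /pair_cost /pair_gauge /pair_sum -sumEFin -big_split/=.
by apply: eq_bigr => i _; rewrite -sumEFin -big_split.
Qed.

Lemma pair_energyE (F : X -> X -> R) (x : BXN) : ((pair_energy F x)%:E =
  \sum_(i < N) \sum_(j < N | (i < j)%N) (F (x i) (x j))%:E)%E.
Proof.
by rewrite /pair_energy /pair_sum -sumEFin; apply: eq_bigr => i _; rewrite -sumEFin.
Qed.

Lemma pair_energy_le_cost delta (x : BXN) : 0 < delta ->
  ((pair_energy (renormalized delta) x)%:E <= pair_cost f x + (pair_gauge x)%:E)%E.
Proof.
move=> delta0; rewrite pair_cost_gaugeE pair_energyE.
by apply: lee_sum => i _; apply: lee_sum => j _; exact: renormalized_le_cost.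
Qed.

Lemma pair_energy_eq_cost delta (x : BXN) : 0 < delta ->
  (forall i, ~~ crowded delta i x) ->
  ((pair_energy (renormalized delta) x)%:E = pair_cost f x + (pair_gauge x)%:E)%E.
Proof.
move=> delta0 h; rewrite pair_cost_gaugeE pair_energyE.
apply: eq_bigr => i _; apply: eq_bigr => j ij; apply: renormalized_eq_cost => //.
rewrite leNgt; apply/negP => xij; move/negP: (h i); apply; apply/existsP; exists j.
by rewrite xij andbT; apply: contraTneq ij => ->; rewrite ltnn.
Qed.

Lemma pair_cost_gauge_ge0 (x : BXN) : (0 <= pair_cost f x + (pair_gauge x)%:E)%E.
Proof.
apply: le_trans (pair_energy_le_cost x d0_gt0); rewrite lee_fin.
by apply: pair_energy_ge0 => y z; exact: renormalized_ge0.
Qed.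

Lemma measurable_pair_cost : measurable_fun [set: BXN] (fun x : BXN => pair_cost f x).
Proof.
have -> : (fun x : BXN => pair_cost f x) = fun x : BXN =>
    (\sum_(i < N) \sum_(j < N) if (i < j)%N then f (mdist (x i : X) (x j)) else 0)%E.
  by apply/funext => x; apply: eq_bigr => i _; rewrite big_mkcond.
apply: emeasurable_sum => i; apply: emeasurable_sum => j; case: (i < j)%N => //.
by apply: measurable_f_mdist; exact: measurable_coord.
Qed.

Lemma measurable_pair_gauge : measurable_fun [set: BXN] pair_gauge.
Proof.
have -> : pair_gauge = fun x : BXN =>
    \sum_(i < N) \sum_(j < N) if (i < j)%N then gauge (x i) + gauge (x j) else 0.
  by apply/funext => x; apply: eq_bigr => i _; rewrite big_mkcond.
apply: measurable_sum => i; apply: measurable_sum => j; case: (i < j)%N => //.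
by apply: measurable_funD; apply: (measurableT_comp measurable_gauge);
  exact: measurable_coord.
Qed.

End pairs.
End renormalized_cost.

(** * Tightness and weak convergence *)

Section tails.
Context {R : realType} {X : polishMetricType R}.
Local Notation BX := (borelType X).
Local Open Scope ereal_scope.

Lemma continuous_excess (g : X -> R) A : continuous g -> continuous (excess g A : X -> R).
Proof.
move=> cg x; apply: (@continuous_max R X (fun=> 0%R)); first exact: cvg_cst.
by apply: cvgB; [exact: cg|exact: cvg_cst].
Qed.

Lemma ge0_integral_fin_num_excess (rho : probability BX R) (g : BX -> R) A tau :
  measurable_fun setT g -> (forall x, 0 <= g x)%R -> (0 <= A)%R ->
  \int[rho]_x (excess g A x)%:E <= tau%:E -> \int[rho]_x (g x)%:E \is a fin_num.
Proof.
move=> mg g0 A0 gA.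
rewrite ge0_fin_numE; last by apply: integral_ge0 => x _; rewrite lee_fin.
apply: (@le_lt_trans _ _ (\int[rho]_x (A%:E + (excess g A x)%:E))).
  apply: ge0_le_integral => //.
  - by move=> x _; rewrite lee_fin.
  - exact/measurable_EFinP.
  - by apply: emeasurable_funD => //; exact: measurable_excess.
  - by move=> x _; rewrite -EFinD lee_fin le_excess.
rewrite ge0_integralD//; last 2 first.
- by move=> x _; rewrite lee_fin excess_ge0.
- exact: measurable_excess.
rewrite integral_cst//= probability_setT mule1.
by rewrite (le_lt_trans (leeD2l _ gA))// -EFinD ltry.
Qed.

(** Semicontinuity of the integral of a function that may be unbounded, hence is
    not covered by weak convergence: it is tested on the truncations. *)
Lemma weak_cvg_integral_le (rho : nat -> probability BX R) (rhoo : probability BX R)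
    (h : X -> R) (tau : R) :
  weak_cvg rho rhoo -> continuous h -> (forall x, 0 <= h x)%R ->
  (forall n, \int[rho n]_x (h x)%:E <= tau%:E) -> \int[rhoo]_x (h x)%:E <= tau%:E.
Proof.
move=> rr ch h0 htau.
have cm m : continuous (fun x => Num.min m%:R (h x))%R.
  by move=> x; apply: (@continuous_min R X (fun=> m%:R)%R); [exact: cvg_cst|exact: ch].
have m0 m x : (0 <= Num.min m%:R (h x) <= m%:R)%R.
  by rewrite le_min ler0n h0/= ge_min lexx.
have mE m : measurable_fun [set: BX] (fun x => (Num.min m%:R (h x))%:E).
  apply/measurable_EFinP; exact: continuous_measurable_borel (cm m).
have hm m : \int[rhoo]_x (Num.min m%:R (h x))%:E <= tau%:E.
  have /cvg_lim <- // := weak_cvg_bounded rr (cm m) (m0 m).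
  apply: lime_le; first by apply/cvg_ex; eexists; exact: (weak_cvg_bounded rr (cm m) (m0 m)).
  apply: nearW => n; apply: le_trans (htau n); apply: ge0_le_integral => //.
  - by move=> x _; rewrite lee_fin; case/andP: (m0 m x).
  - by apply/measurable_EFinP; exact: continuous_measurable_borel.
  - by move=> x _; rewrite lee_fin ge_min lexx orbT.
have -> : \int[rhoo]_x (h x)%:E =
    limn (fun m => \int[rhoo]_x (Num.min m%:R (h x))%:E).
  rewrite -monotone_convergence//.
  - apply: eq_integral => x _; apply/esym/cvg_lim => //.
    apply: cvg_near_cst; near=> m.
    rewrite min_r//; near: m.
    exact: nbhs_infty_ger.
  - by move=> m x _; rewrite lee_fin; case/andP: (m0 m x).
  - move=> x _ m n mn; rewrite lee_fin le_min ge_min ler_nat mn/=.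
    by rewrite ge_min lexx orbT.
apply: lime_le; last exact: nearW.
apply: ereal_nondecreasing_is_cvgn => m n mn; apply: ge0_le_integral => //.
- by move=> x _; rewrite lee_fin; case/andP: (m0 m x).
- move=> x _; rewrite lee_fin le_min ge_min ler_nat mn/=.
  by rewrite ge_min lexx orbT.
Unshelve. all: by end_near. Qed.

(** Uniform integrability makes weak convergence pass to an unbounded function. *)
Lemma tight_integral_cvg (rho : nat -> probability BX R) (rhoo : probability BX R)
    (g : X -> R) :
  weak_cvg rho rhoo -> continuous g -> (forall x, 0 <= g x)%R ->
  (forall tau : R, (0 < tau)%R -> exists2 A : R, (0 <= A)%R &
    forall n, \int[rho n]_x (excess g A x)%:E <= tau%:E) ->
  forall eta, (0 < eta)%R -> \forall n \near \oo,
    (`| fine (\int[rho n]_x (g x)%:E) - fine (\int[rhoo]_x (g x)%:E) | <= eta)%R.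
Proof.
move=> rr cg g0 gtail eta eta0.
have t0 : (0 < eta / 2)%R by rewrite divr_gt0.
have [A A0 hA] := gtail _ t0.
have hAoo : \int[rhoo]_x (excess g A x)%:E <= (eta / 2)%:E.
  apply: weak_cvg_integral_le rr _ _ hA; first exact: continuous_excess.
  by move=> x; exact: excess_ge0.
have mg : measurable_fun [set: BX] g by exact: continuous_measurable_borel.
pose h x := Num.min A (g x).
have ch : continuous h.
  by move=> x; apply: (@continuous_min R X (fun=> A)); [exact: cvg_cst|exact: cg].
have h0 x : (0 <= h x <= A)%R by rewrite le_min A0 g0/= ge_min lexx.
have mh : measurable_fun [set: BX] h by exact: continuous_measurable_borel.
have split_g (r : probability BX R) : \int[r]_x (excess g A x)%:E <= (eta / 2)%:E ->
    exists2 e, (0 <= e <= eta / 2)%R &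
      fine (\int[r]_x (g x)%:E) = (fine (\int[r]_x (h x)%:E) + e)%R.
  move=> hr.
  have efin : \int[r]_x (excess g A x)%:E \is a fin_num.
    rewrite ge0_fin_numE; last by apply: integral_ge0 => x _; rewrite lee_fin excess_ge0.
    by rewrite (le_lt_trans hr)// ltry.
  exists (fine (\int[r]_x (excess g A x)%:E)).
    rewrite -lee_fin -(@lee_fin _ _ (eta / 2)) fineK// hr andbT.
    by apply: integral_ge0 => x _; rewrite lee_fin excess_ge0.
  have hfin : \int[r]_x (h x)%:E \is a fin_num.
    apply: (@ge0_integral_fin_num_excess r h A 0%R) => //.
      by move=> x; case/andP: (h0 x).
    rewrite integral0_eq// => x _; rewrite /excess max_l// subr_le0.
    by case/andP: (h0 x).
  rewrite -fineD// -ge0_integralD//; first last.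
  - exact: measurable_excess.
  - by move=> x _; rewrite lee_fin excess_ge0.
  - exact/measurable_EFinP.
  - by move=> x _; rewrite lee_fin; case/andP: (h0 x).
  congr fine; apply: eq_integral => x _; rewrite -EFinD; congr EFin.
  rewrite /h /excess; have [Ag|gA] := leP A (g x).
    by rewrite max_r ?subr_ge0//; lra.
  by rewrite max_l ?addr0// subr_le0 ltW.
have hfin : \int[rhoo]_x (h x)%:E \is a fin_num.
  apply: (@ge0_integral_fin_num_excess rhoo h A 0%R) => //.
    by move=> x; case/andP: (h0 x).
  rewrite integral0_eq// => x _; rewrite /excess max_l// subr_le0.
  by case/andP: (h0 x).
have hc := weak_cvg_bounded rr ch h0.
rewrite -(fineK hfin) in hc.
have /fine_cvg/cvgrPdist_le/(_ _ t0) := hc.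
apply: filterS => n /= hn.
have [e1 /andP[? ?] ->] := split_g _ (hA n).
have [e2 /andP[? ?] ->] := split_g _ hAoo.
move: hn; rewrite distrC !ler_norml => /andP[? ?]; apply/andP; split; lra.
Qed.

Lemma transfer_ball (mu nu : probability BX R) p (eps b beta : R) (x : X) :
  transfer_density mu nu eps p -> (b + eps <= beta)%R ->
  mu (ball x b) <= nu (ball x beta) + eps%:E.
Proof.
move=> [mp p0 px py pfar] bb; have mball := measurable_mball x.
have mpE : measurable_fun setT (fun w => (p w)%:E) by exact/measurable_EFinP.
have p0E w : 0 <= (p w)%:E by rewrite lee_fin.
have mi1 : measurable_fun setT (fun w : BX * BX => (p w)%:E * (\1_(ball x b) w.1)%:E).
  apply: emeasurable_funM => //; apply/measurable_EFinP.
  exact: (measurableT_comp (@measurable_indic _ _ R setT _ (mball b)) measurable_fst).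
have mi2 : measurable_fun setT (fun w : BX * BX => (p w)%:E * (\1_(ball x beta) w.2)%:E).
  apply: emeasurable_funM => //; apply/measurable_EFinP.
  exact: (measurableT_comp (@measurable_indic _ _ R setT _ (mball beta)) measurable_snd).
have i10 w : 0 <= (p w)%:E * (\1_(ball x b) w.1)%:E by rewrite mule_ge0// lee_fin.
have i20 w : 0 <= (p w)%:E * (\1_(ball x beta) w.2)%:E by rewrite mule_ge0// lee_fin.
have -> : mu (ball x b) = \int[mu \x nu]_w ((p w)%:E * (\1_(ball x b) w.1)%:E).
  rewrite fubini_tonelli1// /fubini_F/=.
  under eq_integral => a _.
    rewrite ge0_integralZr//; last first.
      exact: (measurable_fun_pair2 _ mpE).
    rewrite px mul1e; over.
  by rewrite integral_indic// setIT.
have -> : nu (ball x beta) = \int[mu \x nu]_w ((p w)%:E * (\1_(ball x beta) w.2)%:E).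
  rewrite fubini_tonelli2// /fubini_G/=.
  under eq_integral => a _.
    rewrite ge0_integralZr//; last first.
      exact: (measurable_fun_pair1 _ mpE).
    rewrite py mul1e; over.
  by rewrite integral_indic// setIT.
apply: le_trans (leeD2l _ pfar).
have mpf : measurable_fun setT (fun w => (p w)%:E * far eps w).
  by apply: emeasurable_funM => //; exact: measurable_far.
have pf0 w : 0 <= (p w)%:E * far eps w by rewrite mule_ge0 ?far_ge0.
rewrite -ge0_integralD//.
apply: ge0_le_integral => //; first exact: emeasurable_funD.
move=> [a c] _ /=; rewrite -ge0_muleDr; [|by rewrite lee_fin|exact: far_ge0].
rewrite lee_wpmul2l// /far/= -EFinD lee_fin !indicE.
have [fac|nac] := leP eps (mdist (a : X) c).
  by rewrite (le_trans (_ : _ <= 1)%R) ?lern1 ?leq_b1// lerDr.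
rewrite addr0 ler_nat; case h : (a \in _) => //.
have {}h : (mdist x a < b)%R by move: h; rewrite ballEmdist => /set_mem.
rewrite mem_set// ballEmdist/=.
by have := mdist_triangle x a c; move: h nac bb; lra.
Qed.

End tails.

(** * Plans for the renormalized cost *)

Section plans.
Context {R : realType} {X : polishMetricType R} (f : R -> \bar R) (o : X) (d0 : R).
Local Notation BX := (borelType X).
Hypotheses (f0 : f 0 = +oo%E) (f_fin : forall t, 0 < t -> f t \is a fin_num).
Hypothesis f_cont : {within [set t : R | 0 < t], continuous f}.
Hypothesis f_decr : forall s t : R, 0 < s -> s <= t -> (f t <= f s)%E.
Hypothesis f_lim0 : f t @[t --> 0^'+] --> +oo%E.
Hypotheses (d0_gt0 : 0 < d0) (fd0 : forall t, 0 < t -> t <= d0 -> 0 <= fine (f t)).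

Local Notation g := (gauge f o d0).
Let g0 x : 0 <= g x. Proof. exact: gauge_ge0. Qed.
Let mg : measurable_fun [set: BX] g. Proof. exact: (measurable_gauge o f_fin f_cont d0_gt0). Qed.

(** If [f] never takes a negative value the gauge vanishes. Otherwise [f] is
    nonpositive from some [t1] on, so that far from [o] the gauge is the opposite
    of [f (2 * mdist x o)], whose integral is uniformly small there. *)
Lemma gauge_tails (rho : nat -> probability BX R) (tau : R) :
  (forall eps : R, 0 < eps -> \forall r \near +oo, forall n : nat,
    (`| \int[rho n]_(x in ~` ball o r) f (2 * mdist x o)%R | < eps%:E)%E) ->
  0 < tau -> exists2 A, 0 <= A &
    forall n, (\int[rho n]_x (excess g A x)%:E <= tau%:E)%E.
Proof.
move=> h_unif tau0.
have [[t1 [t10 ft1]]|fpos] := pselect (exists t1, 0 < t1 /\ fine (f t1) < 0); last first.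
  have gE0 x : g x = 0.
    rewrite /gauge max_l// oppr_le0 leNgt; apply/negP => h; apply: fpos.
    by exists (Num.max d0 (2 * mdist x o)); split; first by rewrite lt_max d0_gt0.
  exists 0 => // n; rewrite integral0_eq; first by rewrite lee_fin ltW.
  by move=> x _; rewrite /excess gE0 subr0 max_l.
have [r [_ hr]] := h_unif _ tau0.
pose r1 := Num.max (r + 1) (Num.max t1 d0).
have r1r : r < r1 by rewrite lt_max ltrDl ltr01.
have r1t : t1 <= r1 by rewrite !le_max lexx !orbT.
have r1d : d0 <= r1 by rewrite !le_max lexx !orbT.
pose A := Num.max 0 (- clamp f d0 (2 * r1)).
have A0 : 0 <= A by rewrite le_max lexx.
exists A => // n; have {}hr := hr r1 r1r n.
pose D : set BX := ~` ball o r1.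
have DE x : D x -> r1 <= mdist x o.
  by rewrite /D ballEmdist /= => /negP; rewrite -leNgt mdistC.
have mD : measurable D.
  by apply: measurableC; exact: measurable_mball.
have fE x : D x -> f (2 * mdist x o) = (- g x)%:E.
  move=> /DE dx.
  have tx : t1 <= 2 * mdist x o by have := mdist_ge0 x o; move: r1t dx; lra.
  have dx2 : d0 <= 2 * mdist x o by have := mdist_ge0 x o; move: r1d dx; lra.
  rewrite /gauge /clamp (max_r dx2) max_r ?opprK ?fine_f//.
    exact: lt_le_trans tx.
  rewrite oppr_ge0 (le_trans _ (ltW ft1))//; exact: (fine_decr f_fin f_decr).
have exE x : (excess g A x)%:E = ((fun x => (excess g A x)%:E) \_ D) x.
  rewrite patchE; case: ifPn => // /negP xD.
  have {}xD : ~ D x by move=> h; apply: xD; rewrite inE.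
  have dx : mdist x o < r1.
    by apply: contra_notT xD; rewrite -leNgt /D ballEmdist/= mdistC => h; apply/negP; rewrite -leNgt.
  rewrite /excess max_l// subr_le0 /A /gauge ge_max !le_max lexx/=.
  rewrite lerN2 (clamp_decr f_fin f_decr)// ?orbT//.
  by move: dx; lra.
have gDfin : (`|\int[rho n]_(x in D) (g x)%:E| < tau%:E)%E.
  move: hr; rewrite (eq_integral (fun x : BX => - (g x)%:E)%E); last first.
    by move=> x /set_mem /fE ->.
  rewrite integral_ge0N; last by move=> x _; rewrite lee_fin.
  by rewrite abseN.
have -> : (\int[rho n]_x (excess g A x)%:E = \int[rho n]_(x in D) (excess g A x)%:E)%E.
  by rewrite [RHS]integral_mkcond; apply: eq_integral => x _; exact: exE.
apply: (@le_trans _ _ (\int[rho n]_(x in D) (g x)%:E)%E).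
  apply: ge0_le_integral => //.
  - by move=> x _; rewrite lee_fin excess_ge0.
  - by apply: measurable_funTS; exact: measurable_excess.
  - by apply: measurable_funTS; exact/measurable_EFinP.
  - by move=> x _; rewrite lee_fin /excess ge_max g0/= gerBl.
apply: le_trans (ltW gDfin); exact: lee_abs.
Qed.

Section plan_integrals.
Context {N : nat}.
Local Notation BXN := (borelType {ptws 'I_N -> X}).
Local Notation plan rho gamma := (has_marginals gamma (fun=> rho)).

Definition mean_gauge (rho : probability BX R) : R := fine (\int[rho]_x (g x)%:E)%E.

(** The integral of [pair_gauge] under any plan with marginals [rho]. *)
Definition gauge_constant (rho : probability BX R) : R :=
  pair_sum (fun _ _ : 'I_N => mean_gauge rho + mean_gauge rho).

Lemma integral_pair_gauge rho (gamma : probability BXN R) : plan rho gamma ->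
  (\int[rho]_x (g x)%:E)%E \is a fin_num ->
  (\int[gamma]_x (pair_gauge f o d0 x)%:E = (gauge_constant rho)%:E)%E.
Proof.
move=> gr gfin.
have mgi (i : 'I_N) : measurable_fun [set: BXN] (fun x : BXN => (g (x i))%:E).
  by apply/measurable_EFinP; exact: (measurableT_comp mg (measurable_coord i)).
have igi (i : 'I_N) : (\int[gamma]_x (g (x i))%:E = (mean_gauge rho)%:E)%E.
  rewrite (ge0_integral_marginal i (psi := fun x => (g x)%:E) gr) ?fineK//.
  exact/measurable_EFinP.
pose c (i j : 'I_N) (x : BXN) : \bar R :=
  (if (i < j)%N then (g (x i))%:E + (g (x j))%:E else 0)%E.
have mc i j : measurable_fun setT (c i j).
  by rewrite /c; case: (i < j)%N => //; exact: emeasurable_funD.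
have c0 i j x : (0 <= c i j x)%E.
  by rewrite /c; case: ifP => // _; rewrite adde_ge0// lee_fin.
have -> : (\int[gamma]_x (pair_gauge f o d0 x)%:E =
    \int[gamma]_x \sum_(i < N) \sum_(j < N) c i j x)%E.
  apply: eq_integral => x _; rewrite /pair_gauge /pair_sum -sumEFin.
  by apply: eq_bigr => i _; rewrite -sumEFin big_mkcond.
rewrite ge0_integral_sum//; first last.
- by move=> i x _; apply: sume_ge0.
- by move=> i; apply: emeasurable_sum.
rewrite /gauge_constant /pair_sum -sumEFin; apply: eq_bigr => i _.
rewrite ge0_integral_sum// -sumEFin [RHS]big_mkcond; apply: eq_bigr => j _.
rewrite /c; case: (i < j)%N; last by rewrite integral0.
by rewrite ge0_integralD// ?igi ?EFinD// => x _; rewrite lee_fin.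
Qed.

Lemma renormalized_energy_fin delta rho (gamma : probability BXN R) :
  0 < delta -> delta <= d0 -> plan rho gamma ->
  (\int[rho]_x (g x)%:E)%E \is a fin_num ->
  (\int[gamma]_x (pair_energy (renormalized f o d0 delta) x)%:E)%E \is a fin_num.
Proof.
move=> delta0 dd0 gr gfin.
have mF i j : measurable_fun [set: BXN] (fun x => renormalized f o d0 delta (x i) (x j)).
  by apply: (measurable_renormalized o f_fin f_cont d0_gt0) => //; exact: measurable_coord.
have e0 (x : BXN) : 0 <= pair_energy (renormalized f o d0 delta) x.
  by apply: pair_energy_ge0 => y z; exact: (renormalized_ge0 o f_fin f_decr fd0).
rewrite ge0_fin_numE; last by apply: integral_ge0 => x _; rewrite lee_fin.
pose c := pair_sum (fun _ _ : 'I_N => fine (f delta)).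
have c0 : 0 <= c by apply: pair_sum_ge0 => *; exact: fd0.
have mG := @measurable_pair_gauge _ _ f o d0 f_fin f_cont d0_gt0 N.
apply: (@le_lt_trans _ _ (\int[gamma]_x (c%:E + (pair_gauge f o d0 x)%:E))%E).
  apply: ge0_le_integral => //.
  - by move=> x _; rewrite lee_fin.
  - by apply/measurable_EFinP; exact: measurable_pair_energy.
  - by apply: emeasurable_funD => //; exact/measurable_EFinP.
  - move=> x _; rewrite -EFinD lee_fin -pair_sumD; apply: le_pair_sum => i j _.
    by rewrite addrA; exact: (renormalized_le o d0 f_fin f_decr).
rewrite ge0_integralD//; last 2 first.
- by move=> x _; rewrite lee_fin pair_gauge_ge0.
- exact/measurable_EFinP.
rewrite integral_cst//= probability_setT mule1 (integral_pair_gauge gr gfin).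
by rewrite -EFinD ltry.
Qed.

(** The image of [rho] under the diagonal. *)
Lemma diagonal_plan (rho : probability BX R) :
  exists gamma : probability BXN R, plan rho gamma.
Proof.
pose S (w : BX * BX) : BXN := fun=> w.1.
have mS : measurable_fun setT S by apply: measurable_coordP => i; exact: measurable_fst.
have p1 : (\int[rho \x rho]_w (1%R)%:E = 1)%E.
  rewrite fubini_tonelli1// /fubini_F/=.
  under eq_integral do rewrite integral_cst//= mul1e probability_setT.
  by rewrite integral_cst//= mul1e probability_setT.
have [gamma hg] := transported_probability (@measurable_cst _ _ _ _ setT (1 : R)) (fun=> ler01) mS p1.
exists gamma; apply: has_marginalsP => i psi mpsi psi0.
rewrite (hg (fun x => psi (x i)))//; last exact: (measurableT_comp mpsi (measurable_coord i)).
under eq_integral do rewrite mul1e.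
rewrite /S fubini_tonelli1//; last exact: (measurableT_comp mpsi).
apply: eq_integral => x _; rewrite /fubini_F/=.
by rewrite integral_cst//= probability_setT mule1.
Qed.

(** Adding the gauge turns the transport problem into one with a nonnegative
    cost, at the price of a constant that only depends on the marginal. *)
Lemma integral_pair_cost rho (gamma : probability BXN R) : plan rho gamma ->
  (\int[rho]_x (g x)%:E)%E \is a fin_num ->
  (\int[gamma]_x (pair_cost f x + (pair_gauge f o d0 x)%:E) =
   \int[gamma]_x (pair_cost f x) + (gauge_constant rho)%:E)%E.
Proof.
move=> gr gfin; rewrite -(integral_pair_gauge gr gfin) ge0_integral_addr//.
- exact: (measurable_pair_cost f0 f_fin f_cont f_lim0).
- exact: (measurable_pair_gauge o f_fin f_cont d0_gt0).
- by move=> x; exact: pair_gauge_ge0.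
- by move=> x; exact: (pair_cost_gauge_ge0 o f0 f_fin f_decr d0_gt0 fd0).
- by rewrite (integral_pair_gauge gr gfin).
Qed.

End plan_integrals.
End plans.

(** * Comparison of the costs of two measures *)

Section stability.
Context {R : realType} {X : polishMetricType R} {N : nat}.
Variables (f : R -> \bar R) (o : X) (d0 : R).
Local Notation BX := (borelType X).
Local Notation BXN := (borelType {ptws 'I_N -> X}).
Hypotheses (f0 : f 0 = +oo%E) (f_fin : forall t, 0 < t -> f t \is a fin_num).
Hypothesis f_cont : {within [set t : R | 0 < t], continuous f}.
Hypothesis f_decr : forall s t : R, 0 < s -> s <= t -> (f t <= f s)%E.
Hypothesis f_lim0 : f t @[t --> 0^'+] --> +oo%E.
Hypotheses (d0_gt0 : 0 < d0) (fd0 : forall t, 0 < t -> t <= d0 -> 0 <= fine (f t)).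

Local Notation g := (gauge f o d0).
Local Notation plan rho gamma := (has_marginals gamma (fun=> rho)).
Local Notation energy delta gamma :=
  (\int[gamma]_x (pair_energy (renormalized f o d0 delta) x)%:E)%E.

Let g0 x : 0 <= g x. Proof. exact: gauge_ge0. Qed.
Let mg : measurable_fun [set: BX] g. Proof. exact: (measurable_gauge o f_fin f_cont d0_gt0). Qed.

(* [height] is a modulus of uniform integrability of the gauge. All the scales
   below are chosen from it, hence are common to the measures that share it. *)
Variable height : R -> R.
Hypothesis height0 : forall tau, 0 < tau -> 0 <= height tau.

Definition tight_gauge (rho : probability BX R) : Prop :=
  forall tau, 0 < tau -> (\int[rho]_x (excess g (height tau) x)%:E <= tau%:E)%E.

Lemma tight_gauge_fin rho : tight_gauge rho -> (\int[rho]_x (g x)%:E)%E \is a fin_num.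
Proof.
by move=> /(_ 1 ltr01); exact: ge0_integral_fin_num_excess mg g0 (height0 ltr01).
Qed.

(* the quotient by [c + 1] spares a case distinction on [c = 0] *)
Let le_share (c eta : R) : 0 <= c -> 0 <= eta -> c * (eta / (c + 1)) <= eta.
Proof.
move=> c0 eta0; rewrite mulrCA ler_piMr//.
by rewrite ler_pdivrMr ?mul1r ?lerDl// ltr_wpDl.
Qed.

Let share_gt0 (c eta : R) : 0 <= c -> 0 < eta -> 0 < eta / (c + 1).
Proof. by move=> c0 eta0; rewrite divr_gt0// ltr_wpDl. Qed.

Let mF delta (i j : 'I_N) : 0 < delta ->
  measurable_fun [set: BXN] (fun x => renormalized f o d0 delta (x i) (x j)).
Proof.
by move=> delta0; apply: (measurable_renormalized o f_fin f_cont d0_gt0) => //;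
  exact: measurable_coord.
Qed.

Section uncrowd.
Variables (b kappa : R).
Hypotheses (b0 : 0 < b) (kappa0 : 0 <= kappa).
Hypothesis kappa_lt : 0 < 1 - 2 * N.-1%:R * kappa.

Definition spread_measure (rho : probability BX R) : Prop :=
  forall x : X, (rho (ball x b) <= kappa%:E)%E.

(** Choice of the constants of [uncrowded_plan], in the order: the tail [tau], the
    mass [mbar] that is cheap to repair, the energy [M0] of a close pair that
    keeps the crowded mass below [mbar], and the distance [delta] below which
    [f] exceeds [M0]. *)
Lemma uncrowding_scale (eta : R) : 0 < eta ->
  exists delta, [/\ 0 < delta, delta <= d0 &
    forall (rho : probability BX R) (gamma : probability BXN R),
      tight_gauge rho -> spread_measure rho -> plan rho gamma ->
      exists gamma' : probability BXN R, [/\ plan rho gamma',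
        (energy delta gamma' <= energy delta gamma + eta%:E)%E &
        forall i, gamma' [set x | crowded delta i x] = 0%E]].
Proof.
move=> eta0.
pose z0 := 1 - 2 * N.-1%:R * kappa.
pose K := Num.max 0 (fine (f b)).
have K0 : 0 <= K by rewrite le_max lexx.
have eta4 : 0 < eta / 4 by rewrite divr_gt0.
pose c1 := N%:R * (4 * N%:R ^+ 2) : R.
have c10 : 0 <= c1 by rewrite !mulr_ge0.
pose tau := eta / 4 / (c1 + 1).
have tau0 : 0 < tau by exact: share_gt0.
have ltau : c1 * tau <= eta / 4 by apply: le_share => //; exact: ltW.
pose A := height tau.
have A0 : 0 <= A by exact: height0.
pose C := (2 * K + 4 * A) * N%:R ^+ 2.
have C0 : 0 <= C by rewrite mulr_ge0// addr_ge0 ?mulr_ge0.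
have NC0 : 0 <= N%:R * C by rewrite mulr_ge0.
pose T := 4 * N%:R ^+ 2 * tau.
have T0 : 0 <= T by apply: mulr_ge0; [rewrite mulr_ge0|exact: ltW].
pose mbar := Num.min (z0 / 2) (eta / 4 / (N%:R * C + 1)).
have mbar0 : 0 < mbar by rewrite lt_min divr_gt0//= share_gt0.
have mbarz : 2 * mbar <= z0.
  have : mbar <= z0 / 2 by rewrite ge_min lexx.
  lra.
have lmbar : N%:R * C * mbar <= eta / 4.
  apply: le_trans (le_share NC0 (ltW eta4)); rewrite ler_wpM2l//.
  by rewrite ge_min lexx orbT.
pose Q := N%:R * (eta / 4 + C + T).
have zm0 : 0 < z0 / 2 * mbar by rewrite mulr_gt0// divr_gt0.
pose M0 := Num.max 1 (Q / (z0 / 2 * mbar)).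
have [d1 d10 hd1] := large_near0 f_fin f_lim0 M0.
pose delta := Num.min d1 (Num.min d0 b).
have delta0 : 0 < delta by rewrite !lt_min d10 d0_gt0 b0.
have dd0 : delta <= d0 by rewrite !ge_min lexx !orbT.
have db : delta <= b by rewrite !ge_min lexx !orbT.
have M0le : M0 <= fine (f delta) by apply: hd1 => //; rewrite ge_min lexx.
have M1 : 0 < fine (f delta).
  by apply: lt_le_trans M0le; rewrite lt_max ltr01.
exists delta; split => // rho gamma trho srho gr.
have gfin := tight_gauge_fin trho.
have QM : Q <= fine (f delta) * (z0 / 2) * mbar.
  rewrite -mulrA -ler_pdivrMr//; apply: le_trans M0le.
  by rewrite le_max lexx orbT.
have [gamma' [g'r g'e g'0]] := @uncrowded_plan R X N (renormalized f o d0 delta) g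
  delta b K (fine (f delta)) A tau kappa rho
  (fun x y => renormalized_ge0 o f_fin f_decr fd0 x y delta0 dd0) g0 mg
  (fun i j => mF i j delta0) K0 (ltW M1) A0 db
  (fun x y => renormalized_far o d0 f_fin f_decr delta0 b0)
  (fun x y => renormalized_close f o delta0 dd0)
  kappa0 srho (trho _ tau0) kappa_lt
  (fun gamma gr => renormalized_energy_fin f_fin f_cont f_decr d0_gt0 fd0 delta0 dd0 gr gfin)
  gamma (eta / 4) mbar gr eta4 mbar0 mbarz QM M1.
exists gamma'; split => //; apply: (le_trans g'e).
rewrite leeD2l// lee_fin -/C -/T mulrDr mulrA.
have : N%:R * T <= eta / 4 by rewrite /T mulrA.
by move: lmbar eta4; rewrite mulrA; lra.
Qed.

End uncrowd.

(** Choice of the constants of [transfer_all]: the clamped interaction is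
    uniformly continuous, being Lipschitz at infinity and constant near [0]. *)
Lemma transfer_scale (alpha delta eta : R) :
  [lipschitz fine (f t) | t in [set t : R | alpha <= t]] ->
  0 < delta -> delta <= d0 -> 0 < eta ->
  exists2 eps, 0 < eps & forall (mu nu : probability BX R) p (gamma : probability BXN R),
    tight_gauge mu -> tight_gauge nu -> transfer_density mu nu eps p -> plan mu gamma ->
    exists gamma' : probability BXN R, plan nu gamma' /\
      (energy delta gamma' <= energy delta gamma + eta%:E)%E.
Proof.
move=> f_lip delta0 dd0 eta0.
have eta3 : 0 < eta / 3 by rewrite divr_gt0.
pose K := fine (f delta) * N%:R ^+ 2.
have K0 : 0 <= K by rewrite mulr_ge0 ?fd0.
pose C := 2 * N%:R : R.
have C0 : 0 <= C by rewrite mulr_ge0.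
pose c1 := N%:R * (C * N.+1%:R).
have c10 : 0 <= c1 by rewrite !mulr_ge0.
pose tau := eta / 3 / (c1 + 1).
have tau0 : 0 < tau by exact: share_gt0.
have ltau : c1 * tau <= eta / 3 by apply: le_share => //; exact: ltW.
pose A := height tau.
have A0 : 0 <= A by exact: height0.
pose c2 := N%:R * (K + C * N.+1%:R * A).
have c20 : 0 <= c2 by rewrite mulr_ge0// addr_ge0// !mulr_ge0.
pose c3 := N%:R * (3 * N%:R ^+ 2) : R.
have c30 : 0 <= c3 by rewrite !mulr_ge0.
pose w := eta / 3 / (c3 + 1).
have w0 : 0 < w by exact: share_gt0.
have lw : c3 * w <= eta / 3 by apply: le_share => //; exact: ltW.
have [e1 e10 he1] := uniform_continuous_clamp f_fin f_cont delta0 w0 f_lip.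
have [e2 e20 he2] := uniform_continuous_clamp f_fin f_cont d0_gt0 w0 f_lip.
pose eps := Num.min (eta / 3 / (c2 + 1)) (Num.min (e1 / 2) (e2 / 2)).
have eps0 : 0 < eps by rewrite !lt_min share_gt0// !divr_gt0.
have leps : c2 * eps <= eta / 3.
  apply: le_trans (le_share c20 (ltW eta3)); rewrite ler_wpM2l//.
  by rewrite ge_min lexx.
have eps1 : eps <= e1 / 2 by rewrite !ge_min lexx !orbT.
have eps2 : eps <= e2 / 2 by rewrite !ge_min lexx !orbT.
exists eps => // mu nu p gamma tmu tnu hp gmu.
pose F := renormalized f o d0 delta.
have F0 x y : 0 <= F x y by exact: (renormalized_ge0 o f_fin f_decr fd0).
have g_near x x' : mdist x x' < eps -> g x' <= g x + w.
  move=> xx'; rewrite -lerBlDl (le_trans (ler_norm _))//.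
  apply: le_trans (gauge_dist _ _ _ _ _) _; apply: he2.
  rewrite -mulrBr normrM gtr0_norm//.
  have := mdist_dist x' x o; rewrite (mdistC x' x).
  by move: xx' eps2; lra.
have F_near x y x' y' : mdist x x' < eps -> mdist y y' < eps -> F x' y' <= F x y + 3 * w.
  move=> xx' yy'.
  have : clamp f delta (mdist x' y') <= clamp f delta (mdist x y) + w.
    rewrite -lerBlDl (le_trans (ler_norm _))//; apply: he1.
    have h1 := mdist_dist x' x y'; rewrite (mdistC x' x) in h1.
    have h2 := mdist_dist y' y x; rewrite (mdistC y' x) (mdistC y x) (mdistC y' y) in h2.
    have := ler_normD (mdist x' y' - mdist x y') (mdist x y' - mdist x y).
    rewrite addrA subrK; move: h1 h2 xx' yy' eps1; lra.
  by have := g_near _ _ xx'; have := g_near _ _ yy'; rewrite /F /renormalized; lra.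
pose omega := 3 * w * N%:R ^+ 2.
have omega0 : 0 <= omega by rewrite mulr_ge0// mulr_ge0// ltW.
have phi_near (x x' : BXN) : (forall a, mdist (x a : X) (x' a) < eps) ->
    pair_energy F x' <= pair_energy F x + omega.
  move=> xx'.
  apply: (@le_trans _ _ (pair_sum (fun i j : 'I_N => F (x i) (x j) + (3 * w + (0 + 0))))).
    by apply: le_pair_sum => i j _; rewrite !addr0 F_near.
  rewrite pair_sumD lerD2l (le_trans (@pair_sum_le_sum R N (3 * w) (fun=> 0) _ _))//.
    by rewrite mulr_ge0// ltW.
  by rewrite big1// mulr0 addr0.
have phi_far (x : BXN) : pair_energy F x <= K + C * \sum_(a < N) g (x a).
  apply: le_trans (pair_sum_le_sum (fd0 delta0 dd0) (fun a => g0 (x a))).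
  apply: le_pair_sum => i j _; rewrite addrA.
  exact: (renormalized_le o d0 f_fin f_decr).
have phi0 (x : BXN) : 0 <= pair_energy F x by exact: pair_energy_ge0.
have mphi : measurable_fun [set: BXN] (pair_energy F).
  by apply: measurable_pair_energy => i j; exact: mF.
have [gamma' [g'r g'e]] := transfer_all mg g0 mphi phi0 eps0 K0 C0 A0 omega0 phi_near
  phi_far gmu hp (tmu _ tau0) (tnu _ tau0).
exists gamma'; split => //; apply: (le_trans g'e).
rewrite leeD2l// lee_fin.
rewrite [leLHS](_ : _ = c3 * w + c2 * eps + c1 * tau); last first.
  by rewrite /omega /c1 /c2 /c3; ring.
by move: lw leps ltau; lra.
Qed.

Section comparison.
Variables (b kappa alpha : R).
Hypotheses (b0 : 0 < b) (kappa0 : 0 <= kappa).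
Hypothesis kappa_lt : 0 < 1 - 2 * N.-1%:R * kappa.
Hypothesis f_lip : [lipschitz fine (f t) | t in [set t : R | alpha <= t]].

Let constant rho := @gauge_constant _ _ f o d0 N rho.

(** Away from crowding the truncation is not felt. *)
Lemma uncrowded_cost delta (rho : probability BX R) (gamma : probability BXN R) :
  0 < delta -> delta <= d0 -> tight_gauge rho -> plan rho gamma ->
  (forall i, gamma [set x | crowded delta i x] = 0)%E ->
  (\int[gamma]_x pair_cost f x + (constant rho)%:E = energy delta gamma)%E.
Proof.
move=> delta0 dd0 trho gr h0; have gfin := tight_gauge_fin trho.
rewrite -(integral_pair_cost f0 f_fin f_cont f_decr f_lim0 d0_gt0 fd0 gr gfin).
apply: ge0_ae_eq_integral => //.
- apply: emeasurable_funD; first exact: (measurable_pair_cost f0 f_fin f_cont f_lim0).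
  by apply/measurable_EFinP; exact: (measurable_pair_gauge o f_fin f_cont d0_gt0).
- by apply/measurable_EFinP; apply: measurable_pair_energy => i j; exact: mF.
- by move=> x _; exact: (pair_cost_gauge_ge0 o f0 f_fin f_decr d0_gt0 fd0).
- move=> x _; rewrite lee_fin; apply: pair_energy_ge0 => y z.
  exact: (renormalized_ge0 o f_fin f_decr fd0).
have : \forall x \ae gamma, forall i, ~~ crowded delta i x.
  apply: filter_forall => i; exists [set x | crowded delta i x]; split => //.
    exact: measurable_crowded.
  by move=> x /= /negP; rewrite negbK.
apply: filterS => x nx _.
exact/esym/(pair_energy_eq_cost o d0 f_fin).
Qed.

(** From a plan for [mu]: truncate, which lowers the cost; carry the plan to
    [nu]; remove the crowding, after which the truncated cost is the cost. *)
Lemma transport_cost_le (eta : R) : 0 < eta ->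
  exists2 eps, 0 < eps & forall (mu nu : probability BX R) p,
    tight_gauge mu -> tight_gauge nu -> spread_measure b kappa nu ->
    transfer_density mu nu eps p ->
    (transport_cost N f nu + (constant nu)%:E <=
     transport_cost N f mu + (constant mu)%:E + eta%:E)%E.
Proof.
move=> eta0; have eta2 : 0 < eta / 2 by rewrite divr_gt0.
have [delta [delta0 dd0 huncrowd]] := uncrowding_scale b0 kappa0 kappa_lt eta2.
have [eps eps0 htransfer] := transfer_scale f_lip delta0 dd0 eta2.
exists eps => // mu nu p tmu tnu snu hp.
have munu (gamma : probability BXN R) : plan mu gamma -> (transport_cost N f nu + (constant nu)%:E <=
    \int[gamma]_x pair_cost f x + (constant mu)%:E + eta%:E)%E.
  move=> gmu.
  have [g1 [g1nu g1e]] := htransfer _ _ _ _ tmu tnu hp gmu.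
  have [g2 [g2nu g2e g20]] := huncrowd _ _ tnu snu g1nu.
  apply: (@le_trans _ _ (\int[g2]_x pair_cost f x + (constant nu)%:E)%E).
    by apply: leeD2r; apply: ereal_inf_lbound; exists g2.
  rewrite (uncrowded_cost delta0 dd0 tnu g2nu g20) (le_trans g2e)//.
  have -> : (eta%:E = (eta / 2)%:E + (eta / 2)%:E :> \bar R)%E by rewrite -EFinD -splitr.
  rewrite addeA leeD2r// (le_trans g1e)// leeD2r//.
  rewrite -(integral_pair_cost f0 f_fin f_cont f_decr f_lim0 d0_gt0 fd0 gmu (tight_gauge_fin tmu)).
  apply: ge0_le_integral => //.
  - move=> x _; rewrite lee_fin; apply: pair_energy_ge0 => y z.
    exact: (renormalized_ge0 o f_fin f_decr fd0).
  - by apply/measurable_EFinP; apply: measurable_pair_energy => i j; exact: mF.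
  - apply: emeasurable_funD; first exact: (measurable_pair_cost f0 f_fin f_cont f_lim0).
    by apply/measurable_EFinP; exact: (measurable_pair_gauge o f_fin f_cont d0_gt0).
  - by move=> x _; exact: (pair_energy_le_cost o d0 f0 f_fin f_decr).
rewrite -addeA -EFinD -leeBlDr//; apply: le_ereal_inf_tmp => _ [gamma gmu <-].
by rewrite leeBlDr// EFinD addeA; exact: munu.
Qed.

(** The cost is bounded below by the opposite of the gauge constant, and the
    plan obtained by removing the crowding of any plan bounds it above. *)
Lemma transport_cost_fin (rho : probability BX R) :
  tight_gauge rho -> spread_measure b kappa rho -> transport_cost N f rho \is a fin_num.
Proof.
move=> trho srho.
have [delta [delta0 dd0 huncrowd]] := uncrowding_scale b0 kappa0 kappa_lt ltr01.
have [g1 g1r] := @diagonal_plan R X N rho.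
have [g2 [g2r _ g20]] := huncrowd _ _ trho srho g1r.
have gfin := tight_gauge_fin trho.
have ge_const (gamma : probability BXN R) : plan rho gamma -> (- (constant rho)%:E <= \int[gamma]_x pair_cost f x)%E.
  move=> gr; rewrite -[leLHS]add0e leeBlDr//.
  rewrite -(integral_pair_cost f0 f_fin f_cont f_decr f_lim0 d0_gt0 fd0 gr gfin).
  by apply: integral_ge0 => x _; exact: (pair_cost_gauge_ge0 o f0 f_fin f_decr d0_gt0 fd0).
have c2 := uncrowded_cost delta0 dd0 trho g2r g20.
have e2 := renormalized_energy_fin f_fin f_cont f_decr d0_gt0 fd0 delta0 dd0 g2r gfin.
have {}c2 : (\int[g2]_x pair_cost f x)%E \is a fin_num.
  by move: e2; rewrite -c2 fin_numD => /andP[].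
rewrite fin_numElt; apply/andP; split.
  apply: (@lt_le_trans _ _ (- (constant rho)%:E)%E); first by rewrite -EFinN ltNyr.
  by apply: le_ereal_inf_tmp => _ [gamma gr <-]; exact: ge_const.
apply: (@le_lt_trans _ _ (\int[g2]_x pair_cost f x)%E); last by rewrite ltey_eq c2.
by apply: ereal_inf_lbound; exists g2.
Qed.

End comparison.
End stability.

(** * Continuity of the transport cost *)

Lemma gauge_constant_cvg (R : realType) (X : polishMetricType R) (N : nat) (f : R -> \bar R)
    (o : X) (d0 : R) (rho : nat -> probability (borelType X) R) rhoo :
  mean_gauge f o d0 (rho n) @[n --> \oo] --> mean_gauge f o d0 rhoo ->
  gauge_constant (N := N) f o d0 (rho n) @[n --> \oo] --> gauge_constant (N := N) f o d0 rhoo.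
Proof.
move=> h; have gE nu : gauge_constant (N := N) f o d0 nu =
    (mean_gauge f o d0 nu + mean_gauge f o d0 nu) * pair_sum (fun _ _ : 'I_N => 1).
  rewrite /gauge_constant /pair_sum mulr_sumr; apply: eq_bigr => i _.
  by rewrite mulr_sumr; apply: eq_bigr => j _; rewrite mulr1.
rewrite gE; under eq_fun do rewrite gE.
by apply: cvgM; [exact: cvgD|exact: cvg_cst].
Qed.

Theorem proposition5p4 (R : realType) (X : polishMetricType R)
  (N : nat) (N_ge2 : (2 <= N)%N)
  (f : R -> \bar R)
  (f0 : f 0 = +oo%E)
  (f_fin : forall t : R, 0 < t -> f t \is a fin_num)
  (f_cont : {within [set t : R | 0 < t], continuous f})
  (f_decr : forall s t : R, 0 < s -> s <= t -> (f t <= f s)%E)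
  (f_lim0 : f t @[t --> 0^'+] --> +oo%E)
  (rho : nat -> probability (borelType X) R)
  (rhoo : probability (borelType X) R)
  (rho_cvg : weak_cvg rho rhoo)
  (hA : (lim (ereal_sup [set rhoo (ball x r) | x in [set: X]] @[r --> 0^'+])
         < ((N * (N - 1) ^ 2)%:R^-1)%:E)%E)
  (o : X) (r0 : R) (r0_gt0 : 0 < r0)
  (hB : (-oo < \int[rhoo]_(x in ~` ball o r0) f (2 * mdist x o)%R)%E)
  (beta : R) (beta_gt0 : 0 < beta)
  (hbeta : (ereal_sup [set rhoo (ball x beta) | x in [set: X]]
            < ((N * (N - 1) ^ 2)%:R^-1)%:E)%E)
  (alpha : R) (alpha_gt0 : 0 < alpha)
  (halpha : (alpha%:E
             < left_inv_fun f (((N ^ 2 * (N - 1))%:R / 2)%:E * f beta))%E)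
  (f_lip : [lipschitz fine (f t) | t in [set t : R | alpha <= t]])
  (h_unif : forall eps : R, 0 < eps -> \forall r \near +oo, forall n : nat,
    (`| \int[rho n]_(x in ~` ball o r) f (2 * mdist x o)%R | < eps%:E)%E) :
  transport_cost N f (rho n) @[n --> \oo] --> transport_cost N f rhoo.
Proof.
have [d0 d00 fd0] := large_near0 f_fin f_lim0 0.
have tails := gauge_tails (o := o) f_fin f_cont f_decr d00 (rho := rho) ^~ h_unif.
have /choice[height hheight] : forall tau, exists A, 0 < tau -> 0 <= A /\
    forall n, (\int[rho n]_x (excess (gauge f o d0) A x)%:E <= tau%:E)%E.
  move=> tau; have [tau0|_] := ltP 0 tau; last by exists 0.
  by have [A A0 hA'] := tails _ tau0; exists A.
have height0 tau : 0 < tau -> 0 <= height tau by move=> /hheight[].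
have trho n : tight_gauge f o d0 height (rho n) by move=> tau /hheight[_]; exact.
have g0 := @gauge_ge0 R X f o d0.
have cg := continuous_gauge f_fin f_cont d00 (o := o).
have trhoo : tight_gauge f o d0 height rhoo.
  move=> tau tau0; apply: (weak_cvg_integral_le rho_cvg).
  - exact: continuous_excess.
  - by move=> x; exact: excess_ge0.
  - by move=> n; exact: trho.
have mean_cvg : mean_gauge f o d0 (rho n) @[n --> \oo] --> mean_gauge f o d0 rhoo.
  apply/cvgrPdist_le => e e0.
  have := tight_integral_cvg rho_cvg cg g0 tails e0.
  by apply: filterS => n; rewrite distrC.
have const_cvg := @gauge_constant_cvg R X N f o d0 rho rhoo mean_cvg.
(* [kappa] lies strictly between the concentration of [rhoo] and its bound: the
   room below is for the passage from [rhoo] to [rho n] *)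
pose kappa0 : R := (N * (N - 1) ^ 2)%:R^-1.
pose s := ereal_sup [set rhoo (ball x beta) | x in [set: X]].
have le_s x : (rhoo (ball x beta) <= s)%E by apply: ereal_sup_ubound; exists x.
have s0 : (0 <= s)%E := le_trans (measure_ge0 _ _) (le_s o).
have sfin : s \is a fin_num by rewrite ge0_fin_numE// (lt_trans hbeta)// ltry.
pose kappa1 := fine s.
have sE : s = kappa1%:E by rewrite /kappa1 fineK.
have kappa10 : 0 <= kappa1 by rewrite -lee_fin -sE.
have kappa1lt : kappa1 < kappa0 by rewrite -lte_fin -sE.
pose kappa := (kappa1 + kappa0) / 2.
have kappa_ge0 : 0 <= kappa by rewrite /kappa; lra.
have kappa_lt : 0 < 1 - 2 * N.-1%:R * kappa.
  have N1 : (0 < N.-1)%N by rewrite -subn1 subn_gt0.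
  (* the left-hand side is [2 / (N * (N - 1))] *)
  have : 2 * N.-1%:R * kappa0 <= 1.
    rewrite /kappa0 ler_pdivrMr ?ltr0n ?muln_gt0 ?expn_gt0 ?subn1 ?N1 ?(ltnW N_ge2)//.
    rewrite mul1r -natrM ler_nat leq_mul// expnS expn1.
    by rewrite leq_pmulr.
  have : 2 * N.-1%:R * kappa < 2 * N.-1%:R * kappa0.
    by rewrite ltr_pM2l ?mulr_gt0 ?ltr0n// /kappa; lra.
  lra.
pose b := beta / 2.
have b0 : 0 < b by rewrite divr_gt0.
have srhoo : spread_measure b kappa rhoo.
  move=> x; apply: (@le_trans _ _ (rhoo (ball x beta))).
    apply: le_measure; rewrite ?inE.
    - exact: measurable_mball.
    - exact: measurable_mball.
    - by apply: le_ball; rewrite /b; lra.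
  by rewrite (le_trans (le_s x))// sE lee_fin /kappa; lra.
pose e1 := Num.min (beta / 2) ((kappa0 - kappa1) / 2).
have e10 : 0 < e1 by rewrite lt_min b0 divr_gt0// subr_gt0.
have spread_transfer (mu : probability (borelType X) R) p :
    transfer_density mu rhoo e1 p -> spread_measure b kappa mu.
  move=> hp x; apply: (le_trans (transfer_ball (beta := beta) x hp _)).
    have : e1 <= beta / 2 by rewrite ge_min lexx.
    by rewrite /b; lra.
  apply: (@le_trans _ _ (kappa1%:E + e1%:E)%E); first by rewrite leeD2r// -sE.
  have : e1 <= (kappa0 - kappa1) / 2 by rewrite ge_min lexx orbT.
  by rewrite -EFinD lee_fin /kappa; lra.
have srho : \forall n \near \oo, spread_measure b kappa (rho n).
  have := transfer_density_weak_cvg rho_cvg e10.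
  by apply: filterS => n [p]; exact: spread_transfer.
have cost_fin (nu : probability (borelType X) R) : tight_gauge f o d0 height nu ->
    spread_measure b kappa nu -> transport_cost N f nu \is a fin_num.
  exact: (transport_cost_fin f0 f_fin f_cont f_decr f_lim0 d00 fd0 height0 b0 kappa_ge0
    kappa_lt).
have coo := cost_fin _ trhoo srhoo.
have cn : \forall n \near \oo, transport_cost N f (rho n) \is a fin_num.
  by apply: filterS srho => n; exact: cost_fin.
rewrite -(fineK coo); apply/fine_cvgP; split => //.
apply/cvgrPdist_le => eta eta0.
have eta2 : 0 < eta / 2 by rewrite divr_gt0.
have [eps eps0 hcmp] := transport_cost_le o f0 f_fin f_cont f_decr f_lim0 d00 fd0
  height0 b0 kappa_ge0 kappa_lt f_lip eta2.
have hp := transfer_density_weak_cvg rho_cvg eps0.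
have hc := (cvgrPdist_le _ _).1 const_cvg _ eta2.
near=> n.
have [p np] : exists p, transfer_density (rho n) rhoo eps p by near: n.
have sn : spread_measure b kappa (rho n) by near: n.
have fn : transport_cost N f (rho n) \is a fin_num by near: n.
have kn : `|gauge_constant (N := N) f o d0 rhoo - gauge_constant (N := N) f o d0 (rho n)|
  <= eta / 2 by near: n; exact: hc.
have := hcmp _ _ _ (trho n) trhoo srhoo np.
have := hcmp _ _ _ trhoo (trho n) sn (transfer_densityC np).
rewrite -(fineK fn) -(fineK coo) -!EFinD !lee_fin /= => h1 h2.
by move: kn; rewrite !ler_norml => /andP[k1 k2]; apply/andP; split; lra.
Unshelve. all: by end_near.
Qed.
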